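(* Let $\mathcal L$ be an oriented link with $L\ge2$ components and expand $F_{(1)^L}^{SO}(\mathcal L)=\sum_{i\ge -L}a_i(t)z^i$ as a Laurent series in $z=q-q^{-1}$ with coefficients in $\mathbb Q(t)$. If $L\ge3$, then $a_{-L}=a_{1-L}=a_{2-L}=0$, i.e. $\mathrm{val}_z(F^{SO}_{(1)^L}(\mathcal L))\ge 3-L$. If $L=2$, then $a_{-2}=a_{-1}=0$, i.e. $\mathrm{val}_z(F^{SO}_{(1)^2}(\mathcal L))\ge0$.
   Context: Let $K_{\mathcal L}(z,t)$ be the Kauffman (Dubrovnik) polynomial normalized by $K_{\bigcirc}=1$ (defined by $K_{\mathcal L}=t^{-w(D)}\Lambda(D)$, $\Lambda$ the regular isotopy invariant with $\Lambda(D_+)-\Lambda(D_-)=z(\Lambda(D_\|)-\Lambda(D_=))$, kinks contributing $t^{\pm1}$, $\Lambda(\bigcirc)=1$). For a subset $\Delta\subseteq[L]=\{1,\dots,L\}$ let $\mathcal L_\Delta$ be the sublink of components with labels in $\Delta$ and set $W_\Delta(\mathcal L)=t^{2\,lk(\mathcal L_\Delta)}\big(1+\tfrac{t-t^{-1}}{z}\big)K_{\mathcal L_\Delta}(z,t)$ (this is the colored Kauffman polynomial of $\mathcal L_\Delta$ with every component colored by the standard representation), $lk$ being the total linking number. Then $F^{SO}_{(1)^L}(\mathcal L)$ — the coefficient of $\prod_{\alpha=1}^Lpb_1(z_\alpha)$ in the orthogonal free energy $\log Z^{SO}_{CS}(\mathcal L)$ — is given by $F^{SO}_{(1)^L}(\mathcal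 L)=\sum_{r=1}^L\frac{(-1)^{r-1}}{r}\sum_{(\Delta_1,\dots,\Delta_r)}\prod_{i=1}^rW_{\Delta_i}(\mathcal L)$, the inner sum over ordered $r$-tuples of nonempty pairwise disjoint subsets with union $[L]$. *)

(* Defs.v *)
(* Combinatorial model of (unoriented / oriented) link
   diagrams on S^2 as 4-valent planar combinatorial maps, and the Kauffman
   (Dubrovnik) regular-isotopy invariant Lambda characterised by its
   defining properties (skein relation at every crossing + its value on
   descending diagrams, which are diagrams of unlinks). *)
From HB Require Import structures.
From mathcomp Require Import all_boot all_order all_algebra fraction.
Unset Printing Implicit Defensive.
Import Order.TTheory GRing.Theory Num.Theory.

(* Diagrams.  A diagram with n crossings has darts 0 .. 4n-1; dart 4i+k is
   the half-edge at position k (k = 0,1,2,3 in counterclockwise order) of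
   crossing i.  The under-strand goes through positions 0,2, the
   over-strand through positions 1,3.  [glue] is the fixed-point-free
   involution pairing half-edges into edges.  [nfree] counts crossingless
   circle components (split, unknotted). *)
Record diagram := Diagram { ncr : nat; glue : nat -> nat; nfree : nat }.

Definition dart (D : diagram) := 'I_(4 * ncr D).

Definition rotd (d : nat) : nat := 4 * (d %/ 4) + (d %% 4).+1 %% 4.
Definition oppd (d : nat) : nat := 4 * (d %/ 4) + (d %% 4 + 2) %% 4.

Definition wf_diagram (D : diagram) : Prop :=
  forall d, (d < 4 * ncr D)%N ->
    [/\ (glue D d < 4 * ncr D)%N, glue D (glue D d) = d & glue D d != d].

Definition comprel (D : diagram) : rel (dart D) :=
  fun x y => (val y == glue D x) || (val y == oppd x).
Definition facerel (D : diagram) : rel (dart D) :=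
  fun x y => val y == rotd (glue D x).
Definition graphrel (D : diagram) : rel (dart D) :=
  fun x y => [|| val y == glue D x, val y == rotd x | val x == rotd y].

Definition ncomp (D : diagram) : nat :=
  (n_comp (comprel D) predT + nfree D)%N.

(* genus 0 for every connected component of the graph (Euler formula
   V - E + F = 2 per component, with E = 2V) *)
Definition planar (D : diagram) : Prop :=
  n_comp (facerel D) predT = (ncr D + 2 * n_comp (graphrel D) predT)%N.

(* Orientations: o d = true iff the half-edge d points out of its crossing *)
Definition valid_or (D : diagram) (o : nat -> bool) : Prop :=
  forall d, (d < 4 * ncr D)%N -> o (oppd d) = ~~ o d /\ o (glue D d) = ~~ o d.

Definition csign (o : nat -> bool) (i : nat) : int :=
  if o (4 * i + 2)%N == o (4 * i + 1)%N then 1%R else (-1)%R.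

Definition writhe (D : diagram) (o : nat -> bool) : int :=
  (\sum_(i < ncr D) csign o i)%R.

Definition samecomp (D : diagram) (d e : nat) : bool :=
  [exists x : dart D, [exists y : dart D,
     [&& val x == d, val y == e & connect (comprel D) x y]]].

Definition lk2 (D : diagram) (o : nat -> bool) : int :=
  (\sum_(i < ncr D | ~~ samecomp D (4 * i) (4 * i + 1)) csign o i)%R.

(* Removing a set of crossings [rem]: at a removed crossing each remaining
   half-edge d is reconnected through [partner d]; half-edges with [drop]
   are deleted.  Closed loops created this way become free circles;
   [nf] is the number of previously free circles that are kept. *)
Fixpoint chase (D : diagram) (rem : nat -> bool) (partner : nat -> nat)
    (fuel v : nat) : nat :=
  if fuel is f.+1 then
    (if rem (v %/ 4) then chase D rem partner f (glue D (partner v)) else v)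
  else v.

Definition survivors (D : diagram) (rem : nat -> bool) : seq nat :=
  [seq i <- iota 0 (ncr D) | ~~ rem i].

Definition olddart (D : diagram) (rem : nat -> bool) (d : nat) : nat :=
  (4 * nth 0 (survivors D rem) (d %/ 4) + d %% 4)%N.
Definition newdart (D : diagram) (rem : nat -> bool) (v : nat) : nat :=
  (4 * index (v %/ 4) (survivors D rem) + v %% 4)%N.

Definition keptrem (rem drop : nat -> bool) (d : nat) : bool :=
  rem (d %/ 4) && ~~ drop d.

Definition looprel (D : diagram) (rem : nat -> bool) (partner : nat -> nat)
    (drop : nat -> bool) : rel (dart D) :=
  fun x y => [&& keptrem rem drop x, keptrem rem drop y &
                 (val y == glue D x) || (val y == partner x)].

Definition nloops (D : diagram) (rem : nat -> bool) (partner : nat -> nat)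
    (drop : nat -> bool) : nat :=
  n_comp (looprel D rem partner drop)
    [pred x : dart D | keptrem rem drop x &&
       [forall y : dart D, connect (looprel D rem partner drop) x y ==>
                    keptrem rem drop (glue D y)]].

Definition remove (D : diagram) (rem : nat -> bool) (partner : nat -> nat)
    (drop : nat -> bool) (nf : nat) : diagram :=
  Diagram (size (survivors D rem))
    (fun d => newdart D rem
       (chase D rem partner (4 * ncr D).+1 (glue D (olddart D rem d))))
    (nf + nloops D rem partner drop).

Definition pair01 (d : nat) : nat := (4 * (d %/ 4) + nth 0 [:: 1; 0; 3; 2] (d %% 4))%N.
Definition pair03 (d : nat) : nat := (4 * (d %/ 4) + nth 0 [:: 3; 2; 1; 0] (d %% 4))%N.

Definition smooth (D : diagram) (i : nat) (p : nat -> nat) : diagram :=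
  remove D (fun j => j == i) p (fun _ => false) (nfree D).

Definition switch (D : diagram) (i : nat) : diagram :=
  let r d := if d %/ 4 == i then rotd d else d in
  let rinv d := if d %/ 4 == i then rotd (rotd (rotd d)) else d in
  Diagram (ncr D) (fun d => rinv (glue D (r d))) (nfree D).

(* Descending diagrams (diagrams of unlinks).  A passage is (i, b): the
   over (b = true, darts 4i+1, 4i+3) or under (b = false, darts 4i, 4i+2)
   strand at crossing i.  tau is the "time" of traversal: each crossing is
   met first as an over-crossing, along each component tau increases except
   at its last passage, and the components are traversed one after the
   other. *)
Definition pout (o : nat -> bool) (i : nat) (b : bool) : nat :=
  if o (4 * i + b)%N then (4 * i + b)%N else (4 * i + b + 2)%N.

Definition descending (D : diagram) (o : nat -> bool) : Prop :=
  exists tau : nat -> bool -> nat,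
  [/\ (forall (i : nat) (b : bool) (j : nat) (c : bool), (i < ncr D)%N -> (j < ncr D)%N ->
          tau i b = tau j c -> i = j /\ b = c),
      (forall i, (i < ncr D)%N -> (tau i true < tau i false)%N),
      (forall (i : nat) (b : bool), (i < ncr D)%N ->
          let d := glue D (pout o i b) in
          (tau i b < tau (d %/ 4) (odd d))%N \/
          (forall (j : nat) (c : bool), (j < ncr D)%N -> samecomp D (4 * i + b) (4 * j + c) ->
              (tau j c <= tau i b)%N))
    & (forall (i : nat) (b : bool) (j : nat) (c : bool), (i < ncr D)%N -> (j < ncr D)%N ->
          ~~ samecomp D (4 * i + b) (4 * j + c) -> (tau i b < tau j c)%N ->
          forall (i' : nat) (b' : bool) (j' : nat) (c' : bool), (i' < ncr D)%N -> (j' < ncr D)%N ->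
            samecomp D (4 * i + b) (4 * i' + b') ->
            samecomp D (4 * j + c) (4 * j' + c') ->
            (tau i' b' < tau j' c')%N)].

Local Open Scope ring_scope.
Definition Qt := {fraction {poly rat}}.
Definition FF := {fraction {poly Qt}}.
Definition tvar : FF :=
  FracField.tofrac (polyC (FracField.tofrac ('X : {poly rat}) : Qt)).
Definition zvar : FF := FracField.tofrac ('X : {poly Qt}).
Definition delta : FF := 1 + (tvar - tvar^-1) / zvar.

(* Lambda is the Kauffman (Dubrovnik) regular isotopy invariant, normalised
   by Lambda(O) = 1: skein relation
     Lambda(D+) - Lambda(D-) = z (Lambda(D_||) - Lambda(D_=)),
   and on descending diagrams (unlinks) Lambda = t^{w(D)} delta^{c-1}
   (since K(unlink of c comps) = delta^{c-1}, K = t^{-w} Lambda).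
   These properties determine Lambda uniquely on planar diagrams, and the
   Kauffman invariant satisfies them. *)
Definition kauffman_lambda (Lam : diagram -> FF) : Prop :=
  (forall D, wf_diagram D -> planar D -> forall i, (i < ncr D)%N ->
     Lam D - Lam (switch D i) = zvar * (Lam (smooth D i pair01) - Lam (smooth D i pair03)))
  /\
  (forall D o, wf_diagram D -> planar D -> valid_or D o -> (0 < ncomp D)%N ->
     descending D o -> Lam D = tvar ^ writhe D o * delta ^+ (ncomp D).-1).

Definition kauffK (Lam : diagram -> FF) (D : diagram) (o : nat -> bool) : FF :=
  tvar ^ (- writhe D o) * Lam D.

Definition ccomp (D : diagram) : finType := {x : dart D | fingraph.root (comprel D) x == x}.
Definition lcomp (D : diagram) : finType := (ccomp D + 'I_(nfree D))%type.

Definition keepdart (D : diagram) (S : {set lcomp D}) (d : nat) : bool :=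
  [exists c : ccomp D, (inl c \in S) &&
     [exists x : dart D, (val x == d) && (fingraph.root (comprel D) x == val c)]].

Definition sub_rem (D : diagram) (S : {set lcomp D}) (j : nat) : bool :=
  ~~ [&& keepdart D S (4 * j), keepdart D S (4 * j + 1),
         keepdart D S (4 * j + 2) & keepdart D S (4 * j + 3)].

Definition sublink (D : diagram) (S : {set lcomp D}) : diagram :=
  remove D (sub_rem D S) oppd (fun d => ~~ keepdart D S d)
    #|[set j : 'I_(nfree D) | inr j \in S]|.

Definition sub_or (D : diagram) (S : {set lcomp D}) (o : nat -> bool) : nat -> bool :=
  fun d => o (olddart D (sub_rem D S) d).

Definition Wsub (Lam : diagram -> FF) (D : diagram) (o : nat -> bool)
    (S : {set lcomp D}) : FF :=
  tvar ^ lk2 (sublink D S) (sub_or D S o) * delta * kauffK Lam (sublink D S) (sub_or D S o).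

Definition ordpart (T : finType) (r : nat) (P : {ffun 'I_r -> {set T}}) : bool :=
  [&& [forall i, P i != set0],
      [forall i, forall j, (i != j) ==> [disjoint P i & P j]] &
      (\bigcup_(i < r) P i == setT)].

Definition FSO (Lam : diagram -> FF) (D : diagram) (o : nat -> bool) : FF :=
  \sum_(r < #|lcomp D|)
     ((-1) ^+ r / (r.+1)%:R *
      \sum_(P : {ffun 'I_r.+1 -> {set lcomp D}} | ordpart _ _ P)
         \prod_(i < r.+1) Wsub Lam D o (P i)).

Definition zval_ge (f : FF) (m : int) : Prop :=
  exists p q : {poly Qt}, q.[0] != 0 /\
    f * zvar ^ (- m) = FracField.tofrac p / FracField.tofrac q.

(* Main.v *)
(** Up to a unit [t^k], the free energy is the cumulant of the multiplicative family
    S |-> delta * Lambda(L_S), the self-writhes being multiplicative over blocks.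
    Colour the components of a link with L colours, let c be the number of
    components, and form the cumulant over the colours.  A crossing change
    between two colours alters it by z times a difference of cumulants of smoothings in
    which the two colours are merged and two components have become one; a
    crossing change within one colour alters it by z times a difference of cumulants with
    the same colours and at most one more component.  Crossing changes lead to a
    descending diagram in which the colours are stacked: there the family is
    multiplicative, so the cumulant vanishes if L >= 2, while for L = 1 it is
    t^w delta^c.  By induction the valuation is at least 2L - 2 - c, that is
    L - 2 when every component has its own colour.

    All the smoothings, crossing changes and sublinks involved are encoded on the darts of
    one fixed map.  Their planarity is obtained homologically: Euler's formula holds iff
    every rational cycle of the map is the boundary of a function on its faces, and
    that property is inherited by local arguments. *)
Require Import Defs.
From mathcomp Require Import all_boot all_order all_algebra fraction.
From mathcomp Require Import zify ring lra.
Set Implicit Arguments.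
Unset Strict Implicit.
Unset Printing Implicit Defensive.
Import Order.TTheory GRing.Theory Num.Theory.

(** * Strands *)

(** The exponent 2L - 2 - c is the affine function that balances the recursion. For L = 1 it must be
    -c, the valuation of t^w delta^c, as delta has a simple pole at z = 0. The factor z of the skein
    relation pays for exactly one unit: a smoothing within a colour may raise c by one, and merging
    two colours lowers both L and c by one, whence the coefficient 2 of L. Colours are kept apart
    from components because smoothing a self-crossing can split a component, while the cumulant must
    keep its index set. The obstacle is that the skein relation has to be applied to all sublinks of
    a link at once, whereas smoothings and sublinks renumber crossings, and Lambda is not given as
    invariant under renumbering. Hence a diagram is only asked to realize a system of strands on the
    darts of the original map, through an injection of its own darts, and the bound is proved for
    every choice of realizing diagrams, one for each set of colours. *)

(* The darts in [Sv] are those of the surviving crossings; at a removed crossing a strand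
   entering by [x] leaves by [q x].  On the darts [K] that are kept, an edge of the
   remaining diagram is a class with two members in [Sv], and a class without any is a
   free circle. *)
Definition strand_rel (T : finType) (g q : T -> T) (Sv K : pred T) : rel T :=
  fun x y => K x && ((y == g x) || (~~ Sv x && (y == q x))).

Definition strand_turn (T : finType) (q : T -> T) (Sv : pred T) (x : T) : T :=
  if Sv x then x else q x.

Definition strand_step (T : finType) (g q : T -> T) (Sv : pred T) (x : T) : T :=
  g (strand_turn q Sv x).

(* Turning around at its ends, a strand is a single orbit of [strand_step], on which
   [strand_turn] acts as a reflection: its fixed points, the ends, are two in number. *)
Section StrandEnds.

Variables (T : finType) (g q : T -> T) (Sv K : pred T).
Hypothesis gK : involutive g.
Hypothesis gN : forall x, g x != x.
Hypothesis qK : involutive q.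
Hypothesis qN : forall x, q x != x.
Hypothesis Svq : forall x, Sv (q x) = Sv x.
Hypothesis Kg : forall x, K (g x) = K x.
Hypothesis Kq : forall x, K (q x) = K x.
Hypothesis SvK : forall x, Sv x -> K x.

Local Notation e := (strand_rel g q Sv K).

Lemma strand_rel_sym : symmetric e.
Proof.
have H x y : e x y -> e y x.
  case/andP=> Kx /orP[/eqP->|/andP[Sx /eqP->]]; rewrite /strand_rel.
    by rewrite Kg Kx gK eqxx.
  by rewrite Kq Kx qK Svq Sx eqxx orbT.
by move=> x y; apply/idP/idP; apply: H.
Qed.

Lemma strand_connect_sym : connect_sym e.
Proof. exact/sym_connect_sym/strand_rel_sym. Qed.

Lemma strand_closedK : closed e K.
Proof.
apply: (intro_closed strand_connect_sym) => x y /andP[Kx].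
by case/orP=> [/eqP->|/andP[_ /eqP->]] _; rewrite unfold_in ?Kg ?Kq.
Qed.

Local Notation qt := (strand_turn q Sv).
Local Notation s := (strand_step g q Sv).

Let qtK : involutive qt.
Proof.
by move=> x; rewrite /strand_turn; case: (boolP (Sv x)) => [->//|n]; rewrite Svq (negPf n) qK.
Qed.

Let s_inj : injective s.
Proof. exact: inj_comp (can_inj gK) (can_inj qtK). Qed.

(** The dihedral relation: the reflection [strand_turn] conjugates [strand_step] to its inverse. *)
Let iter_s_qt k y : iter k s (qt (iter k s y)) = qt y.
Proof.
elim: k y => [//|k IH] y; rewrite iterSr [iter k.+1 s y]iterS.
by rewrite {2}/strand_step {1}/strand_step qtK gK IH.
Qed.

Let iter_s_g k x : Sv x -> iter k s (g (iter k s x)) = s x.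
Proof.
move=> Sx; have -> y : g y = s (qt y) by rewrite /strand_step qtK.
by rewrite -iterSr iterS iter_s_qt /strand_turn Sx.
Qed.

Let connect_iter x k : K x -> connect e x (iter k s x).
Proof.
move=> Kx; elim: k => [|k IH]; first exact: connect0.
have Ky : K (iter k s x).
  by have := closed_connect strand_closedK IH; rewrite !unfold_in Kx => <-.
apply: connect_trans IH _; rewrite iterS; move: (iter k s x) Ky => y Ky; rewrite /strand_step /strand_turn.
case: ifPn => Sy; first by apply: connect1; rewrite /strand_rel Ky eqxx.
apply: (@connect_trans _ _ (q y)); apply: connect1.
  by rewrite /strand_rel Ky Sy eqxx orbT.
by rewrite /strand_rel Kq Ky eqxx.
Qed.

Let connect_orbit x y : Sv x -> connect e x y -> fconnect s x y.
Proof.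
move=> Sx; suff cl : closed e (fconnect s x).
  move/(closed_connect cl) => E; have : x \in fconnect s x by apply: connect0.
  by rewrite E.
apply: (intro_closed strand_connect_sym) => u v /andP[_ uv] xu.
have xqu : fconnect s x (qt u).
  rewrite fconnect_sym //; have := iter_s_qt (findex s x u) x.
  by rewrite iter_findex // {2}/strand_turn Sx => E; rewrite -[X in fconnect s _ X]E; apply: fconnect_iter.
case/orP: uv => [/eqP->|/andP[Su /eqP->]].
  have -> : g u = s (qt u) by rewrite /strand_step qtK.
  exact: connect_trans xqu (fconnect1 _ _).
by move: xqu; rewrite /strand_turn (negPf Su).
Qed.

(** The reflection fixes both [x] and [y], so going twice from [x] to [y] leads back to [x]: twice
    the position of [y] is a multiple of the order, and it lies strictly between 0 and twice the
    order. *)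
Let half_order x y : Sv x -> Sv y -> y != x -> connect e x y ->
  findex s x y + findex s x y = order s x.
Proof.
move=> Sx Sy yx /(connect_orbit Sx) xy; set k := findex s x y.
have k_gt0 : 0 < k by rewrite lt0n findex_eq0 eq_sym.
have km : k < order s x by apply: findex_max.
have kk : iter (k + k) s x = x.
  rewrite iterD; have := iter_s_qt k x; rewrite iter_findex //.
  by rewrite /strand_turn Sx Sy.
case: (ltnP (k + k) (order s x)) => [lt_kk|le_kk].
  by have := findex_iter lt_kk; rewrite kk findex0; move: k_gt0; case: (k).
have lt_m : k + k - order s x < order s x.
  by rewrite ltn_subLR //; apply: leq_add km (ltnW km).
have := findex_iter lt_m.
have -> : iter (k + k - order s x) s x = x.
  by rewrite -[RHS]kk -{2}(subnK le_kk) iterD iter_order.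
by rewrite findex0 => /esym/eqP; rewrite subn_eq0 => ?; apply/eqP; rewrite eqn_leq le_kk andbT.
Qed.

Lemma strand_end_unique x y w : Sv x -> Sv y -> Sv w ->
  connect e x y -> connect e x w -> y != x -> w != x -> y = w.
Proof.
move=> Sx Sy Sw xy xw yx wx.
have := half_order Sx Sw wx xw; rewrite -(half_order Sx Sy yx xy) !addnn.
move/double_inj=> E.
by rewrite -(iter_findex (connect_orbit Sx xy)) -E iter_findex // connect_orbit.
Qed.

Lemma strand_end_iter x : Sv x ->
  exists h, [/\ 0 < h <= #|T|, Sv (iter h s x), iter h s x != x,
     connect e x (iter h s x) & (forall j, 0 < j < h -> ~~ Sv (iter j s x))].
Proof.
move=> Sx; set m := order s x.
have m_gt0 : 0 < m by apply: order_gt0.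
have mx : iter m s x = x by apply: iter_order.
have itn n : injective (iter n s) by elim: n => [|n IH] // u v /s_inj/IH.
(* On an odd orbit the other reflection, [g], would have a fixed point. *)
have modd : odd m = false.
  apply/negP=> mo; pose k := m./2.+1.
  have E : iter (k + k) s x = s x.
    by rewrite /k addSn addnS addnn -[in RHS]mx -iterS -[in RHS](odd_double_half m) mo.
  have := iter_s_g k Sx; rewrite -E iterD => /itn /eqP; exact/negP.
have hh : m./2 + m./2 = m by rewrite addnn -[RHS]odd_double_half modd.
exists m./2.
have h_gt0 : 0 < m./2 by move: hh m_gt0; case: m./2 => // <-.
have hm : m./2 < m by rewrite -{2}hh -addn1 leq_add2l.
(* The reflection also fixes the point opposite to [x]; as [q] has no fixed point, that point must
   survive. *)
have Sh : Sv (iter m./2 s x).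
  have xh : iter m./2 s (iter m./2 s x) = x by rewrite -iterD hh.
  have := iter_s_qt m./2 x; rewrite {2}/strand_turn Sx -[RHS]xh => /itn/eqP.
  by rewrite /strand_turn; case: ifP => //; rewrite (negPf (qN _)).
have findex_h j : j < m -> findex s x (iter j s x) = j by apply: findex_iter.
have neq j : 0 < j < m -> iter j s x != x.
  by case/andP=> j0 jm; rewrite eq_sym -(findex_eq0 s) findex_h // -lt0n.
split=> //.
- by rewrite h_gt0 (leq_trans (ltnW hm)) // max_card.
- by rewrite neq // h_gt0.
- exact/connect_iter/SvK.
move=> j /andP[j0 jh]; apply/negP=> Sj.
have jm : j < m by apply: ltn_trans hm.
have := half_order Sx Sj _ (connect_iter j (SvK Sx)).
rewrite neq ?j0 // findex_h // -/m -hh !addnn => /(_ isT)/double_inj E.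
by rewrite E ltnn in jh.
Qed.

Lemma strand_end_exists x : Sv x -> exists y, [/\ Sv y, y != x & connect e x y].
Proof. by case/strand_end_iter=> h [_ ? ? ? _]; exists (iter h s x). Qed.

(** Induction along a strand from one end to the other: [P] is carried from each dart by which the
    strand enters a crossing to the next such dart. Orientations, face values and times are
    transported in this way. *)
Lemma strand_walk x w (P : T -> Prop) : Sv x -> Sv w -> w != x -> connect e x w ->
  P (g x) -> (forall y, ~~ Sv y -> connect e x y -> P y -> P (g (q y))) -> P w.
Proof.
move=> Sx Sw wx xw P0 PS; have [h [/andP[h0 _] Sh hx xh nS]] := strand_end_iter Sx.
rewrite (strand_end_unique Sx Sw Sh) //.
suff H j : 0 < j <= h -> P (iter j s x) by apply: H; rewrite h0 leqnn.
elim: j => [/andP[]//|[_ _|j IH /andP[_ jh]]]; first by rewrite /= /strand_step /strand_turn Sx.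
have Sj : ~~ Sv (iter j.+1 s x) by apply: nS; rewrite jh.
rewrite iterS {1}/strand_step /strand_turn (negPf Sj); apply: PS => //; first exact/connect_iter/SvK.
by apply: IH; apply: ltnW.
Qed.

End StrandEnds.

(** * Euler's formula and homology *)

Section ConstantFunctions.

Local Open Scope ring_scope.

Variable T : finType.

Local Notation vec := 'rV[rat]_#|T|.

Definition fn_of (z : vec) (x : T) : rat := z 0 (enum_rank x).
Definition vec_of (f : T -> rat) : vec := \row_i f (enum_val i).

Lemma vec_ofE f x : fn_of (vec_of f) x = f x.
Proof. by rewrite /fn_of mxE enum_rankK. Qed.

Lemma fn_ofP (z1 z2 : vec) : fn_of z1 =1 fn_of z2 <-> z1 = z2.
Proof.
split=> [E|->//]; apply/rowP=> i; have := E (enum_val i).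
by rewrite /fn_of enum_valK.
Qed.

(** The rows are the indicators of the components, so counting components becomes computing the rank
    of the space of functions constant along [e]. *)
Definition cst_mx (e : rel T) : 'M[rat]_(#|roots e|, #|T|) :=
  \matrix_(i, j) (fingraph.root e (enum_val j) == enum_val i)%:R.

Variable e : rel T.
Hypothesis e_sym : connect_sym e.

Lemma rank_cst_mx : \rank (cst_mx e) = n_comp e T.
Proof.
have /eqP-> : row_free (cst_mx e).
  apply/row_freeP; exists (\matrix_(j, i) (enum_val j == enum_val i)%:R).
  apply/matrixP=> i k; rewrite !mxE (bigD1 (enum_rank (enum_val k))) //=.
  rewrite big1 => [|j jk]; last first.
    rewrite !mxE; case: (enum_val j =P enum_val k) => [E|]; last by rewrite mulr0.
    by rewrite -E enum_valK eqxx in jk.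
  rewrite !mxE enum_rankK eqxx mulr1 addr0; have /eqP-> := enum_valP k.
  by rewrite (inj_eq enum_val_inj) eq_sym.
by apply: eq_card => x; rewrite !inE andbT.
Qed.

Lemma sub_cst_mx (z : vec) :
  (z <= cst_mx e)%MS <-> forall x y, e x y -> fn_of z x = fn_of z y.
Proof.
split=> [/submxP[D ->] x y exy|zc].
  have E : fingraph.root e x = fingraph.root e y by apply/(fingraph.rootP e_sym)/connect1.
  by rewrite /fn_of !mxE; apply: eq_bigr => i _; rewrite !mxE !enum_rankK E.
have zr x : fn_of z (fingraph.root e x) = fn_of z x.
  have /connectP[p ep ->] := connect_root e x.
  by elim: p x ep => //= y p IH x /andP[/zc-> /IH].
apply/submxP; exists (\row_i fn_of z (enum_val i)).
apply/fn_ofP=> x.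
rewrite /fn_of !mxE.
have rx : fingraph.root e x \in roots e by rewrite inE (fingraph.roots_root e_sym).
rewrite (bigD1 (enum_rank_in rx (fingraph.root e x))) //= big1 => [|i ir].
  by rewrite !mxE enum_rankK enum_rankK_in // eqxx mulr1 addr0; apply: esym (zr x).
rewrite !mxE enum_rankK; case: eqP => [E|]; last by rewrite mulr0.
by case/eqP: ir; apply: enum_val_inj; rewrite enum_rankK_in.
Qed.

End ConstantFunctions.

Section AddEdge.

Local Open Scope ring_scope.

Variables (T : finType) (e e' : rel T) (u v : T).
Hypotheses (e_sym : connect_sym e) (e'_sym : connect_sym e').
Hypothesis e'E : forall z : T -> rat,
  (forall x y, e' x y -> z x = z y) <-> (forall x y, e x y -> z x = z y) /\ z u = z v.

Let c : 'cV[rat]_#|T| := delta_mx (enum_rank u) 0 - delta_mx (enum_rank v) 0.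

Let mul_c (z : 'rV[rat]_#|T|) : (z *m c == 0) = (fn_of z u == fn_of z v).
Proof.
rewrite mulmxBr -!colE subr_eq0; apply/eqP/eqP => [/matrixP/(_ 0 0)|E].
  by rewrite !mxE.
by apply/matrixP=> i j; rewrite !ord1 !mxE.
Qed.

Let cst_edge : (cst_mx e' :=: cst_mx e :&: kermx c)%MS.
Proof.
apply/eqmxP/andP; split; apply/rV_subP=> z.
  move=> /(sub_cst_mx e'_sym)/e'E[ze zuv]; rewrite sub_capmx.
  apply/andP; split; first exact/(sub_cst_mx e_sym).
  by apply/sub_kermxP/eqP; rewrite mul_c zuv.
rewrite sub_capmx => /andP[/(sub_cst_mx e_sym) ze /sub_kermxP/eqP].
rewrite mul_c => /eqP zuv; exact/(sub_cst_mx e'_sym)/e'E.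
Qed.

(** One linear form, z u - z v, cuts the functions constant along [e'] out of those constant along
    [e], so the dimension drops by at most one. *)
Lemma n_comp_edge : (n_comp e T <= (n_comp e' T).+1)%N.
Proof.
rewrite -!rank_cst_mx // cst_edge -(mxrank_mul_ker (cst_mx e) c).
by rewrite -[X in (_ <= X)%N]add1n leq_add2r rank_leq_col.
Qed.

(** The indicator of the component of [u] is not killed by the form z u - z v, so the dimension does
    drop. *)
Lemma n_comp_edge_merge : ~~ connect e u v -> n_comp e T = (n_comp e' T).+1.
Proof.
move=> uv; apply/eqP; rewrite eqn_leq n_comp_edge /=.
rewrite -!rank_cst_mx // cst_edge -(mxrank_mul_ker (cst_mx e) c).
rewrite -[X in (X <= _)%N]add1n leq_add2r lt0n mxrank_eq0.
pose z := vec_of (fun x => (connect e u x)%:R : rat).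
have ze : (z <= cst_mx e)%MS.
  apply/(sub_cst_mx e_sym) => x y exy; rewrite !vec_ofE.
  by rewrite (same_connect1r e_sym exy).
apply: contraNneq uv => c0; have: z *m c == 0.
  by have /submxP[D ->] := ze; rewrite -mulmxA c0 mulmx0.
rewrite mul_c !vec_ofE connect0; by case: connect.
Qed.

End AddEdge.

Section EulerFormula.

Variables (T : finType) (g rot : T -> T) (n : nat).
Hypothesis gK : involutive g.
Hypothesis gN : forall x, g x != x.
Hypothesis rot4 : forall x, rot (rot (rot (rot x))) = x.
Hypothesis rot2 : forall x, rot (rot x) != x.
Hypothesis cardT : #|T| = 4 * n.

Definition map_graph_rel : rel T :=
  fun x y => [|| y == g x, y == rot x | x == rot y].

Local Open Scope ring_scope.

(* [z] is a 1-cycle, given by its values on oriented edges, and [h] a 2-chain,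
   [h x] being its value on the face that runs along the dart [x]. *)
Definition cycles_bound : Prop := forall z : T -> rat,
  (forall x, z (g x) = - z x) ->
  (forall x, z x + z (rot x) + z (rot (rot x)) + z (rot (rot (rot x))) = 0) ->
  exists h : T -> rat,
    (forall x, h (rot (g x)) = h x) /\ (forall x, h x - h (g x) = z x).

Let g_inj : injective g := can_inj gK.
Let rot_inj : injective rot.
Proof. by move=> x y E; rewrite -(rot4 x) E rot4. Qed.
Let face x := rot (g x).
Let face_inj : injective face := inj_comp rot_inj g_inj.

Let frel_sym (f : T -> T) : injective f -> connect_sym (frel f).
Proof. by move=> f_inj x y; rewrite fconnect_sym. Qed.

Let gr_sym : connect_sym map_graph_rel.
Proof.
apply: sym_connect_sym => x y; rewrite /map_graph_rel.
by rewrite [y == g x]eq_sym (can2_eq gK gK) [(x == rot y) || _]orbC.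
Qed.

Let order_g x : order g x = 2.
Proof.
have p0 : fcycle g [:: x; g x] by rewrite /= gK !eqxx.
by rewrite (order_cycle p0) ?inE ?eqxx //= inE eq_sym gN.
Qed.

Let rot_neq x : rot x != x.
Proof. by apply: contraNneq (rot2 x) => E; rewrite !E. Qed.

Let order_rot x : order rot x = 4.
Proof.
have p0 : fcycle rot [:: x; rot x; rot (rot x); rot (rot (rot x))] by rewrite /= rot4 !eqxx.
rewrite (order_cycle p0) ?inE ?eqxx //= !inE !negb_or.
have r3 : rot (rot (rot x)) != x.
  by apply: contraNneq (rot_neq x) => E; rewrite -{1}E rot4.
rewrite ![x == _]eq_sym rot_neq rot2 r3 !(inj_eq rot_inj).
by rewrite ![x == _]eq_sym rot_neq rot2.
Qed.

Let fcard_all (f : T -> T) k : (forall x, order f x = k) -> injective f ->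
  (n_comp (frel f) T * k = #|T|)%N.
Proof.
move=> fo f_inj; apply: fcard_order_set => //.
by apply/subsetP=> x _; rewrite inE fo eqxx.
Qed.

Let n_comp_g : n_comp (frel g) T = (2 * n)%N.
Proof.
apply/eqP; rewrite -(@eqn_pmul2r 2) // (fcard_all order_g) // cardT.
by rewrite mulnAC.
Qed.

Let n_comp_rot : n_comp (frel rot) T = n.
Proof. by apply/eqP; rewrite -(@eqn_pmul2r 4) // (fcard_all order_rot) // cardT mulnC. Qed.

Let Sg := cst_mx (frel g).
Let V := cst_mx (frel rot).
Let Phi := cst_mx (frel face).
Let Gr := cst_mx map_graph_rel.
Let bnd : 'M[rat]_#|T| := 1%:M - \matrix_(i, j) (enum_val i == g (enum_val j))%:R.
(** The 1-cycles: antisymmetry is orthogonality to the functions constant on edges, and Kirchhoff's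
    law is orthogonality to those constant on vertices. *)
Let Z := kermx (Sg + V)%MS^T.

Let bndE (z : 'rV[rat]_#|T|) x : fn_of (z *m bnd) x = fn_of z x - fn_of z (g x).
Proof.
rewrite mulmxBr mulmx1 /fn_of !mxE (bigD1 (enum_rank (g x))) //= big1 => [|i ix].
  by rewrite mxE !enum_rankK eqxx mulr1 addr0.
rewrite mxE enum_rankK; case: eqP => [E|]; last by rewrite mulr0.
by case/eqP: ix; rewrite -E enum_valK.
Qed.

Let sub_frel (f : T -> T) (f_inj : injective f) (z : 'rV[rat]_#|T|) :
  (z <= cst_mx (frel f))%MS <-> forall x, fn_of z (f x) = fn_of z x.
Proof.
rewrite sub_cst_mx; last exact: frel_sym.
by split=> [H x|H x y /eqP <-]; [rewrite (H x (f x)) /= | rewrite H].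
Qed.

Let sub_Gr (z : 'rV[rat]_#|T|) :
  (z <= Gr)%MS <-> (z <= Sg)%MS /\ (z <= V)%MS.
Proof.
rewrite (sub_cst_mx gr_sym) !sub_frel //; split=> [H|[Hg Hr] x y].
  by split=> x; apply/esym/H; rewrite /map_graph_rel eqxx ?orbT.
by case/or3P=> /eqP->; rewrite ?Hg ?Hr.
Qed.

Let cap_Sg_V : (Sg :&: V :=: Gr)%MS.
Proof.
apply/eqmxP/andP; split; apply/rV_subP=> z; rewrite sub_capmx.
  by case/andP=> zg zr; apply/sub_Gr.
by case/sub_Gr=> -> ->.
Qed.

(** A face function without boundary is invariant under [g] and under [rot] after [g], hence under
    [rot]: it is constant on the components of the graph. *)
Let cap_Phi_bnd : (Phi :&: kermx bnd :=: Gr)%MS.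
Proof.
apply/eqmxP/andP; split; apply/rV_subP=> z; rewrite sub_capmx.
  case/andP=> /(sub_frel face_inj) zf /sub_kermxP zb.
  have zg x : fn_of z (g x) = fn_of z x.
    apply/esym/eqP; rewrite -subr_eq0 -bndE zb; apply/eqP; exact: mxE.
  apply/sub_Gr; split; apply/sub_frel => // x.
  by rewrite -{1}(gK x) [fn_of _ _]zf zg.
case/sub_Gr=> /(sub_frel g_inj) zg /(sub_frel rot_inj) zr; apply/andP; split.
  by apply/(sub_frel face_inj) => x; rewrite /face zr zg.
by apply/sub_kermxP/fn_ofP => x; rewrite bndE zg subrr /fn_of mxE.
Qed.

Let dot_sum (z w : 'rV[rat]_#|T|) : (z *m w^T) 0 0 = \sum_x fn_of z x * fn_of w x.
Proof.
rewrite mxE (reindex (@enum_rank T)) /=; last exact/onW_bij/enum_rank_bij.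
by apply: eq_bigr => x _; rewrite mxE.
Qed.

Let sub_Z (z : 'rV[rat]_#|T|) : (z <= Z)%MS <->
  (forall w : 'rV[rat]_#|T|, (w <= Sg)%MS || (w <= V)%MS -> \sum_x fn_of z x * fn_of w x = 0).
Proof.
split=> [/sub_kermxP zZ w ww|H].
  have /submxP[D ->] : (w <= Sg + V)%MS.
    by case/orP: ww => /submx_trans; apply; rewrite ?addsmxSl ?addsmxSr.
  by rewrite -dot_sum trmx_mul mulmxA zZ mul0mx mxE.
apply/sub_kermxP; rewrite -[z]trmxK -trmx_mul; apply/eqP; rewrite trmx_eq0.
apply/eqP; apply/row_matrixP => i; rewrite row0 row_mul.
have /sub_addsmxP[[u1 u2] /= ->] : (row i (Sg + V)%MS <= Sg + V)%MS by apply: row_sub.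
have {}H (w : 'rV[rat]_#|T|) : (w <= Sg)%MS || (w <= V)%MS -> w *m z^T = 0.
  move/H => ww; apply/matrixP=> a b; rewrite !ord1 [RHS]mxE dot_sum -[RHS]ww.
  by apply: eq_bigr => x _; rewrite mulrC.
by rewrite mulmxDl !H ?submxMl ?orbT // addr0.
Qed.

Let sum_anti (z : T -> rat) : (forall x, z (g x) = - z x) -> \sum_x z x = 0.
Proof.
move=> zg; have : \sum_x z x = - \sum_x z x.
  by rewrite {1}(reindex_inj g_inj) /= -sumrN; apply: eq_bigr => x _; rewrite zg.
by move/eqP; rewrite -addr_eq0 -mulr2n mulrn_eq0 /= => /eqP.
Qed.

Let cycle_Z (z : T -> rat) : (vec_of z <= Z)%MS <->
  (forall x, z (g x) = - z x) /\
  (forall x, z x + z (rot x) + z (rot (rot x)) + z (rot (rot (rot x))) = 0).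
Proof.
rewrite sub_Z; split=> [H|[zg zr] w].
  have dot1 (a : T) : \sum_x z x * (x == a)%:R = z a.
    by rewrite (bigD1 a) //= eqxx mulr1 big1 ?addr0 // => x /negPf->; rewrite mulr0.
  split=> x.
    pose w := vec_of (fun y => (y == x)%:R + (y == g x)%:R).
    have /H : (w <= Sg)%MS || (w <= V)%MS.
      apply/orP; left; apply/sub_frel => // y; rewrite !vec_ofE.
      by rewrite (inj_eq g_inj) (can2_eq gK gK) addrC.
    rewrite (eq_bigr (fun y => z y * (y == x)%:R + z y * (y == g x)%:R)).
      by rewrite big_split /= !dot1 => /eqP; rewrite addrC addr_eq0 => /eqP.
    by move=> y _; rewrite !vec_ofE mulrDr.
  pose w := vec_of (fun y => (y == x)%:R + (y == rot x)%:R + (y == rot (rot x))%:R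
     + (y == rot (rot (rot x)))%:R).
  have /H : (w <= Sg)%MS || (w <= V)%MS.
    apply/orP; right; apply/sub_frel => // y; rewrite !vec_ofE.
    rewrite -{1}(rot4 x) !(inj_eq rot_inj).
    by ring.
  rewrite (eq_bigr (fun y => z y * (y == x)%:R + z y * (y == rot x)%:R
     + z y * (y == rot (rot x))%:R + z y * (y == rot (rot (rot x)))%:R)).
    by rewrite !big_split /= !dot1.
  by move=> y _; rewrite !vec_ofE !mulrDr.
case/orP=> /sub_frel ww.
  rewrite sum_anti // => x; rewrite !vec_ofE zg ww // mulNr //.
have {}ww x : fn_of w (rot x) = fn_of w x by apply: ww.
pose F x := fn_of (vec_of z) x * fn_of w x.
suff : (\sum_x F x) *+ 4 = 0 by move/eqP; rewrite mulrn_eq0 => /eqP.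
have R : \sum_x F x = \sum_x F (rot x) by rewrite (reindex_inj rot_inj).
have R2 : \sum_x F x = \sum_x F (rot (rot x)) by rewrite R (reindex_inj rot_inj).
have R3 : \sum_x F x = \sum_x F (rot (rot (rot x))) by rewrite R2 (reindex_inj rot_inj).
rewrite !mulrS mulr0n addr0 {2}R {2}R2 {2}R3 -!big_split /=.
apply: big1 => x _; rewrite /F !vec_ofE !ww -!mulrDl.
by rewrite !addrA zr mul0r.
Qed.

(** Boundaries are cycles: a face function satisfies h (g y) = h (rot y), so its differences
    telescope around a vertex. *)
Let bnd_Z : (Phi *m bnd <= Z)%MS.
Proof.
apply/rV_subP=> _ /submxP[D ->]; rewrite mulmxA.
have : (D *m Phi <= Phi)%MS by apply: submxMl.
move: (D *m Phi) => h /(sub_frel face_inj) hf.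
have -> : h *m bnd = vec_of (fun x => fn_of h x - fn_of h (g x)).
  by apply/fn_ofP=> x; rewrite bndE vec_ofE.
apply/cycle_Z; split=> x; first by rewrite gK opprB.
have hg y : fn_of h (rot y) = fn_of h (g y) by rewrite -[in LHS](gK y) [LHS]hf.
rewrite -!hg rot4.
move: (fn_of h x) (fn_of h _) (fn_of h _) (fn_of h _) => a b c d.
by ring.
Qed.

(** Let F count the faces and C the components. Boundaries have dimension F - C. There are 2n edges
    and n vertices, so cycles have dimension 4n - (2n + n - C) = n + C. Boundaries being cycles, all
    cycles bound iff F - C = n + C. *)
Lemma euler_cycles_bound : cycles_bound <->
  n_comp (frel face) T = (n + 2 * n_comp map_graph_rel T)%N.
Proof.
have rB := mxrank_mul_ker Phi bnd.
rewrite cap_Phi_bnd !rank_cst_mx // in rB.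
have rZ := mxrank_sum_cap Sg V.
rewrite cap_Sg_V !rank_cst_mx // n_comp_g n_comp_rot in rZ.
have kZ : \rank Z = (#|T| - \rank (Sg + V))%N by rewrite mxrank_ker mxrank_tr.
have le1 : (\rank (Sg + V) <= #|T|)%N by apply: rank_leq_col.
have B_Z := mxrank_leqif_sup bnd_Z.
have -> : n_comp (frel face) T = (n + 2 * n_comp map_graph_rel T)%N <->
   \rank (Phi *m bnd) = \rank Z.
  by move: (cardT) le1 rB rZ kZ; move: #|T| (\rank _) (\rank _) (\rank _) => *; split; lia.
rewrite (rwP eqP) B_Z; split=> [H|H z zg zr].
  apply/rV_subP=> z; have -> : z = vec_of (fn_of z) by apply/fn_ofP=> x; rewrite vec_ofE.
  case/cycle_Z=> /H{}H /H[h [hf hz]].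
  have hPhi : (vec_of h <= Phi)%MS.
    by apply/(sub_frel face_inj) => x; rewrite !vec_ofE hf.
  have -> : vec_of (fn_of z) = vec_of h *m bnd.
    by apply/fn_ofP=> x; rewrite bndE !vec_ofE hz.
  exact: submxMr.
have zZ : (vec_of z <= Z)%MS by apply/cycle_Z.
have /submxP[D zD] := submx_trans zZ H.
exists (fn_of (D *m Phi)); split=> x.
  by apply: (sub_frel face_inj _).1 x; apply: submxMl.
by rewrite -bndE -mulmxA -zD vec_ofE.
Qed.

End EulerFormula.

(** * Diagrams realizing a system of strands *)

Section DartArithmetic.

Lemma rotd_lt n d : d < 4 * n -> rotd d < 4 * n.
Proof. rewrite /rotd; lia. Qed.

Lemma rotd4 d : rotd (rotd (rotd (rotd d))) = d.
Proof. rewrite /rotd; lia. Qed.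

Lemma rotd2 d : rotd (rotd d) = oppd d.
Proof. rewrite /rotd /oppd; lia. Qed.

Lemma rotd2_neq d : rotd (rotd d) != d.
Proof. apply/eqP; rewrite /rotd; lia. Qed.

Lemma rotd_div d : rotd d %/ 4 = d %/ 4.
Proof. rewrite /rotd; lia. Qed.

Lemma odd_rotd d : odd (rotd d) = ~~ odd d.
Proof. rewrite /rotd; lia. Qed.

End DartArithmetic.

Section PlanarDiagrams.

Variable D : diagram.

Definition glue_dart (x : dart D) : dart D := insubd x (glue D x).
Definition rot_dart (x : dart D) : dart D := insubd x (rotd x).

Lemma val_rot_dart (x : dart D) : val (rot_dart x) = rotd x.
Proof. by rewrite val_insubd rotd_lt. Qed.

Hypothesis wfD : wf_diagram D.

Lemma val_glue_dart (x : dart D) : val (glue_dart x) = glue D x.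
Proof. by rewrite val_insubd; have [-> _ _] := wfD (ltn_ord x). Qed.

Lemma glue_dartK : involutive glue_dart.
Proof.
by move=> x; apply: val_inj; rewrite !val_glue_dart; have [] := wfD (ltn_ord x).
Qed.

Lemma glue_dart_neq x : glue_dart x != x.
Proof. by rewrite -val_eqE /= val_glue_dart; have [] := wfD (ltn_ord x). Qed.

Lemma rot_dart4 x : rot_dart (rot_dart (rot_dart (rot_dart x))) = x.
Proof. by apply: val_inj; rewrite !val_rot_dart rotd4. Qed.

Lemma rot_dart2_neq x : rot_dart (rot_dart x) != x.
Proof. by rewrite -val_eqE /= !val_rot_dart rotd2_neq. Qed.

Lemma planarE : planar D <-> cycles_bound glue_dart rot_dart.
Proof.
have cD : #|dart D| = (4 * ncr D)%N by rewrite card_ord.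
rewrite (euler_cycles_bound glue_dartK glue_dart_neq rot_dart4 rot_dart2_neq cD).
rewrite /planar.
have -> : n_comp (facerel D) predT = n_comp (frel (fun x => rot_dart (glue_dart x))) (dart D).
  apply: eq_n_comp => x y; apply: eq_connect => {}x {}y.
  by rewrite /facerel /= -val_glue_dart -val_rot_dart eq_sym.
have -> // : n_comp (graphrel D) predT = n_comp (map_graph_rel glue_dart rot_dart) (dart D).
apply: eq_n_comp => x y; apply: eq_connect => {}x {}y.
by rewrite /graphrel /map_graph_rel /= -val_glue_dart -!val_rot_dart !val_eqE.
Qed.

End PlanarDiagrams.

(** * Orientations of strands *)

Section Orientations.

Variables (T : finType) (g q : T -> T).
Hypothesis gK : involutive g.
Hypothesis gN : forall x, g x != x.
Hypothesis qK : involutive q.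
Hypothesis qN : forall x, q x != x.

Definition strand_next (x : T) : T := g (q x).

Lemma strand_next_inj : injective strand_next.
Proof. exact: inj_comp (can_inj gK) (can_inj qK). Qed.

Let iter_q k x : iter k strand_next (q (iter k strand_next x)) = q x.
Proof.
elim: k x => [//|k IH] x; rewrite iterSr [iter k.+1 _ x]iterS.
by rewrite {2 3}/strand_next qK gK IH.
Qed.

(* A strand meeting [x] in both directions would be a palindromic word in the
   involutions [g] and [q], whose middle letter would have a fixed point. *)
Lemma strand_next_disjoint x : ~~ fconnect strand_next x (q x).
Proof.
have s_inj := strand_next_inj.
have itn k : injective (iter k strand_next) by elim: k => [|k IH] // u v /s_inj/IH.
apply/negP=> /iter_findex; move: (findex _ _ _) => k E.
pose y := iter k./2 strand_next x.
have := iter_q k./2 x; rewrite -E -{3}(odd_double_half k) -addnn.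
case: (odd k); rewrite ?add0n ?add1n -?addnS iterD => /itn /eqP; last exact/negP.
rewrite iterS /strand_next; set u := q _; rewrite -/y -/u => /eqP E'.
by have := gN u; rewrite -E' eqxx.
Qed.

(** The darts [x] and [q x] lie on different orbits of [strand_next], which run along the same
    component in opposite directions; comparing the ranks of the roots of these orbits selects one
    of the two directions. *)
Lemma orientation_exists : exists2 o : T -> bool,
  (forall x, o (g x) = ~~ o x) & (forall x, o (q x) = ~~ o x).
Proof.
have s_sym := fconnect_sym strand_next_inj.
pose r x := enum_rank (fingraph.root (frel strand_next) x).
have rN x : (r (q x) == r x :> nat) = false.
  rewrite (inj_eq val_inj) (inj_eq enum_rank_inj) eq_sym root_connect //.
  by rewrite (negPf (strand_next_disjoint x)).
have r_gq x : r (g (q x)) = r x.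
  by congr enum_rank; apply/esym/(fingraph.rootP s_sym)/fconnect1.
exists (fun x => r x < r (q x)) => x.
  have -> : r (g x) = r (q x) by rewrite -{1}(qK x) r_gq.
  have -> : r (q (g x)) = r x by rewrite -(r_gq (q (g x))) qK gK.
  by rewrite -leqNgt ltn_neqAle rN.
by rewrite qK -leqNgt ltn_neqAle rN.
Qed.

End Orientations.

(** * Diagrams encoded on the darts of a fixed map *)

Section Realizations.

Variables (T : finType) (g rot : T -> T).
Hypothesis gK : involutive g.
Hypothesis gN : forall x, g x != x.
Hypothesis rot4 : forall x, rot (rot (rot (rot x))) = x.

Definition circles (q : T -> T) (Sv K : pred T) : nat :=
  n_comp (strand_rel g q Sv K)
    [pred x | K x && [forall y, connect (strand_rel g q Sv K) x y ==> ~~ Sv y]].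

(* [D] is the diagram left on the kept darts, up to the embedding [io] of its darts;
   [ov] tells which of them belong to over-strands. *)
Record realizes (q : T -> T) (Sv K ov : pred T) (nf : nat) (D : diagram)
    (io : dart D -> T) : Prop := Realizes {
  rz_Sv : forall d, Sv (io d);
  rz_inj : injective io;
  rz_surj : forall x, Sv x -> exists d, io d = x;
  rz_rot : forall d, io (rot_dart d) = rot (io d);
  rz_ov : forall d : dart D, ov (io d) = odd d;
  rz_glue : forall d : dart D, exists d' : dart D,
    [/\ val d' = glue D d, d' != d & connect (strand_rel g q Sv K) (io d) (io d')];
  rz_free : nfree D = nf + circles q Sv K }.

(** At a removed crossing [q] is the reconnection, at a surviving one the straight passage. With
    [pred0] in place of [Sv], [strand_rel] then describes the components of the link. *)
Record tangle (q : T -> T) (Sv : pred T) : Prop := Tangle {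
  tg_qK : involutive q;
  tg_qN : forall x, q x != x;
  tg_rot : forall x, Sv (rot x) = Sv x;
  tg_q : forall x, Sv x -> q x = rot (rot x) }.

Record strand_closed (q : T -> T) (Sv K : pred T) : Prop := StrandClosed {
  sc_g : forall x, K (g x) = K x;
  sc_q : forall x, K (q x) = K x;
  sc_Sv : forall x, Sv x -> K x }.

Local Open Scope ring_scope.

(** The homological form of planarity for the remaining diagram, on the darts of the fixed map. At a
    removed crossing both the flow and the face on each side of a strand continue along [q]. *)
Definition strand_cycles_bound (q : T -> T) (Sv K : pred T) : Prop :=
  forall z : T -> rat,
    (forall x, z (g x) = - z x) ->
    (forall x, ~~ Sv x -> z (q x) = - z x) ->
    (forall x, Sv x -> z x + z (rot x) + z (rot (rot x)) + z (rot (rot (rot x))) = 0) ->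
    (forall x, ~~ K x -> z x = 0) ->
  exists h : T -> rat,
    (forall x, K x -> h x - h (g x) = z x) /\
    (forall x, K x -> h (if Sv x then rot x else q x) = h (g x)).

Local Close Scope ring_scope.

Lemma tangle_Svq q Sv : tangle q Sv -> forall x, Sv (q x) = Sv x.
Proof.
move=> tg x; have qS := tg_q tg; case: (boolP (Sv x)) => Sx.
  by rewrite qS // !(tg_rot tg).
apply: contraNF Sx => Sqx.
by rewrite -(tg_qK tg x) qS // !(tg_rot tg).
Qed.

Section OneRealization.

Variables (q : T -> T) (Sv K ov : pred T) (nf : nat) (D : diagram) (io : dart D -> T).
Hypotheses (tg : tangle q Sv) (sc : strand_closed q Sv K).
Hypothesis rz : realizes q Sv K ov nf io.

Local Notation e := (strand_rel g q Sv K).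

Let qK := tg_qK tg.
Let Svq := tangle_Svq tg.
Let Kg := sc_g sc.
Let Kq := sc_q sc.
Let e_sym : connect_sym e := strand_connect_sym gK qK Svq Kg Kq.

Lemma rz_end_unique d d1 d2 : d1 != d -> d2 != d ->
  connect e (io d) (io d1) -> connect e (io d) (io d2) -> d1 = d2.
Proof.
move=> dd1 dd2 c1 c2; apply: (rz_inj rz).
apply: (strand_end_unique gK qK Svq Kg Kq
  (rz_Sv rz d) (rz_Sv rz d1) (rz_Sv rz d2) c1 c2).
- by apply: contraNneq dd1 => /(rz_inj rz)->.
- by apply: contraNneq dd2 => /(rz_inj rz)->.
Qed.

Lemma rz_wf : wf_diagram D.
Proof.
move=> d dN; have [d1 [/= E1 n1 c1]] := rz_glue rz (Ordinal dN).
have [d2 [/= E2 n2 c2]] := rz_glue rz d1.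
rewrite -E1 -E2 ltn_ord; split=> //.
rewrite -[d]/(val (Ordinal dN)); congr val.
by apply: rz_end_unique n2 _ c2 _; rewrite 1?eq_sym // e_sym.
Qed.

Lemma rz_glue_dart d :
  glue_dart d != d /\ connect e (io d) (io (glue_dart d)).
Proof.
have [d1 [/= E1 n1 c1]] := rz_glue rz d.
by have -> : glue_dart d = d1 by apply: val_inj; rewrite (val_glue_dart rz_wf).
Qed.

Lemma rz_connect d d' : connect e (io d) (io d') -> d' = d \/ d' = glue_dart d.
Proof.
move=> c; case: (d' =P d) => [|/eqP n]; [by left|right].
by have [n' c'] := rz_glue_dart d; apply: rz_end_unique c'.
Qed.

Lemma rz_walk d (P : T -> Prop) : P (g (io d)) ->
  (forall y, ~~ Sv y -> connect e (io d) y -> P y -> P (g (q y))) ->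
  P (io (glue_dart d)).
Proof.
have [gd cg] := rz_glue_dart d.
apply: (strand_walk gK gN qK (tg_qN tg) Svq Kg Kq (sc_Sv sc)
  (rz_Sv rz d) (rz_Sv rz _) _ cg).
by apply: contraNneq gd => /(rz_inj rz)->.
Qed.

Lemma rz_planar : strand_cycles_bound q Sv K -> planar D.
Proof.
move=> H; apply/(planarE rz_wf) => z zg zr.
have [o og oq] := orientation_exists gK gN qK (tg_qN tg).
pose sg (b : bool) : rat := if b then 1%R else (-1)%R.
have sgN b : sg (~~ b) = (- sg b)%R by case: b => /=; rewrite ?opprK.
have sgM b : (sg b * sg b = 1)%R by case: b => /=; rewrite ?mulrNN mulr1.
(* A flow on [D] is spread along the strands and set to zero on free circles and dropped darts. The
   sign of the orientation makes the value independent of the end chosen by [pick], since both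
   factors change sign at the other end. *)
pose zs x := if [pick d : dart D | connect e x (io d)] is Some d
  then (sg (o (io d)) * z d)%R else 0%R.
pose zT x := (sg (o x) * zs x)%R.
have o_glue (d : dart D) : o (io (glue_dart d)) = ~~ o (io d).
  apply: (rz_walk (P := fun y => o y = ~~ o (io d))) => //.
  by move=> y _ _ oy; rewrite og oq oy negbK.
have zs_conn x y : connect e x y -> zs x = zs y.
  by move=> xy; rewrite /zs (eq_pick (fun d : dart D => same_connect e_sym xy (io d))).
have zs_io (d : dart D) : zs (io d) = (sg (o (io d)) * z d)%R.
  rewrite /zs; case: pickP => [d' dd'|/(_ d)]; last by rewrite connect0.
  case: (d' =P d) => [->//|/eqP d'd].
  have [E|->] := rz_connect dd'; first by rewrite E eqxx in d'd.
  by rewrite zg o_glue sgN mulrNN.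
have zsK x : ~~ K x -> zs x = 0%R.
  move=> Kx; rewrite /zs; case: pickP => // d xd; case/negP: Kx.
  have := closed_connect (strand_closedK gK qK Svq Kg Kq) xd; rewrite !unfold_in => ->.
  by apply/(sc_Sv sc)/(rz_Sv rz).
have zT_io (d : dart D) : zT (io d) = z d by rewrite /zT zs_io mulrA sgM mul1r.
have zT_g x : zT (g x) = (- zT x)%R.
  rewrite /zT og sgN mulNr; case: (boolP (K x)) => Kx.
    by rewrite (zs_conn x (g x)) // connect1 // /strand_rel Kx eqxx.
  by rewrite !zsK ?mulr0 // Kg.
have zT_q x : ~~ Sv x -> zT (q x) = (- zT x)%R.
  move=> Sx; rewrite /zT oq sgN mulNr; case: (boolP (K x)) => Kx.
    by rewrite (zs_conn x (q x)) // connect1 // /strand_rel Kx Sx eqxx orbT.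
  by rewrite !zsK ?mulr0 // Kq.
have [h [hg hr]] : exists h : T -> rat,
    (forall x, K x -> h x - h (g x) = zT x)%R /\
    (forall x, K x -> h (if Sv x then rot x else q x) = h (g x)).
  apply: H => // [x Sx|x Kx]; last by rewrite /zT zsK ?mulr0.
  by have [d <-] := rz_surj rz Sx; rewrite -!(rz_rot rz) !zT_io zr.
have Kio (d : dart D) : K (io d) by apply/(sc_Sv sc)/(rz_Sv rz).
(* The face on a given side of a strand keeps its value past the removed crossings. *)
have h_glue (d : dart D) : h (g (io (glue_dart d))) = h (io d).
  apply: (rz_walk (P := fun y => h (g y) = h (io d))); rewrite ?gK // => y Sy yd <-.
  have Ky : K y.
    have := closed_connect (strand_closedK gK qK Svq Kg Kq) yd.
    by rewrite !unfold_in => <-.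
  by rewrite gK -hr // (negPf Sy).
exists (fun d : dart D => h (io d)); split=> d.
  change (h (io (rot_dart (glue_dart d))) = h (io d)).
  by rewrite (rz_rot rz) -[RHS]h_glue -(hr _ (Kio _)) (rz_Sv rz).
change (h (io d) - h (io (glue_dart d)) = z d)%R.
rewrite -[h (io d)]h_glue -[LHS]opprB hg ?Kio //.
by rewrite zT_io zg opprK.
Qed.

End OneRealization.
End Realizations.

Section CountingComponents.

Lemma n_comp_local (T : finType) (e e' : rel T) (a : pred T) :
  (forall x, a x -> connect e x =1 connect e' x) -> n_comp e a = n_comp e' a.
Proof.
move=> H; apply: eq_card => x; rewrite !inE.
case: (boolP (x \in a)) => [ax|]; rewrite ?andbF // !andbT.
by rewrite /roots /fingraph.root (eq_pick (H x ax)).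
Qed.

Lemma connect_local (T : finType) (e e' : rel T) (x : T) : subrel e e' ->
  (forall y z, connect e x y -> e' y z -> e y z) -> connect e x =1 connect e' x.
Proof.
move=> sub H y; apply/idP/idP; first by apply: connect_sub => u v /sub/connect1.
case/connectP=> p; elim/last_ind: p y => [|p z IH] y; first by move=> _ ->; apply: connect0.
rewrite rcons_path last_rcons => /andP[pp pz] ->.
have xz := IH _ pp erefl.
by apply: connect_trans xz (connect1 (H _ _ xz pz)).
Qed.

Lemma n_compID (T : finType) (e : rel T) (a b : pred T) :
  n_comp e a = n_comp e [predI a & b] + n_comp e [predI a & predC b].
Proof.
rewrite /n_comp_mem -(cardID b); congr (_ + _); apply: eq_card => x.
  by rewrite !inE andbA.
by rewrite !inE andbC -andbA.
Qed.

Lemma n_comp_transfer (T T' : finType) (h : T' -> T) (e : rel T) (e' : rel T')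
    (a : pred T) (a' : pred T') :
  connect_sym e -> connect_sym e' -> closed e a -> (forall x', a' x' = a (h x')) ->
  (forall x, a x -> exists x', connect e x (h x')) ->
  (forall x' y', a (h x') -> connect e' x' y' = connect e (h x') (h y')) ->
  n_comp e a = n_comp e' a'.
Proof.
move=> se se' cl aE onto fun_h; rewrite (adjunction_n_comp h se se' cl) //.
  by apply: eq_n_comp_r => x; rewrite !unfold_in aE.
split=> [x ax|x' y' ax']; last exact: fun_h.
case: (pickP (fun x' => connect e x (h x'))) => [x' c|n]; first by exists x'.
by exfalso; have [x' c] := onto x ax; rewrite n in c.
Qed.

End CountingComponents.

(** * Removing crossings in two stages *)

Section Composition.

Variables (T : finType) (g rot : T -> T).
Hypothesis gK : involutive g.
Hypothesis gN : forall x, g x != x.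
Variables (q : T -> T) (Sv K ov : pred T) (nf : nat) (D : diagram) (io : dart D -> T).
Hypotheses (tg : tangle rot q Sv) (sc : strand_closed g q Sv K).
Hypothesis rz : realizes g rot q Sv K ov nf io.
Variables (q0 : dart D -> dart D) (S0 : pred (dart D)) (q2 : T -> T) (Sv2 : pred T).
Hypotheses (q0K : involutive q0) (S0q0 : forall d, S0 (q0 d) = S0 d).
Hypotheses (q2K : involutive q2) (Sv2q2 : forall x, Sv2 (q2 x) = Sv2 x).
Hypothesis K_q2 : forall x, K (q2 x) = K x.
Hypothesis Sv2_sub : forall x, Sv2 x -> Sv x.
Hypothesis Sv2_io : forall d, Sv2 (io d) = S0 d.
Hypothesis q2_out : forall x, ~~ Sv x -> q2 x = q x.
Hypothesis q2_io : forall d, ~~ S0 d -> q2 (io d) = io (q0 d).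

Local Notation e := (strand_rel g q Sv K).
Local Notation e0 := (strand_rel (@glue_dart D) q0 S0 predT).
Local Notation e2 := (strand_rel g q2 Sv2 K).

Let wfD := rz_wf gK tg sc rz.
Let qK := tg_qK tg.
Let Svq := tangle_Svq tg.
Let Kg := sc_g sc.
Let Kq := sc_q sc.
Let e_sym : connect_sym e := strand_connect_sym gK qK Svq Kg Kq.
Let e0_sym : connect_sym e0 := strand_connect_sym (K := predT)
  (glue_dartK wfD) q0K S0q0 (fun _ => erefl) (fun _ => erefl).
Let e2_sym : connect_sym e2 := strand_connect_sym gK q2K Sv2q2 Kg K_q2.

Let e_sub : subrel e e2.
Proof.
move=> x y /andP[Kx /orP[/eqP->|/andP[Sx /eqP->]]]; rewrite /strand_rel Kx ?eqxx //.
by rewrite q2_out // eqxx (contra (@Sv2_sub x) Sx) orbT.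
Qed.

(** An edge of [D] is a strand of the first stage. A strand of the second stage alternates such
    edges with passages [q0] at crossings of [D], which are the passages [q2] on the fixed map. *)
Lemma connect_compose d d' : connect e0 d d' = connect e2 (io d) (io d').
Proof.
have Kio c : K (io c) := sc_Sv sc (rz_Sv rz c).
apply/idP/idP.
  case/connectP=> p ep ->{d'}; elim: p d ep => [|c p IH] d /=; first by rewrite connect0.
  case/andP=> dc /IH; apply: connect_trans.
  case/andP: dc => _ /orP[/eqP->|/andP[Sd /eqP->]].
    have [_ ] := rz_glue_dart gK tg sc rz d.
    by apply: connect_sub => x y /e_sub/connect1.
  by apply: connect1; rewrite /strand_rel Kio Sv2_io Sd q2_io // eqxx orbT.
move=> c2; pose B := [pred x | [exists c, connect e0 d c && connect e (io c) x]].
have clB : closed e2 B.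
  apply: (intro_closed e2_sym) => x y xy; rewrite !inE => /existsP[c /andP[dc cx]].
  have step : e x y -> [exists c, connect e0 d c && connect e (io c) y].
    by move=> exy; apply/existsP; exists c; rewrite dc (connect_trans cx (connect1 exy)).
  case/andP: xy => Kx /orP[/eqP E|/andP[Sx2 /eqP E]].
    by apply: step; rewrite /strand_rel Kx E eqxx.
  case: (boolP (Sv x)) => Sx; last first.
    by apply: step; rewrite /strand_rel Kx Sx E q2_out // eqxx orbT.
  have [c1 c1x] := rz_surj rz Sx; subst x.
  rewrite Sv2_io in Sx2; apply/existsP; exists (q0 c1); rewrite E q2_io // connect0 andbT.
  apply: connect_trans dc _; apply: (@connect_trans _ _ c1).
    have [->|->] := rz_connect gK tg sc rz cx; first exact: connect0.
    by apply: connect1; rewrite /strand_rel eqxx.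
  by apply: connect1; rewrite /strand_rel Sx2 eqxx orbT.
have : io d' \in B.
  by rewrite -(closed_connect clB c2) inE; apply/existsP; exists d; rewrite !connect0.
rewrite inE => /existsP[c /andP[dc cd']]; apply: connect_trans dc _.
have [->|->] := rz_connect gK tg sc rz cd'; first exact: connect0.
by apply: connect1; rewrite /strand_rel eqxx.
Qed.

(** A final circle either meets no crossing of [D], and is a circle of the first stage, or passes
    through one, and corresponds to a circle of the second stage. *)
Lemma circles_compose : circles g q2 Sv2 K =
  circles g q Sv K + circles (@glue_dart D) q0 S0 predT.
Proof.
have Kio c : K (io c) := sc_Sv sc (rz_Sv rz c).
pose b := [pred x | [forall y, connect e2 x y ==> ~~ Sv y]].
have cl_const (P : pred T) : closed e2 [pred x | [forall y, connect e2 x y ==> ~~ P y]].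
  move=> x y xy; rewrite !inE; apply: eq_forallb => z.
  by rewrite (same_connect1 e2_sym xy).
have clK : closed e2 K := strand_closedK gK q2K Sv2q2 Kg K_q2.
rewrite {1}/circles (n_compID _ _ b); congr (_ + _).
  have sub2 u v : connect e u v -> connect e2 u v.
    by apply: connect_sub => ? ? /e_sub/connect1.
  have loc x : K x -> (forall y, connect e x y -> ~~ Sv y) -> connect e x =1 connect e2 x.
    move=> Kx nS; apply: connect_local e_sub _ => y z xy /andP[Ky].
    have Sy := nS y xy; rewrite /strand_rel Ky Sy /= => /orP[->//|/andP[_ /eqP->]].
    by rewrite q2_out // eqxx orbT.
  rewrite (@n_comp_local _ e2 e).
    apply: eq_n_comp_r => x; rewrite !inE.
    apply/andP/andP=> [[/andP[Kx _] /forallP nS]|[Kx /forallP nS]].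
      split=> //; apply/forallP=> y; apply/implyP=> xy; have := nS y.
      by rewrite sub2.
    have nSe y : connect e x y -> ~~ Sv y by move=> xy; have := nS y; rewrite xy.
    rewrite Kx; split; last by apply/forallP=> y; apply/implyP; rewrite -loc //; apply: nSe.
    apply/forallP=> y; apply/implyP; rewrite -loc // => /nSe.
    by apply: contra; apply: Sv2_sub.
  move=> x /andP[/andP[Kx _] /forallP nS] y.
  by rewrite loc // => z xz; have := nS z; rewrite sub2.
apply: (@n_comp_transfer _ _ io) => //.
- move=> x y xy; have := cl_const Sv2 x y xy; have := cl_const Sv x y xy.
  by have := clK x y xy; rewrite !unfold_in /= => -> -> ->.
- move=> d; rewrite /= !inE Kio /=.
  have -> /= : ~~ b (io d) by apply/forallPn; exists (io d); rewrite connect0 (rz_Sv rz).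
  rewrite andbT; apply/forallP/forallP => H y; apply/implyP=> c.
    have Sy := Sv2_sub; case: (boolP (Sv2 y)) => // S2y.
    have [d' E] := rz_surj rz (Sv2_sub S2y); subst y.
    have := H d'; rewrite connect_compose c /=.
    by rewrite -Sv2_io S2y.
  by have := H (io y); rewrite -connect_compose c Sv2_io.
- move=> x /andP[_ /forallPn[y]]; rewrite negb_imply negbK => /andP[xy Sy].
  by have [d E] := rz_surj rz Sy; exists d; rewrite E.
by move=> d d' _; apply: connect_compose.
Qed.

Lemma realizes_compose (D2 : diagram) (io0 : dart D2 -> dart D) :
  realizes (@glue_dart D) (@rot_dart D) q0 S0 predT (fun d => odd d) (nfree D) io0 ->
  realizes g rot q2 Sv2 K ov nf (fun d => io (io0 d)).
Proof.
move=> r0; split.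
- by move=> d; rewrite Sv2_io (rz_Sv r0).
- by move=> d d' /(rz_inj rz)/(rz_inj r0).
- move=> x S2x; have [d E] := rz_surj rz (Sv2_sub S2x); subst x.
  by rewrite Sv2_io in S2x; have [d0 E] := rz_surj r0 S2x; exists d0; rewrite E.
- by move=> d; rewrite (rz_rot r0) (rz_rot rz).
- by move=> d; rewrite (rz_ov rz) (rz_ov r0).
- move=> d; have [d' [E n c]] := rz_glue r0 d; exists d'; split=> //.
  by rewrite -connect_compose.
by rewrite (rz_free r0) (rz_free rz) circles_compose addnA.
Qed.

End Composition.

(** * Deleting crossings from a diagram *)

Section RemoveCrossings.

Variables (D : diagram) (rem : nat -> bool) (partner : nat -> nat) (drop : nat -> bool).
Hypothesis wfD : wf_diagram D.
Hypothesis partner_div : forall d, partner d %/ 4 = d %/ 4.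
Hypothesis partnerK : involutive partner.
Hypothesis partner_neq : forall d, partner d != d.
Hypothesis drop_glue : forall d, d < 4 * ncr D -> drop (glue D d) = drop d.
Hypothesis drop_partner : forall d, d < 4 * ncr D -> drop (partner d) = drop d.
Hypothesis drop_rem : forall d, d < 4 * ncr D -> ~~ rem (d %/ 4) -> ~~ drop d.

Local Notation sv := (survivors D rem).
Local Notation old := (olddart D rem).
Local Notation new := (newdart D rem).

Let mem_sv i : (i \in sv) = (i < ncr D) && ~~ rem i.
Proof. by rewrite mem_filter mem_iota add0n andbC. Qed.

Lemma olddart_div d : old d %/ 4 = nth 0 sv (d %/ 4).
Proof. rewrite /olddart; lia. Qed.

Let nth_sv d : d < 4 * size sv -> nth 0 sv (d %/ 4) \in sv.
Proof. by move=> dN; apply: mem_nth; move: (size _) dN => m; lia. Qed.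

Lemma olddart_rem d : d < 4 * size sv -> ~~ rem (old d %/ 4).
Proof. by move/nth_sv; rewrite olddart_div mem_sv => /andP[]. Qed.

Lemma olddart_lt d : d < 4 * size sv -> old d < 4 * ncr D.
Proof. move/nth_sv; rewrite mem_sv => /andP[]; rewrite /olddart; lia. Qed.

Let newdart_lt v : v < 4 * ncr D -> ~~ rem (v %/ 4) -> new v < 4 * size sv.
Proof.
move=> vN vr; have : index (v %/ 4) sv < size sv by rewrite index_mem mem_sv vr; lia.
rewrite /newdart; lia.
Qed.

Let newdartK v : v < 4 * ncr D -> ~~ rem (v %/ 4) -> old (new v) = v.
Proof.
move=> vN vr; rewrite /olddart.
have -> : new v %/ 4 = index (v %/ 4) sv by rewrite /newdart; lia.
have -> : new v %% 4 = v %% 4 by rewrite /newdart; lia.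
rewrite nth_index ?mem_sv ?vr; lia.
Qed.

Let olddartK d : d < 4 * size sv -> new (old d) = d.
Proof.
move=> dN; rewrite /newdart olddart_div index_uniq.
- by rewrite /olddart; lia.
- by move: (size _) dN => m; lia.
exact/filter_uniq/iota_uniq.
Qed.

Lemma olddart_rotd d : old (rotd d) = rotd (old d).
Proof.
rewrite {1}/olddart rotd_div [in RHS]/rotd olddart_div /rotd /olddart; lia.
Qed.

Definition partner_dart (x : dart D) : dart D := insubd x (partner x).

Lemma val_partner_dart x : val (partner_dart x) = partner x.
Proof.
rewrite val_insubd; suff -> : partner x < 4 * ncr D by [].
by have := partner_div x; have := ltn_ord x; lia.
Qed.

Lemma partner_dartK : involutive partner_dart.
Proof. by move=> x; apply: val_inj; rewrite !val_partner_dart partnerK. Qed.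

Lemma partner_dart_neq x : partner_dart x != x.
Proof. by rewrite -val_eqE /= val_partner_dart. Qed.

Definition kept_crossing (x : dart D) : bool := ~~ rem (x %/ 4).
Definition kept_dart (x : dart D) : bool := ~~ drop x.

Lemma remove_strand_closed : strand_closed (@glue_dart D) partner_dart kept_crossing kept_dart.
Proof.
split=> x; rewrite /kept_dart.
- by rewrite val_glue_dart // drop_glue.
- by rewrite val_partner_dart // drop_partner.
by apply: drop_rem.
Qed.

Let Svq x : kept_crossing (partner_dart x) = kept_crossing x.
Proof. by rewrite /kept_crossing val_partner_dart partner_div. Qed.

Local Notation e := (strand_rel (@glue_dart D) partner_dart kept_crossing kept_dart).

(** [looprel] only sees kept darts at removed crossings. On a class closed under [glue], which
    therefore never reaches a survivor, it has the same connectivity as [strand_rel]. *)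
Lemma nloopsE : nloops D rem partner drop =
  circles (@glue_dart D) partner_dart kept_crossing kept_dart.
Proof.
pose L := looprel D rem partner drop.
have kr (x : dart D) : keptrem rem drop x = ~~ kept_crossing x && kept_dart x.
  by rewrite /keptrem /kept_crossing negbK.
have Le : subrel L e.
  move=> x y; rewrite /L /looprel /strand_rel kr => /and3P[/andP[-> ->] _].
  by rewrite -!val_eqE /= val_glue_dart // val_partner_dart.
have gl (x : dart D) : glue D x = glue_dart x by rewrite val_glue_dart.
have loc x : (forall y, connect L x y -> keptrem rem drop y && keptrem rem drop (glue D y)) ->
    connect L x =1 connect e x.
  move=> H; apply: connect_local Le _ => y z /H /andP[ky kgy] /andP[_].
  rewrite /L /looprel ky => /orP[/eqP->|/andP[_ /eqP->]].
    by rewrite val_glue_dart // eqxx -gl kgy.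
  rewrite val_partner_dart eqxx orbT andbT /=.
  have -> : nat_of_ord (partner_dart y) = partner y by apply: val_partner_dart.
  by move: ky; rewrite /keptrem partner_div drop_partner.
have eK : closed e kept_dart := strand_closedK (glue_dartK wfD) partner_dartK Svq
  (sc_g remove_strand_closed) (sc_q remove_strand_closed).
have LA (x : dart D) : keptrem rem drop x ->
    (forall y : dart D, connect L x y -> keptrem rem drop (glue D y)) ->
    forall y : dart D, connect L x y -> keptrem rem drop y && keptrem rem drop (glue D y).
  move=> kx H y xy; rewrite H // andbT; case/connectP: xy => p.
  elim/last_ind: p => [|p z _]; first by move=> _ ->.
  by rewrite rcons_path last_rcons => /andP[_ /and3P[_ kz _]] ->.
rewrite /nloops /circles (@n_comp_local _ _ e).
  apply: eq_n_comp_r => x; rewrite !inE; apply/andP/andP=> [[kx /forallP H]|[Kx /forallP H]].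
    have {H}/LA H : forall y : dart D, connect L x y -> keptrem rem drop (glue D y).
      by move=> y xy; have := H y; rewrite xy.
    move: (kx); rewrite kr => /andP[_ ->]; split=> //.
    apply/forallP=> y; apply/implyP; rewrite -loc; last exact: H.
    by move/(H kx)/andP=> []; rewrite kr => /andP[].
  have {}H (y : dart D) : connect e x y -> keptrem rem drop y.
    move=> xy; have := H y; rewrite xy kr /= => ->.
    by have E : kept_dart x = kept_dart y := closed_connect eK xy; rewrite -E.
  have kx := H x (connect0 _ _); split=> //.
  apply/forallP=> y; apply/implyP => xy; rewrite gl; apply: H.
  have xy' : connect e x y by apply: connect_sub xy => u v /Le/connect1.
  have E : kept_dart x = kept_dart y := closed_connect eK xy'.
  by apply: connect_trans xy' (connect1 _); rewrite /strand_rel eqxx andbT -E.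
move=> x /andP[kx /forallP H]; apply: loc; apply: LA => // y xy.
by have := H y; rewrite xy.
Qed.

Local Notation s := (strand_step (@glue_dart D) partner_dart kept_crossing).

Let chase_iter (x : dart D) h : kept_crossing (iter h s x) ->
  (forall j, 0 < j < h -> ~~ kept_crossing (iter j s x)) ->
  forall j fuel, 0 < j <= h -> h - j <= fuel ->
  chase D rem partner fuel (iter j s x) = iter h s x.
Proof.
move=> Sh nS j fuel; elim: fuel j => [|fuel IH] j /andP[j0 jh] hj /=.
  by have -> : j = h by lia.
have := Sh; have := nS j; rewrite /kept_crossing !negbK.
have [-> _|jh' /(_ _)] := eqVneq j h; first by move/negPf->.
have jh2 : 0 < j < h by lia.
move=> /(_ jh2) rj _; rewrite rj.
have -> : glue D (partner (iter j s x)) = iter j.+1 s x.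
  rewrite iterS /strand_step /strand_turn /kept_crossing rj /=.
  by rewrite val_glue_dart // val_partner_dart.
by apply: IH; lia.
Qed.

Variable nf : nat.
Local Notation D' := (remove D rem partner drop nf).

Definition old_dart (d : dart D') : dart D := Ordinal (olddart_lt (ltn_ord d)).

(** [chase] iterates [strand_step] up to the next surviving dart, the other end of the strand. At
    most as many steps as there are darts are required, so the fuel suffices. *)
Lemma remove_realizes : realizes (@glue_dart D) (@rot_dart D)
  partner_dart kept_crossing kept_dart (fun x => odd x) nf old_dart.
Proof.
have oldS d : kept_crossing (old_dart d) by apply: olddart_rem.
split=> //.
- move=> d1 d2 /(congr1 val)/(congr1 new) /=.
  by rewrite !olddartK //= => /val_inj.
- move=> x Sx; have lt_new := newdart_lt (ltn_ord x) Sx.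
  by exists (Ordinal lt_new); apply: val_inj; apply: newdartK.
- move=> d; apply: val_inj; rewrite val_rot_dart /=.
  have -> : nat_of_ord (rot_dart d) = rotd d by apply: val_rot_dart.
  exact: olddart_rotd.
- move=> d /=; rewrite /olddart; lia.
- move=> d; pose x := old_dart d.
  have [h [/andP[h0 hN] Sh hx xh nS]] := strand_end_iter (glue_dartK wfD)
    (@glue_dart_neq _ wfD) partner_dartK partner_dart_neq Svq
    (sc_g remove_strand_closed) (sc_q remove_strand_closed)
    (sc_Sv remove_strand_closed) (oldS d).
  have lt_new := newdart_lt (ltn_ord _) Sh.
  have Eo : old_dart (Ordinal lt_new) = iter h s x.
    by apply: val_inj; apply: newdartK.
  exists (Ordinal lt_new); split; last by rewrite Eo.
    change (new (iter h s x) = new (chase D rem partner (4 * ncr D).+1 (glue D (old d)))).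
    congr new; apply/esym.
    have -> : glue D (old d) = iter 1 s x.
      by rewrite /= /strand_step /strand_turn oldS; apply/esym/val_glue_dart.
    by apply: chase_iter => //; rewrite card_ord in hN; lia.
  by apply: contraNneq hx => E; rewrite -/x -Eo E.
by rewrite /= nloopsE.
Qed.

End RemoveCrossings.

Lemma pair01E d : pair01 d = if odd d then rotd (rotd (rotd d)) else rotd d.
Proof.
rewrite /pair01 /rotd; have : d %% 4 < 4 by rewrite ltn_mod.
case E : (d %% 4) => [|[|[|[|n]]]] //= _; case: ifP; lia.
Qed.

Lemma pair03E d : pair03 d = if odd d then rotd d else rotd (rotd (rotd d)).
Proof.
rewrite /pair03 /rotd; have : d %% 4 < 4 by rewrite ltn_mod.
case E : (d %% 4) => [|[|[|[|n]]]] //= _; case: ifP; lia.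
Qed.

(** * Local moves on the fixed map and their homology *)

Section Crossings.

Variables (T : finType) (g rot : T -> T).
Hypothesis gK : involutive g.
Hypothesis gN : forall x, g x != x.
Hypothesis rot4 : forall x, rot (rot (rot (rot x))) = x.
Hypothesis rot2 : forall x, rot (rot x) != x.

Let rot_inj : injective rot.
Proof. by move=> x y E; rewrite -(rot4 x) E rot4. Qed.

Definition crossing (c : T) : pred T :=
  fun x => x \in [:: c; rot c; rot (rot c); rot (rot (rot c))].

Lemma crossing_rot c x : crossing c (rot x) = crossing c x.
Proof.
rewrite /crossing !inE !(inj_eq rot_inj) -{1}(rot4 c) !(inj_eq rot_inj).
by rewrite orbC -!orbA.
Qed.

Lemma crossing_refl c : crossing c c.
Proof. by rewrite /crossing inE eqxx. Qed.

(* The smoothing [pair01] for [b = true] and [pair03] for [b = false], in the positions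
   determined by which strand is over. *)
Definition smooth_map (ov : pred T) (b : bool) (c : T) (q : T -> T) (x : T) : T :=
  if crossing c x then if ov x == b then rot (rot (rot x)) else rot x else q x.

Definition smooth_Sv (c : T) (Sv : pred T) : pred T :=
  fun x => Sv x && ~~ crossing c x.

Definition switch_ov (c : T) (ov : pred T) : pred T :=
  fun x => if crossing c x then ~~ ov x else ov x.

Definition restrict (Sv K : pred T) : pred T := fun x => [&& Sv x, K x & K (rot x)].

Lemma crossingP c x : crossing c x ->
  [\/ x = c, x = rot c, x = rot (rot c) | x = rot (rot (rot c))].
Proof.
by rewrite /crossing !inE => /or4P[] /eqP->; [constructor 1|constructor 2|constructor 3|constructor 4].
Qed.

Section Smoothing.

Variables (q : T -> T) (Sv K ov : pred T) (c : T).
Hypothesis tg : tangle rot q Sv.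
Hypothesis ov_rot : forall x, ov (rot x) = ~~ ov x.
Hypothesis Sc : Sv c.

Lemma Sv_crossing x : crossing c x -> Sv x.
Proof. by case/crossingP=> ->; rewrite ?(tg_rot tg). Qed.

Lemma crossing_q x : crossing c (q x) = crossing c x.
Proof.
apply/idP/idP=> h; last first.
  by rewrite (tg_q tg) ?crossing_rot //; apply: Sv_crossing.
by rewrite -(tg_qK tg x) (tg_q tg) ?crossing_rot //; apply: Sv_crossing.
Qed.

Lemma rot_neq x : rot x != x.
Proof. by apply: contraNneq (rot2 x) => E; rewrite !E. Qed.

Lemma rot3_neq x : rot (rot (rot x)) != x.
Proof. by apply: contraNneq (rot_neq x) => E; rewrite -{1}E rot4. Qed.

Lemma smooth_tangle b : tangle rot (smooth_map ov b c q) (smooth_Sv c Sv).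
Proof.
split=> [x|x|x|x].
- rewrite /smooth_map; case: (boolP (crossing c x)) => cx; last first.
    by rewrite crossing_q (negPf cx) (tg_qK tg).
  case ob: (ov x == b); rewrite !crossing_rot cx !ov_rot ?negbK.
    by rewrite (_ : (~~ ov x == b) = false) ?rot4 // -(eqP ob); case: (ov x).
  by rewrite (_ : (~~ ov x == b) = true) ?rot4 //; move: ob; case: (ov x); case: (b).
- rewrite /smooth_map; case: ifP => _; last exact: tg_qN tg _.
  by case: ifP => _; rewrite ?rot_neq ?rot3_neq.
- by rewrite /smooth_Sv (tg_rot tg) crossing_rot.
by rewrite /smooth_Sv /smooth_map => /andP[Sx /negPf->]; exact: (tg_q tg).
Qed.

Lemma smooth_K : (forall x, K (q x) = K x) -> (forall x, Sv x -> K x) ->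
  forall b x, K (smooth_map ov b c q x) = K x.
Proof.
move=> Kq SK b x; rewrite /smooth_map; case: ifP => // cx.
have Sx := Sv_crossing cx.
by case: ifP => _; rewrite !SK ?(tg_rot tg).
Qed.

Local Open Scope ring_scope.

(** A flow that cancels in the two reconnected pairs satisfies Kirchhoff's law at the former
    crossing, so the old face function is available. Along a reconnected pair one side is already a
    single face; the opposite values of the flow at its two darts then make [h] agree on the other
    side. *)
Lemma smooth_cycles_bound b : strand_cycles_bound g rot q Sv predT ->
  strand_cycles_bound g rot (smooth_map ov b c q) (smooth_Sv c Sv) predT.
Proof.
set q2 := smooth_map _ _ _ _ => H z zg zq zS zK.
have zq2 x : crossing c x -> z (q2 x) = - z x.
  by move=> cx; apply: zq; rewrite /smooth_Sv cx andbF.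
have z4 x : crossing c x -> z x + z (rot x) + z (rot (rot x)) + z (rot (rot (rot x))) = 0.
  move=> cx; have cR y : crossing c y -> crossing c (rot y) by rewrite crossing_rot.
  have := zq2 _ cx; have := zq2 _ (cR _ (cR _ cx)).
  have := zq2 _ (cR _ cx); have := zq2 _ (cR _ (cR _ (cR _ cx))).
  rewrite /q2 /smooth_map !crossing_rot cx !ov_rot !rot4 !negbK.
  by case: (ov x == b) (~~ ov x == b) => [] [] *; lra.
have Sc' x : crossing c x -> Sv x by apply: Sv_crossing.
have [x Sx|x Sx|//|h [hg hr]] := H z zg.
- have cx : crossing c x = false by apply: contraNF Sx => /Sc'.
  by rewrite -zq /q2 /smooth_map ?cx // /smooth_Sv (negPf Sx).
- by case: (boolP (crossing c x)) => cx; [apply: z4 | apply: zS; rewrite /smooth_Sv Sx].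
exists h; split=> // x _; rewrite /smooth_Sv.
case: (boolP (crossing c x)) => cx; last first.
  by rewrite andbT -hr // /q2 /smooth_map (negPf cx).
have hc y : crossing c y -> h (rot y) = h (g y) by move=> cy; rewrite -hr // Sc'.
rewrite andbF; have := zq2 x cx; rewrite {1 2}/q2 /smooth_map cx.
case: ifP => _; last by rewrite hc.
set y := rot (rot (rot x)) => zy.
have cy : crossing c y by rewrite !crossing_rot.
have := hc y cy; rewrite /y rot4 -/y => hx.
have := hg x isT; have := hg y isT; rewrite zy hx => Ey Ex.
by move: Ex Ey; lra.
Qed.

End Smoothing.

Section Restriction.

Variables (q : T -> T) (Sv K : pred T).
Hypothesis tg : tangle rot q Sv.
Hypotheses (Kg : forall x, K (g x) = K x) (Kq : forall x, K (q x) = K x).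

Lemma restrict_tangle : tangle rot q (restrict Sv K).
Proof.
split=> [||x|x /andP[Sx _]]; [exact: tg_qK tg|exact: tg_qN tg| |exact: tg_q tg _ Sx].
rewrite /restrict (tg_rot tg); case: (boolP (Sv x)) => //= Sx.
by rewrite -(tg_q tg Sx) Kq andbC.
Qed.

Lemma restrict_closed : strand_closed g q (restrict Sv K) K.
Proof. by split=> // x /and3P[]. Qed.

Local Open Scope ring_scope.

(* A dropped strand carries no flow, so a face function takes the same value on both
   of its sides; this makes it well defined on the faces of the sublink. *)
Lemma restrict_cycles_bound : strand_cycles_bound g rot q Sv predT ->
  strand_cycles_bound g rot q (restrict Sv K) K.
Proof.
move=> H z zg zq zS zK.
have [x Sx|x Sx|//|h [hg hr]] := H z zg.
- by apply: zq; rewrite /restrict (negPf Sx).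
- case: (boolP (restrict Sv K x)) => [|Rx]; first exact: zS.
  have R2 : restrict Sv K (rot x) = false by rewrite (tg_rot restrict_tangle) (negPf Rx).
  have := zq x Rx; have := zq (rot x); rewrite R2 => /(_ isT).
  by rewrite !(tg_q tg) ?(tg_rot tg) // => -> ->; lra.
exists h; split=> x Kx; first exact: hg.
case: (boolP (Sv x)) => Sx; last by rewrite -[RHS]hr // /restrict (negPf Sx).
rewrite /restrict Sx Kx /=; case: ifP => KRx; first by rewrite -[RHS]hr // Sx.
have h1 := hr x isT; have h2 := hr (rot x) isT; rewrite (tg_rot tg) Sx in h2.
rewrite Sx in h1; have := hg (rot x) isT.
rewrite zK ?KRx // (tg_q tg Sx) h2 -h1; lra.
Qed.

End Restriction.

Lemma full_cycles_bound : cycles_bound g rot ->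
  strand_cycles_bound g rot (fun x => rot (rot x)) predT predT.
Proof.
move=> H z zg _ zS _; have [x|h [hr hg]] := H z zg; first exact: zS.
by exists h; split=> // x _ /=; rewrite -(gK x) hr gK.
Qed.

End Crossings.

Section MovesOfRealizations.

Variables (T : finType) (g rot : T -> T).
Hypothesis gK : involutive g.
Hypothesis gN : forall x, g x != x.
Hypothesis rot4 : forall x, rot (rot (rot (rot x))) = x.
Hypothesis rot2 : forall x, rot (rot x) != x.

Lemma realizes_ext q q' (Sv Sv' K K' ov ov' : pred T) nf D (io : dart D -> T) :
  Sv =1 Sv' -> K =1 K' -> (forall x, Sv x -> ov x = ov' x) ->
  (forall x, K x -> ~~ Sv x -> q x = q' x) ->
  realizes g rot q Sv K ov nf io -> realizes g rot q' Sv' K' ov' nf io.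
Proof.
move=> ES EK Eov Eq r.
have Ee : strand_rel g q Sv K =2 strand_rel g q' Sv' K'.
  move=> x y; rewrite /strand_rel -ES -EK; case: (boolP (K x)) => //= Kx.
  by case: (boolP (Sv x)) => //= Sx; rewrite Eq.
have Ec := eq_connect Ee.
split; first by move=> d; rewrite -ES (rz_Sv r).
- exact: rz_inj r.
- by move=> x; rewrite -ES => Sx; exact: (rz_surj r Sx).
- exact: rz_rot r.
- by move=> d; rewrite -Eov ?(rz_ov r) ?(rz_Sv r).
- by move=> d; have [d' []] := rz_glue r d; exists d'; rewrite -Ec.
rewrite (rz_free r) /circles (eq_n_comp Ec); congr (_ + _).
apply: eq_n_comp_r => x; rewrite !inE EK; congr (_ && _).
by apply: eq_forallb => y; rewrite Ec ES.
Qed.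

Section Moves.

Variables (q : T -> T) (Sv K ov : pred T) (nf : nat) (D : diagram) (io : dart D -> T).
Hypotheses (tg : tangle rot q Sv) (sc : strand_closed g q Sv K).
Hypothesis ov_rot : forall x, ov (rot x) = ~~ ov x.
Hypothesis rz : realizes g rot q Sv K ov nf io.
Variable d0 : dart D.

Let wfD := rz_wf gK tg sc rz.

Lemma crossing_io (d : dart D) : crossing rot (io d0) (io d) = (d %/ 4 == d0 %/ 4).
Proof.
rewrite /crossing -!(rz_rot rz) !inE !(inj_eq (rz_inj rz)) -!val_eqE /=.
have R (x : dart D) : nat_of_ord (rot_dart x) = rotd x by apply: val_rot_dart.
by rewrite !R /rotd; apply/idP/idP; lia.
Qed.

Definition switch_io (d : dart (switch D (d0 %/ 4))) : T :=
  if d %/ 4 == d0 %/ 4 then rot (io (d : dart D)) else io (d : dart D).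

(** [switch] turns the labels of one crossing by a quarter. On the fixed map the strands do not
    move: only the over-marking of the four darts is exchanged. *)
Lemma realizes_switch : realizes g rot q Sv K (switch_ov rot (io d0) ov) nf switch_io.
Proof.
have R (x : dart D) : nat_of_ord (rot_dart x) = rotd x by apply: val_rot_dart.
set i := d0 %/ 4.
pose r (d : dart D) := if d %/ 4 == i then rot_dart d else d.
pose r' (d : dart D) := if d %/ 4 == i then rot_dart (rot_dart (rot_dart d)) else d.
have rr' d : r (r' d) = d.
  rewrite /r /r'; case di: (d %/ 4 == i); last by rewrite di.
  by rewrite !R !rotd_div di rot_dart4.
have r'r d : r' (r d) = d.
  rewrite /r /r'; case di: (d %/ 4 == i); last by rewrite di.
  by rewrite !R !rotd_div di rot_dart4.
have E d : switch_io d = io (r d).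
  by rewrite /switch_io /r; case: ifP => // _; rewrite (rz_rot rz).
have r_rot d : r (rot_dart d) = rot_dart (r d) by rewrite /r R rotd_div; case: ifP.
split.
- by move=> d; rewrite E (rz_Sv rz).
- by move=> d1 d2; rewrite !E => /(rz_inj rz)/(congr1 r'); rewrite !r'r.
- by move=> x /(rz_surj rz)[d <-]; exists (r' d : dart D); rewrite E rr'.
- move=> d; rewrite !E -(rz_rot rz); congr io.
  by rewrite -r_rot; congr r; apply: val_inj.
- move=> d; rewrite E /switch_ov crossing_io (rz_ov rz) /r.
  case: (boolP (d %/ 4 == i)) => [di|/negPf di]; last by rewrite di.
  by rewrite R rotd_div di odd_rotd negbK.
- move=> d; have [n c] := rz_glue_dart gK tg sc rz (r d).
  exists (r' (glue_dart (r d))); rewrite !E rr'; split=> //.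
    have Vr (x : dart D) : nat_of_ord (r x) = if x %/ 4 == i then rotd x else x.
      by rewrite /r; case: ifP.
    have Vr' (x : dart D) : nat_of_ord (r' x) = if x %/ 4 == i then rotd (rotd (rotd x)) else x.
      by rewrite /r'; case: ifP => // _; rewrite !R.
    have Vg (x : dart D) : nat_of_ord (glue_dart x) = glue D x by apply: val_glue_dart.
    by change (nat_of_ord (r' (glue_dart (r d))) = glue (switch D i) d); rewrite Vr' Vg Vr.
  by apply: contraNneq n => /(congr1 r); rewrite rr' => ->.
exact: rz_free rz.
Qed.

(** Smoothing is a [remove] performed on [D]; composing it with the realization of [D] places the
    result on the fixed map. *)
Lemma realizes_smooth (b : bool) : exists io', realizes g rot
   (smooth_map rot ov b (io d0) q) (smooth_Sv rot (io d0) Sv) K ov nf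
   (io' : dart (smooth D (d0 %/ 4) (if b then pair01 else pair03)) -> T).
Proof.
set i := d0 %/ 4; set p := if b then pair01 else pair03.
have pE d : p d = if odd d == b then rotd (rotd (rotd d)) else rotd d.
  by rewrite /p; case: (b); rewrite ?pair01E ?pair03E; case: (odd d).
have p_div d : p d %/ 4 = d %/ 4 by rewrite pE; case: ifP; rewrite ?rotd_div.
have pK : involutive p.
  move=> d; rewrite !pE; case E: (odd d == b); rewrite !odd_rotd ?negbK.
    have -> : (~~ odd d == b) = false by rewrite -(eqP E); case: (odd d).
    by rewrite rotd4.
  have -> : ~~ odd d == b by move: E; case: (odd d) (b) => [] [].
  by rewrite rotd4.
have pN d : p d != d by rewrite pE; case: ifP => _; apply/eqP; rewrite /rotd; lia.
have Sc : Sv (io d0) := rz_Sv rz d0.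
have r0 := remove_realizes (rem := fun j => j == i) (drop := fun _ => false)
  wfD p_div pK pN (fun _ _ => erefl) (fun _ _ => erefl) (fun _ _ _ => isT) (nfree D).
eexists; apply: (realizes_compose gK tg sc rz _ _ _ _ _ _ _ _ _ r0).
- exact: partner_dartK.
- by move=> d; rewrite /kept_crossing val_partner_dart // p_div.
- exact: tg_qK (smooth_tangle rot4 rot2 tg ov_rot Sc b).
- exact: tangle_Svq (smooth_tangle rot4 rot2 tg ov_rot Sc b).
- exact: (smooth_K ov tg Sc (sc_q sc) (sc_Sv sc) b).
- by move=> x /andP[].
- by move=> d; rewrite /smooth_Sv (rz_Sv rz) crossing_io.
- move=> x Sx; rewrite /smooth_map; case: ifP => // /(Sv_crossing tg Sc).
  by rewrite (negPf Sx).
move=> d; rewrite /kept_crossing negbK => di.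
rewrite /smooth_map crossing_io di (rz_ov rz) -!(rz_rot rz).
have R (x : dart D) : nat_of_ord (rot_dart x) = rotd x by apply: val_rot_dart.
have -> : partner_dart p d = if odd d == b then rot_dart (rot_dart (rot_dart d)) else rot_dart d.
  by apply: val_inj; rewrite val_partner_dart // pE; case: ifP => _ /=; rewrite !R.
by case: ifP.
Qed.

End Moves.
End MovesOfRealizations.

Definition extend_or (D : diagram) (T : Type) (o : T -> bool) (io : dart D -> T) (d : nat) : bool :=
  if insub d is Some x then o (io x) else false.

Lemma extend_orE D T (o : T -> bool) (io : dart D -> T) (d : dart D) :
  extend_or o io d = o (io d).
Proof. by rewrite /extend_or valK. Qed.

Lemma base_dart_lt (D : diagram) (i : 'I_(ncr D)) : 4 * i < 4 * ncr D.
Proof. by have := ltn_ord i; lia. Qed.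

Definition base_dart (D : diagram) (i : 'I_(ncr D)) : dart D := Ordinal (base_dart_lt i).

Lemma rot_dartE (D : diagram) (x : dart D) : rot_dart x = rotd x :> nat.
Proof. exact: val_rot_dart. Qed.

Lemma glue_dartE (D : diagram) (x : dart D) : wf_diagram D -> glue_dart x = glue D x :> nat.
Proof. by move=> wfD; apply: val_glue_dart. Qed.

(** * Components and crossing signs read on the fixed map *)

Section Invariants.

Variables (T : finType) (g rot : T -> T).
Hypothesis gK : involutive g.
Hypothesis gN : forall x, g x != x.
Hypothesis rot4 : forall x, rot (rot (rot (rot x))) = x.
Hypothesis rot2 : forall x, rot (rot x) != x.
Variables (q : T -> T) (Sv K ov : pred T) (nf : nat) (D : diagram) (io : dart D -> T).
Hypotheses (tg : tangle rot q Sv) (sc : strand_closed g q Sv K).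
Hypothesis rz : realizes g rot q Sv K ov nf io.

Let wfD := rz_wf gK tg sc rz.
Let opp (d : dart D) := rot_dart (rot_dart d).

Local Notation E := (strand_rel g q pred0 K).

Let comprelE : comprel D =2 strand_rel (@glue_dart D) opp pred0 predT.
Proof.
move=> x y; rewrite /comprel /strand_rel /= -!val_eqE /= !rot_dartE rotd2.
by rewrite glue_dartE.
Qed.

Let oppK : involutive opp.
Proof. by move=> d; rewrite /opp rot_dart4. Qed.

Let q_io d : q (io d) = io (opp d).
Proof. by rewrite (tg_q tg) ?(rz_Sv rz) // -!(rz_rot rz). Qed.

(** The components of [D] are its strands once every crossing is removed with the straight passage,
    which is a second stage without survivors. *)
Lemma connect_comprel d d' : connect (comprel D) d d' = connect E (io d) (io d').
Proof.
rewrite (eq_connect comprelE).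
apply: (connect_compose (S0 := pred0) (Sv2 := pred0) gK tg sc rz (tg_qK tg)) => //.
exact: sc_q sc.
Qed.

Lemma rz_ncomp : ncomp D = nf + n_comp E K.
Proof.
have C : circles g q pred0 K = circles g q Sv K + circles (@glue_dart D) opp pred0 predT.
  apply: (circles_compose (S0 := pred0) (Sv2 := pred0) gK tg sc rz oppK _ (tg_qK tg)) => //.
  exact: sc_q sc.
have CE : circles g q pred0 K = n_comp E K.
  apply: eq_n_comp_r => x; rewrite inE; apply: andb_idr => _.
  by apply/forallP => y; rewrite implybT.
have CD : circles (@glue_dart D) opp pred0 predT = n_comp (comprel D) predT.
  rewrite /circles (eq_n_comp (eq_connect (fun x y => esym (comprelE x y)))).
  apply: eq_n_comp_r => x; rewrite inE /=.
  by apply/forallP => y; rewrite implybT.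
by rewrite /ncomp (rz_free rz) -CE C CD addnC -addnA.
Qed.

Section Oriented.

Variable o : T -> bool.
Hypotheses (og : forall x, o (g x) = ~~ o x) (oq : forall x, o (q x) = ~~ o x).

Lemma rz_o_glue d : o (io (glue_dart d)) = ~~ o (io d).
Proof.
apply: (rz_walk gK gN tg sc rz (P := fun y => o y = ~~ o (io d))) => //.
by move=> y _ _ oy; rewrite og oq oy negbK.
Qed.

Lemma rz_valid_or : valid_or D (extend_or o io).
Proof.
move=> d dN; rewrite -[d]/(val (Ordinal dN)); move: (Ordinal dN) => x.
have -> : oppd (val x) = opp x by rewrite /opp !rot_dartE rotd2.
have -> : glue D (val x) = glue_dart x by rewrite glue_dartE.
by rewrite !extend_orE rz_o_glue -q_io oq.
Qed.

Local Open Scope ring_scope.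

Definition sgn_of (b : bool) : int := if b then 1 else -1.

(** Each crossing has exactly one outgoing under-dart, and its sign is positive when the over-strand
    leaves to the right of it. The predicate [P] serves to select self-crossings. *)
Lemma sum_csign (P : pred T) : (forall x, P (q x) = P x) ->
  \sum_(i < ncr D | P (io (base_dart i))) csign (extend_or o io) i =
  \sum_(x | [&& Sv x, ~~ ov x, o x & P x]) sgn_of (o (rot (rot (rot x)))).
Proof.
move=> Pq; pose b i := io (base_dart i).
have Sb i : Sv (b i) by apply: rz_Sv rz _.
pose out i := if o (b i) then b i else rot (rot (b i)).
have b_opp i : rot (rot (b i)) = io (opp (base_dart i)) by rewrite !(rz_rot rz).
have outE i : exists2 d : dart D, out i = io d & (d %/ 4)%N = i.
  rewrite /out b_opp; case: ifP => _; [exists (base_dart i)|exists (opp (base_dart i))] => //=.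
    by lia.
  by rewrite !rot_dartE !rotd_div /=; lia.
have out_inj : {in [set: 'I_(ncr D)] &, injective out}.
  move=> i j _ _; have [d1 -> E1] := outE i; have [d2 -> E2] := outE j.
  by move/(rz_inj rz) => Ed; apply: val_inj; rewrite /= -E1 -E2 Ed.
have qq x : Sv x -> rot (rot x) = q x by move=> Sx; rewrite (tg_q tg).
have Pout i : P (out i) = P (b i).
  by rewrite /out; case: ifP => // _; rewrite qq // Pq.
rewrite big_mkcond /= (eq_bigl (fun x => [&& Sv x, ~~ ov x & o x] && P x)); last first.
  by move=> x; rewrite -!andbA.
rewrite big_mkcondr /= (eq_bigl (fun x => x \in out @: [set: 'I_(ncr D)])) /=; last first.
  move=> x; apply/idP/imsetP=> [/and3P[Sx ux ox]|[i _ ->]].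
    have [d dx] := rz_surj rz Sx; rewrite -dx (rz_ov rz) in ux.
    have i_lt : (d %/ 4 < ncr D)%N by have := ltn_ord d; lia.
    exists (Ordinal i_lt); rewrite ?inE // /out.
    have : d = base_dart (Ordinal i_lt) \/ d = opp (base_dart (Ordinal i_lt)).
      case: (eqVneq (d %% 4)%N 0%N) => d4; [left|right]; apply: val_inj => /=.
        by lia.
      by rewrite /opp !rot_dartE /rotd /=; lia.
    case=> Ed.
      have <- : x = b (Ordinal i_lt) by rewrite -dx {1}Ed.
      by rewrite ox.
    have Ex : x = rot (rot (b (Ordinal i_lt))) by rewrite b_opp -dx {1}Ed.
    case: ifP => // ob; move: ox; rewrite Ex qq // oq ob.
    by [].
  rewrite /out; case: ifPn => ob.
    by rewrite Sb ob (rz_ov rz) /= andbT; lia.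
  rewrite b_opp (rz_Sv rz) (rz_ov rz) -b_opp qq // oq ob andbT.
  by rewrite /opp !rot_dartE /= !odd_rotd negbK; lia.
rewrite big_imset //=; apply: eq_big => [i|i _]; rewrite ?inE // Pout; case: ifP => // _.
rewrite /csign.
have -> : (4 * i + 2)%N = opp (base_dart i) by rewrite /opp !rot_dartE /rotd /=; lia.
have -> : (4 * i + 1)%N = rot_dart (base_dart i) by rewrite rot_dartE /rotd /=; lia.
rewrite !extend_orE -b_opp (rz_rot rz) qq // oq -/(b i) /out /sgn_of.
have oR x : Sv x -> o (rot (rot (rot x))) = ~~ o (rot x).
  by move=> Sx; rewrite qq ?(tg_rot tg).
case: (o (b i)); last by rewrite rot4; case: (o (rot _)).
by rewrite oR //; case: (o (rot _)).
Qed.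

End Oriented.
End Invariants.

(** * Traversal times and descending diagrams *)

Section Timings.

Variables (T : finType) (g q : T -> T).
Hypothesis gK : involutive g.
Hypothesis gN : forall x, g x != x.
Hypothesis qK : involutive q.
Hypothesis qN : forall x, q x != x.

Local Notation E := (strand_rel g q pred0 predT).

(* The passages through the vertices are numbered consecutively along each component,
   and one component after the other. *)
Record timing (o : T -> bool) (tm : T -> nat) : Prop := Timing {
  tm_q : forall x, tm (q x) = tm x;
  tm_inj : forall x y, tm x = tm y -> y = x \/ y = q x;
  tm_step : forall x, o x ->
    tm (g x) = (tm x).+1 \/ forall y, connect E x y -> tm y <= tm x;
  tm_sep : forall x y, ~~ connect E x y -> tm x < tm y ->
    forall x' y', connect E x x' -> connect E y y' -> tm x' < tm y' }.

Lemma full_strand_sym : connect_sym E.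
Proof.
exact: (strand_connect_sym (Sv := pred0) (K := predT) gK qK
  (fun=> erefl) (fun=> erefl) (fun=> erefl)).
Qed.

Lemma timing_exists (kap : T -> nat) :
    (forall x, kap (g x) = kap x) -> (forall x, kap (q x) = kap x) ->
  exists o tm, [/\ forall x, o (g x) = ~~ o x, forall x, o (q x) = ~~ o x,
    timing o tm & forall x y, kap x < kap y -> tm x < tm y].
Proof.
move=> kg kq; have [o og oq] := orientation_exists gK gN qK qN.
have s_inj := strand_next_inj gK qK; have s_sym := fconnect_sym s_inj.
pose s := strand_next g q.
(* The dart by which the passage through [x] is entered; [s] maps each entry to the next one along
   the orientation. *)
pose ent x := if o x then q x else x.
have ent_q x : ent (q x) = ent x by rewrite /ent oq; case: (o x); rewrite ?qK.
have o_ent x : o (ent x) = false.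
  by rewrite /ent; case: ifP => // ox; rewrite oq ox.
have o_s x : o (s x) = o x by rewrite /s /strand_next og oq negbK.
have ent_in x : o x = false -> ent x = x by rewrite /ent => ->.
have ent_g x : o x -> ent (g x) = s (ent x).
  by move=> ox; rewrite /ent og ox /s /strand_next qK.
have ent_eq x y : ent x = ent y -> y = x \/ y = q x.
  rewrite /ent; case: (o x) (o y) => [] [].
  - by move/(can_inj qK)->; left.
  - by move<-; right.
  - by move->; rewrite qK; right.
  - by move->; left.
pose N := #|T|.
pose rt x := fingraph.root (frel s) (ent x).
have rtE x y : connect E x y = (rt x == rt y).
  rewrite /rt root_connect //; apply/idP/idP.
    case/connectP=> p; elim: p x => [|z p IH] x /=; first by move=> _ ->; apply: connect0.
    case/andP=> xz pz Ey; apply: connect_trans (IH z pz Ey).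
    move: xz; rewrite /strand_rel /= => /orP[]/eqP->; last by rewrite ent_q connect0.
    case: (boolP (o x)) => ox; first by rewrite ent_g // fconnect1.
    have -> : ent x = s (ent (g x)) by rewrite -{1}(gK x) ent_g // og.
    by rewrite s_sym fconnect1.
  have c_ent z : connect E z (ent z).
    rewrite /ent; case: ifP => _; last exact: connect0.
    by apply: connect1; rewrite /strand_rel eqxx orbT.
  move=> c; apply: connect_trans (c_ent x) _; rewrite full_strand_sym.
  apply: connect_trans (c_ent y) _; rewrite full_strand_sym.
  case/connectP: c => p; elim: p (ent x) => [|z p IH] x' /=; first by move=> _ ->; apply: connect0.
  case/andP=> /eqP <- pz Ey; apply: connect_trans (IH _ pz Ey).
  apply: (@connect_trans _ _ (q x')); apply: connect1; first by rewrite /strand_rel eqxx orbT.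
  by rewrite /strand_rel eqxx.
pose fi x := findex s (rt x) (ent x).
have rt_conn x : fconnect s (rt x) (ent x) by rewrite s_sym; apply: connect_root.
have fiN x : fi x < N by apply: leq_trans (findex_max (rt_conn x)) (max_card _).
pose rk x : nat := enum_rank (rt x).
have rkN x : rk x < N by apply: ltn_ord.
have rk_eq x y : rk x = rk y -> rt x = rt y by move/val_inj/enum_rank_inj.
(* Three digits in base [N]: the prescribed key, the component, the position on it. The key
   dominates, so the components are traversed in its order. *)
pose tm x := (kap x * N + rk x) * N + fi x.
have kap_E x y : connect E x y -> kap x = kap y.
  case/connectP=> p; elim: p x => [|z p IH] x /=; first by move=> _ ->.
  by case/andP=> /orP[]/eqP-> pz /(IH _ pz) <-; rewrite ?kg ?kq.
have dm a b r r' : r < N -> r' < N -> a * N + r < b * N + r' -> a <= b.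
  by move=> rN r'N; rewrite leqNgt => lt; apply/negP=> ba; nia.
have dm_lt a b r r' : r < N -> r' < N -> a < b -> a * N + r < b * N + r' by move=> *; nia.
have dm_eq a b r r' : r < N -> r' < N -> a * N + r = b * N + r' -> a = b /\ r = r'.
  move=> rN r'N e; case: (ltngtP a b) => ab; [nia|nia|by subst b; split=> //; lia].
exists o, tm; split=> //; last first.
  by move=> x y kxy; rewrite /tm; apply: (dm_lt) => //; apply: (dm_lt).
split.
- by move=> x; rewrite /tm kq /rk /fi /rt ent_q.
- move=> x y /dm_eq[] // /dm_eq[] // _ /rk_eq rxy ffi; apply: ent_eq.
  by rewrite -(iter_findex (rt_conn x)) -(iter_findex (rt_conn y)) -!/(fi _) ffi rxy.
- move=> x ox.
  have rg : rt (g x) = rt x.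
    by apply/eqP; rewrite -rtE full_strand_sym connect1 // /strand_rel eqxx.
  have eg : ent (g x) = iter (fi x).+1 s (rt x).
    by rewrite ent_g // iterS /fi iter_findex.
  case: (ltnP (fi x).+1 (order s (rt x))) => [lt|ge]; [left|right].
    by rewrite /tm kg /rk rg /fi rg eg findex_iter // addnS.
  move=> y xy; have := xy; rewrite rtE => /eqP rxy.
  rewrite /tm (kap_E _ _ xy) /rk -rxy leq_add2l.
  by have := findex_max (rt_conn y); rewrite -/(fi y) -rxy; lia.
move=> x y nc; rewrite /tm => lt x' y' xx' yy'.
rewrite -(kap_E _ _ xx') -(kap_E _ _ yy').
have -> : rk x' = rk x by rewrite /rk; have := xx'; rewrite rtE => /eqP->.
have -> : rk y' = rk y by rewrite /rk; have := yy'; rewrite rtE => /eqP->.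
apply: dm_lt => //; have := dm _ _ _ _ (fiN x) (fiN y) lt; rewrite leq_eqVlt => /orP[/eqP e|//].
have [_ /rk_eq rxy] := dm_eq _ _ _ _ (rkN x) (rkN y) e.
by rewrite rtE rxy eqxx in nc.
Qed.

End Timings.

Section Descending.

Variables (T : finType) (g rot : T -> T).
Hypothesis gK : involutive g.
Hypothesis gN : forall x, g x != x.
Variables (q : T -> T) (Sv K ov : pred T) (nf : nat) (D : diagram) (io : dart D -> T).
Hypotheses (tg : tangle rot q Sv) (sc : strand_closed g q Sv K).
Hypothesis rz : realizes g rot q Sv K ov nf io.

Local Notation E := (strand_rel g q pred0 predT).

Lemma connect_full x : K x -> connect (strand_rel g q pred0 K) x =1 connect E x.
Proof.
move=> Kx; apply: connect_local => [y z|y z xy]; first by case/andP=> _ yz; apply/andP.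
case/andP=> _ yz; apply/andP; split=> //.
have cl := strand_closedK (Sv := pred0) gK (tg_qK tg) (fun=> erefl) (sc_g sc) (sc_q sc).
by have := closed_connect cl xy; rewrite !unfold_in Kx.
Qed.

Lemma samecomp_dart (x y : dart D) : samecomp D x y = connect E (io x) (io y).
Proof.
rewrite -connect_full; last exact/(sc_Sv sc)/(rz_Sv rz).
rewrite -(connect_comprel gK tg sc rz); apply/idP/idP.
  by case/existsP=> u /existsP[v /and3P[/eqP/val_inj-> /eqP/val_inj->]].
by move=> xy; apply/existsP; exists x; apply/existsP; exists y; rewrite !eqxx.
Qed.

Variables (o : T -> bool) (tm : T -> nat).
Hypotheses (og : forall x, o (g x) = ~~ o x) (oq : forall x, o (q x) = ~~ o x).
Hypothesis tmP : timing g q o tm.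

(* Along the removed part of a strand the time grows until it wraps around at the
   end of the component, and no surviving passage can be skipped meanwhile. *)
Lemma timing_glue (x : dart D) : o (io x) ->
  tm (io x) < tm (io (glue_dart x)) \/
  forall y : dart D, connect E (io x) (io y) -> tm (io y) <= tm (io x).
Proof.
move=> ox; set t := tm (io x).
pose P y := o y = false /\
  (t < tm y /\ (forall z, Sv z -> t < tm z -> tm y <= tm z) \/
   forall z, Sv z -> connect E (io x) z -> tm z <= t).
suff : P (io (glue_dart x)).
  case=> _ [[lt _]|H]; [by left|right=> y].
  by apply: H; apply: rz_Sv rz _.
have Esym := full_strand_sym gK (tg_qK tg).
apply: (rz_walk gK gN tg sc rz) => [|y Sy xy [oy Py]].
  split; first by rewrite og ox.
  have [->|H] := tm_step tmP ox; [left|by right=> z _; apply: H].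
  by rewrite ltnS leqnn.
have oqy : o (q y) by rewrite oq oy.
split; first by rewrite og oqy.
case: Py => [[lt H]|]; last by right.
have nz z : Sv z -> tm z != tm y.
  move=> Sz; apply: contraNneq Sy => e; have [->//|->] := tm_inj tmP e.
  by rewrite (tangle_Svq tg).
have H' z : Sv z -> t < tm z -> tm y < tm z.
  by move=> Sz tz; rewrite ltn_neqAle eq_sym nz // H.
have := tm_step tmP oqy; rewrite (tm_q tmP) => -[e|m].
  by left; rewrite e; split=> //; apply: ltn_trans lt _.
right=> z Sz xz; rewrite leqNgt; apply/negP=> /(H' z Sz); apply/negP.
rewrite -leqNgt; apply: m; have yq : connect E (q y) y.
  by apply: connect1; rewrite /strand_rel /= (tg_qK tg) eqxx orbT.
apply: connect_trans yq _; rewrite Esym.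
suff xy' : connect E (io x) y by rewrite Esym in xz; apply: connect_trans xz xy'.
apply: connect_sub xy => u v /andP[_ uv]; apply: connect1.
by case/orP: uv => [/eqP->|/andP[_ /eqP->]]; rewrite /strand_rel eqxx ?orbT.
Qed.

Definition passage_time (i : nat) (b : bool) : nat :=
  if insub (4 * i + b)%N is Some x then tm (io (x : dart D)) else 0.

(** [descending] only compares times, so those of the fixed map can be used although they are no
    longer consecutive on the remaining diagram. *)
Lemma rz_descending : (forall x, Sv x -> ov x -> tm x < tm (rot x)) ->
  descending D (extend_or o io).
Proof.
move=> good; exists passage_time.
have ptE (x : dart D) i (b : bool) : val x = 4 * i + b -> passage_time i b = tm (io x).
  by move=> e; rewrite /passage_time -e valK.
have pl i (b : bool) : i < ncr D -> 4 * i + b < 4 * ncr D by case: b; lia.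
have pd i (b : bool) : i < ncr D -> exists2 x : dart D, val x = 4 * i + b & passage_time i b = tm (io x).
  by move=> lt; exists (Ordinal (pl i b lt)) => //; apply: ptE.
have tm_opp (x : dart D) : tm (io (rot_dart (rot_dart x))) = tm (io x).
  by rewrite !(rz_rot rz) -(tg_q tg) ?(rz_Sv rz) // (tm_q tmP).
have wfD := rz_wf gK tg sc rz.
have rot_val (x : dart D) : val (rot_dart x) = rotd (val x) by apply: val_rot_dart.
have opp_val (x : dart D) : val (rot_dart (rot_dart x)) = oppd (val x).
  by rewrite !rot_val rotd2.
split.
- move=> i b j c iN jN.
  have [x Ex ->] := pd i b iN; have [y Ey ->] := pd j c jN.
  case/(tm_inj tmP) => [|]; last rewrite (tg_q tg) ?(rz_Sv rz) // -!(rz_rot rz).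
    by move/(rz_inj rz)/(congr1 val); rewrite Ex Ey; case: b c {Ex Ey} => [] []; lia.
  move/(rz_inj rz)/(congr1 val); rewrite opp_val Ey Ex /oppd; case: b c {Ex Ey} => [] [] /=; lia.
- move=> i iN; have [x Ex ->] := pd i true iN; have [y Ey ->] := pd i false iN.
  have ovx : ov (io x) by rewrite (rz_ov rz) -[nat_of_ord x]/(val x) Ex; lia.
  suff -> : tm (io y) = tm (io (rot_dart x)) by rewrite (rz_rot rz) good // (rz_Sv rz).
  rewrite -tm_opp; congr (tm (io _)); apply: val_inj; rewrite opp_val rot_val.
  by rewrite Ex Ey /oppd /rotd; lia.
- move=> i b iN /=; have [x Ex ->] := pd i b iN.
  pose x' := if o (io x) then x else rot_dart (rot_dart x).
  have Epout : pout (extend_or o io) i b = val x'.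
    rewrite /pout -Ex extend_orE /x'; case: ifP => _ //.
    by rewrite opp_val Ex /oppd; case: (b) => /=; lia.
  have ox' : o (io x').
    rewrite /x'; case: ifP => // ox.
    by rewrite !(rz_rot rz) -(tg_q tg) ?(rz_Sv rz) // oq ox.
  have tx' : tm (io x) = tm (io x') by rewrite /x'; case: ifP.
  have Eg : glue D (pout (extend_or o io) i b) = val (glue_dart x').
    by rewrite Epout val_glue_dart.
  rewrite Eg tx'.
  have [lt|H] := timing_glue ox'; [left|right].
    set y := glue_dart x' in lt *.
    have [|z Ez ->] := pd (val y %/ 4) (odd (val y)); first by have := ltn_ord y; rewrite /=; lia.
    suff -> : tm (io z) = tm (io y) by [].
    case: (eqVneq z y) => [->//|zy].
    rewrite -tm_opp; congr (tm (io _)); apply: val_inj; rewrite opp_val.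
    move: zy; rewrite -(inj_eq val_inj) Ez /oppd; move: (val y) => v /eqP; lia.
  move=> j c jN sc'; have [y Ey ->] := pd j c jN.
  apply: H; move: sc'; rewrite -Ex -Ey samecomp_dart.
  apply: connect_trans; rewrite /x'; case: ifP => _; first exact: connect0.
  rewrite !(rz_rot rz) -(tg_q tg) ?(rz_Sv rz) //; apply: connect1.
  by rewrite /strand_rel /= (tg_qK tg) eqxx orbT.
move=> i b j c iN jN; have [x Ex ->] := pd i b iN; have [y Ey ->] := pd j c jN.
rewrite -Ex -Ey samecomp_dart => nc lt i' b' j' c' iN' jN'.
have [x' Ex' ->] := pd i' b' iN'; have [y' Ey' ->] := pd j' c' jN'.
rewrite -Ex' -Ey' !samecomp_dart => xx' yy'; exact: (tm_sep tmP nc lt xx' yy').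
Qed.

End Descending.

(** A function constant along [e'] is constant along [e]; the dimensions are compared. *)
Lemma n_comp_le (T : finType) (e e' : rel T) : connect_sym e -> connect_sym e' ->
  subrel e (connect e') -> n_comp e' T <= n_comp e T.
Proof.
move=> se se' sub; rewrite -!rank_cst_mx //; apply/mxrankS/rV_subP => z.
move/(sub_cst_mx se') => zc; apply/(sub_cst_mx se) => x y /sub/connectP[p].
elim: p x => [|w p IH] x /=; first by move=> _ ->.
by case/andP=> /zc-> pw /(IH _ pw).
Qed.

(** * Additivity of the writhe for stacked strands *)

Section Writhe.

Variables (T : finType) (g rot : T -> T).
Hypothesis gK : involutive g.
Hypothesis gN : forall x, g x != x.
Hypothesis rot4 : forall x, rot (rot (rot (rot x))) = x.
Variables (q : T -> T) (Sv ov : pred T).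
Hypothesis tg : tangle rot q Sv.
Hypothesis ov_rot : forall x, ov (rot x) = ~~ ov x.
Variable o : T -> bool.
Hypotheses (og : forall x, o (g x) = ~~ o x) (oq : forall x, o (q x) = ~~ o x).
Hypothesis bounds : strand_cycles_bound g rot q Sv predT.
Variables (A B : pred T).
Hypotheses (Ag : forall x, A (g x) = A x) (Aq : forall x, A (q x) = A x).
Hypotheses (Bg : forall x, B (g x) = B x) (Bq : forall x, B (q x) = B x).
Hypothesis AB : forall x, A x -> ~~ B x.

Local Open Scope ring_scope.

Definition strand_writhe (S : pred T) : int :=
  \sum_(x | [&& S x, ~~ ov x & o x]) sgn_of (o (rot (rot (rot x)))).

(* The strands of [A] form a cycle, bounding a face function [h]; [h] jumps by the
   crossing sign each time a strand of [B] meets one of [A], and returns to its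
   initial value along every closed strand of [B]. *)
Lemma linking_zero :
  \sum_(x | [&& Sv x, o x, B x & A (rot x)]) sgn_of (o (rot (rot (rot x)))) = 0.
Proof.
pose sg (b : bool) : rat := if b then 1 else -1.
have sgN b : sg (~~ b) = - sg b by case: b; rewrite /= ?opprK.
have oR x : Sv x -> o (rot (rot x)) = ~~ o x by move=> Sx; rewrite -(tg_q tg) // oq.
have AR x : Sv x -> A (rot (rot x)) = A x by move=> Sx; rewrite -(tg_q tg) // Aq.
pose z x : rat := if A x then sg (o x) else 0.
have zq x : z (q x) = - z x by rewrite /z Aq oq sgN; case: (A x); rewrite ?oppr0.
have [x|x _|x Sx|//|h [hg hr]] := bounds (z := z).
- by rewrite /z Ag og sgN; case: (A x); rewrite ?oppr0.
- exact: zq.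
- by rewrite -(tg_q tg (x := rot x)) ?(tg_rot tg) // -(tg_q tg Sx) !zq; ring.
have zB x : B x -> z x = 0.
  by move=> Bx; rewrite /z; case: ifP => // /AB; rewrite Bx.
have hB x : B x -> h (g x) = h x.
  by move=> Bx; apply/eqP; rewrite eq_sym -subr_eq0 hg // zB.
have jump x : B x -> h x - h (q x) = if Sv x then z (rot x) else 0.
  move=> Bx; case: (boolP (Sv x)) => Sx.
    have h1 := hr x isT; have h2 := hr (rot x) isT; rewrite (tg_rot tg) Sx in h2.
    rewrite Sx hB // in h1; rewrite (tg_q tg) // h2 -(hg (rot x)) // h1; ring.
  by have := hr x isT; rewrite (negPf Sx) hB // => ->; rewrite subrr.
have tot : \sum_(x | o x && B x) (h x - h (q x)) = 0.
  rewrite sumrB; apply/eqP; rewrite subr_eq0; apply/eqP.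
  rewrite [LHS](reindex_inj (inv_inj gK)) [RHS](reindex_inj (inv_inj (tg_qK tg))) /=.
  apply: eq_big => x; first by rewrite og oq Bg Bq.
  by case/andP=> _; rewrite Bg => Bx; rewrite hB // (tg_qK tg).
have E : \sum_(x | [&& Sv x, o x, B x & A (rot x)]) sg (o (rot x)) = 0.
  rewrite -[RHS]tot big_mkcond [RHS]big_mkcond /=; apply: eq_bigr => x _.
  case: (o x); rewrite /= ?andbF //; case: (boolP (B x)) => Bx; rewrite /= ?andbF //.
  by rewrite jump // /z; case: (Sv x).
apply/eqP; rewrite -(intr_eq0 rat) rmorph_sum /= -oppr_eq0 -sumrN; apply/eqP.
rewrite -[RHS]E; apply: eq_bigr => x /andP[Sx _]; rewrite oR ?(tg_rot tg) //.
by rewrite /sgn_of; case: (o (rot x)).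
Qed.

Hypothesis A_above : forall x, Sv x -> B x -> A (rot x) -> ~~ ov x.

(** The union has in addition the crossings between [A] and [B]. There [B] runs below, so their
    outgoing under-darts are the darts summed in [linking_zero]. *)
Lemma strand_writheU : strand_writhe (restrict rot Sv [pred x | A x || B x]) =
  strand_writhe (restrict rot Sv A) + strand_writhe (restrict rot Sv B).
Proof.
have AR x : Sv x -> A (rot (rot x)) = A x by move=> Sx; rewrite -(tg_q tg) // Aq.
rewrite -[RHS]addr0 -[X in _ + X]linking_zero /strand_writhe.
rewrite big_mkcond [in RHS]big_mkcond /= [X in _ + X + _]big_mkcond [X in _ + X]big_mkcond /=.
rewrite -!big_split /=; apply: eq_bigr => x _; rewrite /restrict /=.
case: (boolP (Sv x)) => Sx; rewrite /= ?addr0 //.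
have Sr : Sv (rot x) by rewrite (tg_rot tg).
have := @AB x; have := @AB (rot x); have := A_above Sx; have := A_above Sr.
rewrite AR // ov_rot negbK.
case: (A x) (B x) (A (rot x)) (B (rot x)) (ov x) => [] [] [] [] [];
  move=> H1 H2 H3 H4; rewrite /= ?addr0 ?add0r //;
  try (by have := H1 isT isT); try (by have := H2 isT isT); try (by have := H3 isT);
  try (by have := H4 isT); by case: (o x); rewrite /= ?addr0 ?add0r.
Qed.

End Writhe.

(** * Components of a smoothing *)

Section ComponentCounts.

Variables (T : finType) (g rot : T -> T).
Hypothesis gK : involutive g.
Hypothesis gN : forall x, g x != x.
Hypothesis rot4 : forall x, rot (rot (rot (rot x))) = x.
Hypothesis rot2 : forall x, rot (rot x) != x.
Variables (q : T -> T) (Sv ov : pred T) (c : T) (b : bool).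
Hypothesis tg : tangle rot q Sv.
Hypothesis ov_rot : forall x, ov (rot x) = ~~ ov x.
Hypothesis Sc : Sv c.

Local Notation comps q := (strand_rel g q pred0 predT).
Local Notation q' := (smooth_map rot ov b c q).

Let tg' : tangle rot q' (smooth_Sv rot c Sv) := smooth_tangle rot4 rot2 tg ov_rot Sc b.
Let symq : connect_sym (comps q) := full_strand_sym gK (tg_qK tg).
Let symq' : connect_sym (comps q') := full_strand_sym gK (tg_qK tg').

(** The strands with all four darts at [c] tied together: a common refinement of both situations,
    obtained by adding one edge to the strands of [q] and also by adding one edge to those of
    [q']. *)
Let join : rel T := fun x y => comps q x y || crossing rot c x && crossing rot c y.

Let sym_join : connect_sym join.
Proof.
apply: sym_connect_sym => x y; rewrite /join [X in _ || X]andbC; congr (_ || _).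
rewrite /strand_rel /=; congr (_ || _).
  by rewrite eq_sym (can2_eq gK gK).
by rewrite eq_sym (can2_eq (tg_qK tg) (tg_qK tg)).
Qed.

Let crR x : crossing rot c (rot x) = crossing rot c x := crossing_rot rot4 c x.

Let const_q (z : T -> rat) : (forall x y, comps q x y -> z x = z y) <->
  (forall x, z (g x) = z x) /\ (forall x, z (q x) = z x).
Proof.
split=> [H|[Hg Hq] x y /orP[]/eqP->]; rewrite ?Hg ?Hq //.
by split=> x; apply/esym/H; rewrite /strand_rel eqxx ?orbT.
Qed.

Let const_q' (z : T -> rat) : (forall x y, comps q' x y -> z x = z y) <->
  (forall x, z (g x) = z x) /\ (forall x, z (q' x) = z x).
Proof.
split=> [H|[Hg Hq] x y /orP[]/eqP->]; rewrite ?Hg ?Hq //.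
by split=> x; apply/esym/H; rewrite /strand_rel eqxx ?orbT.
Qed.

Let const_join (z : T -> rat) : (forall x y, join x y -> z x = z y) <->
  [/\ forall x, z (g x) = z x, forall x, z (q x) = z x &
     forall x, crossing rot c x -> z x = z c].
Proof.
split=> [H|[Hg Hq Hc] x y].
  split=> x; [| |by move=> cx; apply: H; rewrite /join cx crossing_refl orbT];
  by apply/esym/H; rewrite /join /strand_rel eqxx ?orbT.
case/orP=> [/orP[]/eqP->|/andP[cx cy]]; rewrite ?Hg ?Hq //.
by rewrite (Hc x) // (Hc y).
Qed.

Let join_q (z : T -> rat) : (forall x y, join x y -> z x = z y) <->
  (forall x y, comps q x y -> z x = z y) /\ z c = z (rot c).
Proof.
rewrite const_join const_q; split=> [[Hg Hq Hc]|[[Hg Hq] e]].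
  by split=> //; rewrite Hc // crR crossing_refl.
split=> // x /crossingP[]-> //.
  by rewrite -(tg_q tg) // Hq.
by rewrite -(tg_q tg) ?(tg_rot tg) // Hq.
Qed.

Let q'_out x : ~~ crossing rot c x -> q' x = q x.
Proof. by rewrite /smooth_map => /negPf->. Qed.

Let q'_cross : [\/ q' c = rot c /\ q' (rot (rot c)) = rot (rot (rot c)) |
  q' c = rot (rot (rot c)) /\ q' (rot (rot c)) = rot c].
Proof.
rewrite /smooth_map !crR crossing_refl !ov_rot negbK rot4.
by case: ifP => _; [right|left].
Qed.

Let join_q' (z : T -> rat) : (forall x y, join x y -> z x = z y) <->
  (forall x y, comps q' x y -> z x = z y) /\ z c = z (rot (rot c)).
Proof.
rewrite const_join const_q'; split=> [[Hg Hq Hc]|[[Hg Hq'] e]].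
  split; last by rewrite Hc // !crR crossing_refl.
  split=> // x; case: (boolP (crossing rot c x)) => cx; last by rewrite q'_out // Hq.
  have : crossing rot c (q' x) by rewrite /smooth_map cx; case: ifP => _; rewrite !crR.
  by move=> cqx; rewrite (Hc x) // Hc.
have Hc x : crossing rot c x -> z x = z c.
  have := Hq' c; have := Hq' (rot (rot c)).
  by case: q'_cross => [] [-> ->] e1 e2 /crossingP[]->; congruence.
split=> // x; case: (boolP (crossing rot c x)) => cx; last by rewrite -q'_out // Hq'.
by rewrite (Hc x) // Hc // (crossing_q rot4 tg Sc).
Qed.

(** Undoing one edge of [join] gives back [q'], with at most one component more, whereas [join] has
    no more components than [q]. *)
Lemma smooth_n_comp : n_comp (comps q') T <= (n_comp (comps q) T).+1.
Proof.
apply: leq_trans (n_comp_edge symq' sym_join join_q') _; rewrite ltnS.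
by apply: n_comp_le => // x y xy; apply: connect1; rewrite /join xy.
Qed.

Lemma smooth_n_comp_merge : ~~ connect (comps q) c (rot c) ->
  (n_comp (comps q') T).+1 = n_comp (comps q) T.
Proof.
move=> nc; rewrite (n_comp_edge_merge symq sym_join join_q nc); congr _.+1.
have crq x : crossing rot c (q x) = crossing rot c x := crossing_q rot4 tg Sc x.
(* With the crossing at [c] as the only survivor, the strand leaving by [c] returns at another of
   its darts. That dart is opposite to [c], since the two passages belong to different components.
   The outer strand thus persists in the smoothing and ties all four darts together. *)
have [y [cy yc]] : exists y, [/\ crossing rot c y, y != c &
    connect (strand_rel g q (crossing rot c) predT) c y].
  apply: strand_end_exists => //; [exact: tg_qK tg|exact: tg_qN tg|exact: crossing_refl].
have sub q1 : (forall x, ~~ crossing rot c x -> q1 x = q x) ->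
    subrel (strand_rel g q (crossing rot c) predT) (comps q1).
  move=> q1E x w /andP[_ /orP[/eqP->|/andP[nx /eqP->]]]; rewrite /strand_rel /=.
    by rewrite eqxx.
  by rewrite q1E // eqxx orbT.
move=> cyc; have cy1 : connect (comps q) c y.
  by apply: connect_sub cyc => u v /(sub q (fun=> fun=> erefl))/connect1.
have cy2 : connect (comps q') c y.
  by apply: connect_sub cyc => u v /(sub q' q'_out)/connect1.
have Ey : y = rot (rot c).
  case/crossingP: cy => // Ey; subst y; first by rewrite eqxx in yc.
    by rewrite cy1 in nc.
  case/negP: nc; apply: connect_trans cy1 _; rewrite symq; apply: connect1.
  by rewrite /strand_rel /= (tg_q tg) ?(tg_rot tg) // eqxx orbT.
subst y; have c4 x : crossing rot c x -> connect (comps q') c x.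
  have st y : connect (comps q') y (q' y) by apply: connect1; rewrite /strand_rel eqxx orbT.
  have := st c; have := st (rot (rot c)).
  case: q'_cross => [] [-> ->] e1 e2 /crossingP[]-> //; exact: connect_trans cy2 e1.
apply/eqP; rewrite eqn_leq; apply/andP; split; apply: n_comp_le => // x y.
  case/orP=> [/orP[]/eqP->|/andP[cx cy']].
  - by apply: connect1; rewrite /strand_rel eqxx.
  - case: (boolP (crossing rot c x)) => cx.
      by rewrite symq'; apply: (@connect_trans _ _ c); [rewrite symq'|]; apply: c4; rewrite ?crq.
    by rewrite -q'_out //; apply: connect1; rewrite /strand_rel eqxx orbT.
  by apply: (@connect_trans _ _ c); [rewrite symq'|]; apply: c4.
case/orP=> /eqP->; apply: connect1; rewrite /join /strand_rel /= ?eqxx //.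
case: (boolP (crossing rot c x)) => cx; last by rewrite q'_out ?eqxx ?orbT.
by rewrite /smooth_map cx; case: ifP => _; rewrite !crR cx orbT.
Qed.

End ComponentCounts.

Local Open Scope ring_scope.

(** * Cumulants *)

Section Cumulants.

Variables (F : fieldType) (C : finType).

Definition ordpart_on (A : {set C}) (r : nat) (P : {ffun 'I_r -> {set C}}) : bool :=
  [&& [forall i, P i != set0],
      [forall i, forall j, (i != j) ==> [disjoint P i & P j]] &
      (\bigcup_(i < r) P i == A)].

Definition block_sum (A : {set C}) (r : nat) (Y : {set C} -> F) : F :=
  \sum_(P : {ffun 'I_r -> {set C}} | ordpart_on A P) \prod_(i < r) Y (P i).

(* There is no ordered partition of [A] into more than [#|A|] blocks: the range [#|C|] is
   as good as [#|A|], and it is not affected by merging colours. *)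
Definition cumulant (A : {set C}) (Y : {set C} -> F) : F :=
  \sum_(r < #|C|) (-1) ^+ r / (r.+1)%:R * block_sum A r.+1 Y.

Lemma ordpart_onP (A : {set C}) r (P : {ffun 'I_r -> {set C}}) :
  reflect [/\ forall i, P i != set0, forall i j, i != j -> [disjoint P i & P j],
    forall i, P i \subset A & forall a, a \in A -> exists i, a \in P i] (ordpart_on A P).
Proof.
apply: (iffP and3P) => [[/forallP n /forallP d /eqP u]|[n d s c]]; split=> //.
- by move=> i j ij; have /forallP/(_ j) := d i; rewrite ij.
- by move=> i; rewrite -u; apply: bigcup_sup.
- by move=> a; rewrite -u => /bigcupP[i _ ai]; exists i.
- exact/forallP.
- by apply/forallP=> i; apply/forallP=> j; apply/implyP; apply: d.
rewrite eqEsubset; apply/andP; split; first by apply/bigcupsP=> i _.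
by apply/subsetP=> a /c[i ai]; apply/bigcupP; exists i.
Qed.

Lemma ordpart_uniq (A : {set C}) r (P : {ffun 'I_r -> {set C}}) i j a :
  ordpart_on A P -> a \in P i -> a \in P j -> i = j.
Proof.
case/ordpart_onP=> _ d _ _ ai aj; apply/eqP; apply: contraT => ij.
by have /disjointFr/(_ ai) := d i j ij; rewrite aj.
Qed.

Lemma ordpart_card (A : {set C}) r (P : {ffun 'I_r -> {set C}}) :
  ordpart_on A P -> (r <= #|A|)%N.
Proof.
move=> oP; have [n d s c] := ordpart_onP _ _ oP.
have pk i : {a | a \in P i} by have /set0Pn := n i; exact: sigW.
have inj : injective (fun i => sval (pk i)).
  move=> i j /= e; have aj := svalP (pk j); rewrite -e in aj.
  exact: (ordpart_uniq oP (svalP (pk i)) aj).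
rewrite -[X in (X <= _)%N]card_ord -(card_codom inj); apply: subset_leq_card.
by apply/subsetP=> _ /codomP[i ->]; exact: (subsetP (s i) _ (svalP (pk i))).
Qed.

Lemma block_sum_gt (A : {set C}) r Y : (#|A| < r)%N -> block_sum A r Y = 0.
Proof.
by move=> lt; apply: big_pred0 => P; apply/negP=> /ordpart_card; rewrite leqNgt lt.
Qed.

Lemma block_sum0 (A : {set C}) Y : A != set0 -> block_sum A 0 Y = 0.
Proof.
case/set0Pn=> a aA; apply: big_pred0 => P; apply/negP=> /ordpart_onP[_ _ _ /(_ a aA)].
by case=> -[].
Qed.

Lemma eq_cumulant (A : {set C}) (Y Y' : {set C} -> F) : (forall S : {set C}, S != set0 -> S \subset A -> Y S = Y' S) ->
  cumulant A Y = cumulant A Y'.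
Proof.
move=> E; apply: eq_bigr => r _; congr (_ * _); apply: eq_bigr => P.
by case/ordpart_onP=> n _ s _; apply: eq_bigr => i _; apply: E.
Qed.

Lemma cumulant_weight (A : {set C}) (w : C -> F) (Y : {set C} -> F) :
  cumulant A (fun S => (\prod_(c in S) w c) * Y S) = (\prod_(c in A) w c) * cumulant A Y.
Proof.
rewrite /cumulant mulr_sumr; apply: eq_bigr => r _; rewrite mulrCA; congr (_ * _).
rewrite /block_sum mulr_sumr; apply: eq_bigr => P oP; rewrite big_split /=; congr (_ * _).
have [_ d _ _] := ordpart_onP _ _ oP; case/and3P: oP => _ _ /eqP <-.
by rewrite partition_disjoint_bigcup.
Qed.

Section Differences.

Variables (z : F) (Y Y' Y1 Y2 : {set C} -> F).

Lemma prod_difference r (P : {ffun 'I_r -> {set C}}) j :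
  (forall i, i != j -> [/\ Y (P i) = Y' (P i), Y (P i) = Y1 (P i) & Y (P i) = Y2 (P i)]) ->
  Y (P j) - Y' (P j) = z * (Y1 (P j) - Y2 (P j)) ->
  \prod_i Y (P i) - \prod_i Y' (P i) = z * (\prod_i Y1 (P i) - \prod_i Y2 (P i)).
Proof.
move=> E Ej; rewrite (bigD1 j) // [X in _ - X](bigD1 j) //= [X in z * (X - _)](bigD1 j) //=.
rewrite [X in z * (_ - X)](bigD1 j) //=; pose p := \prod_(i | i != j) Y (P i).
have -> : \prod_(i | i != j) Y' (P i) = p.
  by apply: eq_bigr => i /E[].
have -> : \prod_(i | i != j) Y1 (P i) = p by apply: eq_bigr => i /E[].
have -> : \prod_(i | i != j) Y2 (P i) = p by apply: eq_bigr => i /E[].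
by rewrite -/p -!mulrBl Ej mulrA.
Qed.

(** Exactly one block of each partition contains [a]; the four products differ in that block
    alone. *)
Lemma cumulant_self (A : {set C}) a : a \in A ->
  (forall S : {set C}, S \subset A -> a \notin S -> S != set0 ->
    [/\ Y S = Y' S, Y S = Y1 S & Y S = Y2 S]) ->
  (forall S : {set C}, S \subset A -> a \in S -> Y S - Y' S = z * (Y1 S - Y2 S)) ->
  cumulant A Y - cumulant A Y' = z * (cumulant A Y1 - cumulant A Y2).
Proof.
move=> aA Eo Ei; rewrite /cumulant -!sumrB mulr_sumr; apply: eq_bigr => r _.
rewrite -!mulrBr mulrCA; congr (_ * _); rewrite /block_sum -!sumrB mulr_sumr.
apply: eq_bigr => P oP; have [n d s c] := ordpart_onP _ _ oP.
have [j aj] := c a aA; apply: (prod_difference (j := j)) => [i ij|]; last exact: Ei.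
by apply: Eo => //; apply: contra ij => ai; rewrite (ordpart_uniq oP ai aj).
Qed.

Definition merge_set (a b : C) (S : {set C}) : {set C} := if a \in S then b |: S else S.

(** Deleting [b] is a bijection from the partitions having [a] and [b] in one block onto the
    partitions of [A] without [b]; its inverse puts [b] next to [a]. *)
Lemma block_sum_merge (A : {set C}) a b r (W : {set C} -> F) : a \in A -> b \in A -> a != b ->
  \sum_(P : {ffun 'I_r -> {set C}} | ordpart_on A P && [exists i, (a \in P i) && (b \in P i)])
     \prod_(i < r) W (P i) = block_sum (A :\ b) r (fun S => W (merge_set a b S)).
Proof.
move=> aA bA ab.
pose h (P : {ffun 'I_r -> {set C}}) := [ffun i => merge_set a b (P i)].
pose h' (P : {ffun 'I_r -> {set C}}) := [ffun i => P i :\ b].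
rewrite (reindex_onto h h') => [|P /andP[oP /existsP[j /andP[aj bj]]]]; last first.
  apply/ffunP=> i; rewrite !ffunE /merge_set !inE ab /=.
  case: ifP => ai; first by rewrite -(ordpart_uniq oP aj ai) setD1K.
  apply/setP=> x; rewrite !inE; case: eqP => // ->.
  by apply/esym/negP=> bi; rewrite -(ordpart_uniq oP bj bi) aj in ai.
apply: eq_big => [P|P _]; last by apply: eq_bigr => i _; rewrite ffunE.
apply/andP/idP => [[/andP[oP /existsP[j]]]|oP].
  rewrite !ffunE => /andP[aj bj] /eqP/ffunP E.
  have {}E i : P i = h P i :\ b by rewrite -{1}E ffunE.
  have [n d s c] := ordpart_onP _ _ oP.
  have nb i : b \notin P i by rewrite E !inE eqxx.
  have hPx i x : x != b -> (x \in h P i) = (x \in P i).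
    by move=> xb; rewrite [in RHS]E !inE xb.
  apply/ordpart_onP; split.
  - move=> i; have /set0Pn[x] := n i; rewrite ffunE /merge_set.
    by case: ifP => [ai _|_ xi]; apply/set0Pn; [exists a|exists x].
  - move=> i k /d; apply: disjointW; rewrite E; exact: subD1set.
  - by move=> i; apply/subsetP=> x xi; rewrite !inE (subsetP (s i)) ?andbT ?hPx //;
      apply: contraTneq xi => ->.
  by move=> x /setD1P[xb /c[i]]; rewrite hPx // => xi; exists i.
have [n d s c] := ordpart_onP _ _ oP.
have nb i : b \notin P i.
  by apply/negP=> /(subsetP (s i)); rewrite !inE eqxx.
have hPx i x : x != b -> (x \in h P i) = (x \in P i).
  by move=> xb; rewrite ffunE /merge_set; case: ifP => // _; rewrite !inE (negPf xb).
have hPb i : (b \in h P i) = (a \in P i).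
  by rewrite ffunE /merge_set; case: ifP => [_|_]; rewrite ?inE ?eqxx // (negPf (nb i)).
have aAb : a \in A :\ b by rewrite !inE ab.
split; last first.
  apply/eqP/ffunP=> i; rewrite ffunE; apply/setP=> x; rewrite in_setD1.
  by case: eqP => [->|/eqP xb] /=; rewrite ?hPx // (negPf (nb i)).
apply/andP; split; last first.
  by have [j aj] := c a aAb; apply/existsP; exists j; rewrite hPx // hPb aj.
apply/ordpart_onP; split.
- move=> i; have /set0Pn[x xi] := n i; apply/set0Pn; exists x; rewrite hPx //.
  by apply: contraTneq xi => ->.
- move=> i k ik; apply/pred0P=> x /=; apply/negP=> /andP[].
  case: (eqVneq x b) => [->|xb]; rewrite ?hPb ?hPx // => xi xk.
    by rewrite (ordpart_uniq oP xi xk) eqxx in ik.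
  by rewrite (ordpart_uniq oP xi xk) eqxx in ik.
- move=> i; apply/subsetP=> x; case: (eqVneq x b) => [->//|xb]; rewrite hPx //.
  by move/(subsetP (s i)); rewrite !inE => /andP[].
move=> x xA; case: (eqVneq x b) => [->|xb].
  by have [i ai] := c a aAb; exists i; rewrite hPb.
by have [|i xi] := c x; rewrite ?inE ?xb //; exists i; rewrite hPx.
Qed.

(** The partitions separating [a] from [b] contribute equally to both cumulants and cancel; on the
    others the skein relation acts in the common block, and [block_sum_merge] identifies [b] with
    [a]. *)
Lemma cumulant_merge (A : {set C}) a b : a \in A -> b \in A -> a != b ->
  (forall S : {set C}, S \subset A -> ~~ ((a \in S) && (b \in S)) -> S != set0 -> Y S = Y' S) ->
  (forall S : {set C}, S \subset A -> a \notin S -> b \notin S -> S != set0 ->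
    Y S = Y1 S /\ Y S = Y2 S) ->
  (forall S : {set C}, S \subset A -> a \in S -> b \in S -> Y S - Y' S = z * (Y1 S - Y2 S)) ->
  cumulant A Y - cumulant A Y' =
  z * (cumulant (A :\ b) (fun S => Y1 (merge_set a b S)) -
       cumulant (A :\ b) (fun S => Y2 (merge_set a b S))).
Proof.
move=> aA bA ab Eo En Ei; rewrite /cumulant -!sumrB mulr_sumr; apply: eq_bigr => r _.
rewrite -!mulrBr mulrCA; congr (_ * _); rewrite -!block_sum_merge // /block_sum -!sumrB mulr_sumr.
rewrite (bigID (fun P : {ffun 'I_r.+1 -> {set C}} => [exists i, (a \in P i) && (b \in P i)])) /=.
rewrite [X in _ + X]big1 ?addr0 => [|P /andP[oP /existsPn nab]].
  apply: eq_bigr => P /andP[oP /existsP[j /andP[aj bj]]].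
  have [n d s c] := ordpart_onP _ _ oP.
  apply: (prod_difference (j := j)) => [i ij|]; last exact: Ei.
  have ai : a \notin P i by apply: contra ij => ai; rewrite (ordpart_uniq oP ai aj).
  have bi : b \notin P i by apply: contra ij => bi; rewrite (ordpart_uniq oP bi bj).
  have [e1 e2] := En (P i) (s i) ai bi (n i); split=> //.
  by apply: Eo => //; rewrite (negPf ai).
have [n d s c] := ordpart_onP _ _ oP; apply/eqP; rewrite subr_eq0; apply/eqP.
by apply: eq_bigr => i _; apply: Eo.
Qed.

End Differences.

Section Vanishing.

Variables (A : {set C}) (a : C) (Y : {set C} -> F).
Hypothesis charF : forall n, n.+1%:R != 0 :> F.
Hypotheses (aA : a \in A) (Aa : A :\ a != set0).
Hypothesis mulY : forall S : {set C}, S \subset A :\ a -> S != set0 ->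
  Y (a |: S) = Y [set a] * Y S.

Let B := A :\ a.

Let mem_B x : (x \in B) = (x != a) && (x \in A).
Proof. by rewrite !inE. Qed.

Let sub_a (S : {set C}) : S \subset B -> a \notin S.
Proof. by move=> sS; apply/negP=> /(subsetP sS); rewrite mem_B eqxx. Qed.

(** When [a] is alone, its block is deleted, which leaves [r] blocks. *)
Let block_sum_single r (j : 'I_r.+1) :
  \sum_(P : {ffun 'I_r.+1 -> {set C}} | ordpart_on A P && (P j == [set a]))
     \prod_i Y (P i) = Y [set a] * block_sum B r Y.
Proof.
pose h (Q : {ffun 'I_r -> {set C}}) : {ffun 'I_r.+1 -> {set C}} :=
  [ffun i => if unlift j i is Some k then Q k else [set a]].
pose h' (P : {ffun 'I_r.+1 -> {set C}}) : {ffun 'I_r -> {set C}} := [ffun k => P (lift j k)].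
have hj Q : h Q j = [set a] by rewrite ffunE unlift_none.
have hl Q k : h Q (lift j k) = Q k by rewrite ffunE liftK.
rewrite (reindex_onto h h') => [|P /andP[_ /eqP Pj]]; last first.
  by apply/ffunP=> i; rewrite ffunE; case: unliftP => [k|] ->; rewrite ?ffunE.
rewrite /block_sum mulr_sumr; apply: eq_big => [Q|Q _]; last first.
  rewrite (bigD1_ord j) //= hj; congr (_ * _).
  by apply: eq_bigr => k _; rewrite hl.
have -> : h' (h Q) == Q by apply/eqP/ffunP=> k; rewrite ffunE hl.
rewrite andbT hj eqxx andbT; apply/idP/idP=> oQ.
  have [n d s c] := ordpart_onP _ _ oQ; apply/ordpart_onP; split.
  - by move=> k; have := n (lift j k); rewrite hl.
  - move=> i k ik; have := d (lift j i) (lift j k); rewrite !hl; apply.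
    by rewrite (inj_eq lift_inj).
  - move=> k; apply/subsetP=> x xk; rewrite mem_B; apply/andP; split.
      apply: contraTneq xk => ->; rewrite -hl; apply/negP=> ak.
      have aj : a \in h Q j by rewrite hj inE.
      by case/eqP: (neq_lift j k); apply: ordpart_uniq oQ aj ak.
    by apply: (subsetP (s (lift j k))); rewrite hl.
  move=> x; rewrite mem_B => /andP[xa /c[i]].
  case: (unliftP j i) => [k|] ->; first by rewrite hl; exists k.
  by rewrite hj inE (negPf xa).
have [n d s c] := ordpart_onP _ _ oQ; apply/ordpart_onP; split.
- move=> i; case: (unliftP j i) => [k|] ->; rewrite ?hl ?hj //.
  by apply/set0Pn; exists a; rewrite inE.
- move=> i k; case: (unliftP j i) => [i'|] ->; case: (unliftP j k) => [k'|] ->;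
    rewrite ?hl ?hj ?eqxx // => ik.
  + by apply: d; apply: contraNneq ik => ->.
  + by rewrite disjoint_sym disjoints1 sub_a.
  by rewrite disjoints1 sub_a.
- move=> i; case: (unliftP j i) => [k|] ->; rewrite ?hl ?hj.
    by apply: subset_trans (s k) (subD1set _ _).
  by rewrite sub1set.
move=> x xA; case: (eqVneq x a) => [->|xa]; first by exists j; rewrite hj inE.
by have [|i xi] := c x; rewrite ?mem_B ?xa //; exists (lift j i); rewrite hl.
Qed.

(** When [a] has company, it is removed from its block and [mulY] extracts its factor. *)
Let block_sum_larger r (j : 'I_r) :
  \sum_(P : {ffun 'I_r -> {set C}} | [&& ordpart_on A P, a \in P j & P j != [set a]])
     \prod_i Y (P i) = Y [set a] * block_sum B r Y.
Proof.
pose h (Q : {ffun 'I_r -> {set C}}) : {ffun 'I_r -> {set C}} :=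
  [ffun i => if i == j then a |: Q i else Q i].
pose h' (P : {ffun 'I_r -> {set C}}) : {ffun 'I_r -> {set C}} := [ffun k => P k :\ a].
have hj Q : h Q j = a |: Q j by rewrite ffunE eqxx.
have hn Q i : i != j -> h Q i = Q i by move=> ij; rewrite ffunE (negPf ij).
rewrite (reindex_onto h h') => [|P /and3P[oP aj _]]; last first.
  apply/ffunP=> i; rewrite !ffunE; case: eqP => [->|/eqP ij]; first by rewrite setD1K.
  apply/setP=> x; rewrite !inE; case: eqP => // ->.
  by apply/esym/negP=> ai; rewrite (ordpart_uniq oP ai aj) eqxx in ij.
have hxa Q i x : x != a -> (x \in h Q i) = (x \in Q i).
  by move=> xa; rewrite ffunE; case: ifP => // _; rewrite !inE (negPf xa).
rewrite /block_sum mulr_sumr; apply: eq_big => [Q|Q]; last first.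
  case/andP=> /and3P[oQ _ nja] /eqP/ffunP E.
  have {}E i : Q i = h Q i :\ a by rewrite -{1}E ffunE.
  have [n d s c] := ordpart_onP _ _ oQ.
  have sQ i : Q i \subset B by rewrite E; apply: setSD.
  rewrite (bigD1 j) //= [in RHS](bigD1 j) //= [RHS]mulrA hj mulY //.
    by congr (_ * _); apply: eq_bigr => i /hn->.
  by apply: contraNneq nja => Q0; rewrite hj Q0 setU0.
apply/idP/idP=> [/andP[/and3P[oQ aj nja] /eqP/ffunP E]|oQ].
  have {}E i : Q i = h Q i :\ a by rewrite -{1}E ffunE.
  have [n d s c] := ordpart_onP _ _ oQ; apply/ordpart_onP; split.
  - move=> i; case: (eqVneq i j) => [->|ij]; last by rewrite -hn.
    by apply: contraNneq nja => Q0; rewrite hj Q0 setU0.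
  - have sub i : Q i \subset h Q i by rewrite {1}E subD1set.
    by move=> i k /d; apply: disjointW.
  - by move=> i; rewrite E; apply: setSD.
  by move=> x; rewrite mem_B => /andP[xa /c[i]]; rewrite hxa //; exists i.
have [n d s c] := ordpart_onP _ _ oQ.
have na i : a \notin Q i by apply: sub_a.
have E : h' (h Q) == Q.
  apply/eqP/ffunP=> i; rewrite ffunE; apply/setP=> x; rewrite in_setD1.
  by case: eqP => [->|/eqP xa] /=; rewrite ?hxa // (negPf (na i)).
rewrite E andbT; have aj : a \in h Q j by rewrite hj !inE eqxx.
have ha i : a \in h Q i -> i = j.
  by rewrite ffunE; case: eqP => // _; rewrite (negPf (na i)).
rewrite aj /=; apply/andP; split; last first.
  apply/eqP=> /setP e; have /set0Pn[x xj] := n j.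
  have xa : x != a by apply: contraTneq xj => ->.
  by have := e x; rewrite hxa // xj inE (negPf xa).
apply/ordpart_onP; split.
- move=> i; have /set0Pn[x xi] := n i; apply/set0Pn; exists x; rewrite hxa //.
  by apply: contraTneq xi => ->.
- move=> i k ik; apply/pred0P=> x /=; apply/negP=> /andP[].
  case: (eqVneq x a) => [->|xa].
    by move=> ai ak; rewrite (ha i ai) (ha k ak) eqxx in ik.
  rewrite !hxa // => xi xk.
  by rewrite (ordpart_uniq oQ xi xk) eqxx in ik.
- move=> i; apply/subsetP=> x; case: (eqVneq x a) => [->//|xa]; rewrite hxa //.
  by move/(subsetP (s i)); rewrite mem_B => /andP[].
move=> x xA; case: (eqVneq x a) => [->|xa]; first by exists j.
by have [|i xi] := c x; rewrite ?mem_B ?xa //; exists i; rewrite hxa.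
Qed.

(** The sum is split by the position of the block containing [a]; each of the [r.+1] positions
    contributes the same two terms. *)
Let block_sum_rec r : block_sum A r.+1 Y =
  r.+1%:R * (Y [set a] * (block_sum B r.+1 Y + block_sum B r Y)).
Proof.
transitivity (\sum_(j < r.+1) \sum_(P : {ffun 'I_r.+1 -> {set C}} | ordpart_on A P && (a \in P j))
  \prod_i Y (P i)).
  rewrite (exchange_big_dep (fun P : {ffun 'I_r.+1 -> {set C}} => ordpart_on A P)) /=; last first.
    by move=> j P _ /andP[].
  apply: eq_bigr => P oP; have [n d s c] := ordpart_onP _ _ oP; have [j aj] := c a aA.
  rewrite [RHS](big_pred1 j) // => i /=; rewrite oP /=.
  by apply/idP/eqP => [ai|->//]; apply: ordpart_uniq oP ai aj.
rewrite (eq_bigr (fun=> Y [set a] * (block_sum B r.+1 Y + block_sum B r Y))).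
  by rewrite sumr_const card_ord mulr_natl.
move=> j _; rewrite (bigID (fun P : {ffun 'I_r.+1 -> {set C}} => P j == [set a])) /=.
rewrite addrC mulrDr; congr (_ + _).
  by rewrite -(block_sum_larger j); apply: eq_bigl => P; rewrite andbA.
rewrite -(block_sum_single j); apply: eq_bigl => P.
by case: eqP => [->|]; rewrite ?inE ?eqxx ?andbT ?andbF.
Qed.

(** The factor [r.+1] of the recursion cancels the denominator and the cumulant telescopes. At the
    lower end there are no blocks to cover the nonempty [B]; at the upper end there are more blocks
    than elements of [B]. *)
Lemma cumulant_split : cumulant A Y = 0.
Proof.
pose f r := (-1) ^+ r * (Y [set a] * block_sum B r Y).
rewrite /cumulant (eq_bigr (fun r : 'I_#|C| => f r - f r.+1)) => [|r _]; last first.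
  by rewrite block_sum_rec [LHS]mulrA divfK ?charF // /f exprS; ring.
rewrite -(big_mkord xpredT (fun r => f r - f r.+1)).
have -> : \sum_(0 <= i < #|C|) (f i - f i.+1) = f 0%N - f #|C|.
  rewrite -[LHS]opprK -sumrN (eq_bigr (fun i => f i.+1 - f i)) => [|i _]; last by rewrite opprB.
  by rewrite telescope_sumr // opprB.
rewrite /f block_sum0 // block_sum_gt ?mulr0 ?subr0 //.
have := max_card A; rewrite (cardsD1 a A) aA; exact.
Qed.

End Vanishing.

End Cumulants.

(** * The valuation and the induction *)

Section Valuation.

Variable K : fieldType.
Local Notation frac := (@FracField.tofrac {poly K}).
Local Notation RF := {fraction {poly K}}.
Local Notation z := (frac 'X).

(** The form of [zval_ge] over any coefficient field. For [m] equal to 0 it defines the local ring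
    of K[z] at z = 0, whose closure properties give all the rules below. *)
Definition frac_val_ge (f : RF) (m : int) : Prop :=
  exists p q : {poly K}, q.[0] != 0 /\ f * z ^ (- m) = frac p / frac q.

Lemma frac_char0 : (forall n, n.+1%:R != 0 :> K) -> forall n, n.+1%:R != 0 :> RF.
Proof.
move=> K0 n; have -> : n.+1%:R = frac (n.+1%:R%:P) :> RF by rewrite polyCMn !rmorphMn /= !rmorph1.
by rewrite tofrac_eq0 polyC_eq0.
Qed.

Lemma frac_X_neq0 : z != 0.
Proof. by rewrite tofrac_eq0 polyX_eq0. Qed.

Let zint (f : RF) : Prop := exists p q : {poly K}, q.[0] != 0 /\ f = frac p / frac q.

Let frac_neq0 (q : {poly K}) : q.[0] != 0 -> frac q != 0.
Proof. by rewrite tofrac_eq0; apply: contraNneq => ->; rewrite horner0. Qed.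

Let zintD f g : zint f -> zint g -> zint (f + g).
Proof.
move=> [p [q [q0 ->]]] [p' [q' [q0' ->]]]; exists (p * q' + p' * q), (q * q').
split; first by rewrite hornerM mulf_neq0.
by rewrite addf_div ?frac_neq0 // rmorphD !rmorphM.
Qed.

Let zintM f g : zint f -> zint g -> zint (f * g).
Proof.
move=> [p [q [q0 ->]]] [p' [q' [q0' ->]]]; exists (p * p'), (q * q').
split; first by rewrite hornerM mulf_neq0.
by rewrite mulf_div !rmorphM.
Qed.

Let zint_frac p : zint (frac p).
Proof. by exists p, 1; rewrite hornerC oner_neq0 rmorph1 divr1. Qed.

Let val0P f : frac_val_ge f 0 <-> zint f.
Proof. by rewrite /frac_val_ge oppr0 expr0z mulr1. Qed.

Lemma frac_val_geD f g m : frac_val_ge f m -> frac_val_ge g m -> frac_val_ge (f + g) m.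
Proof. by move=> hf hg; have := zintD hf hg; rewrite -mulrDl. Qed.

Lemma frac_val_geM f g m n : frac_val_ge f m -> frac_val_ge g n -> frac_val_ge (f * g) (m + n).
Proof.
move=> hf hg; have := zintM hf hg.
by rewrite mulrACA -expfzDr ?frac_X_neq0 // -opprD.
Qed.

Lemma frac_val_ge_frac p : frac_val_ge (frac p) 0.
Proof. by apply/val0P/zint_frac. Qed.

Lemma frac_val_ge0 m : frac_val_ge 0 m.
Proof. by exists 0, 1; rewrite hornerC oner_neq0 mul0r rmorph0 mul0r. Qed.

Lemma frac_val_geB f g m : frac_val_ge f m -> frac_val_ge g m -> frac_val_ge (f - g) m.
Proof.
move=> hf hg; rewrite -[g]mul1r -mulNr; apply: frac_val_geD => //.
rewrite -[m]add0r; apply: frac_val_geM => //.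
by have := frac_val_ge_frac (-1); rewrite rmorphN rmorph1.
Qed.

Lemma frac_val_geX : frac_val_ge z 1.
Proof.
exists 1, 1; rewrite hornerC oner_neq0 rmorph1 divr1; split=> //.
by rewrite -{1}(expr1z z) -expfzDr ?frac_X_neq0.
Qed.

Lemma frac_val_ge_le f m n : m <= n -> frac_val_ge f n -> frac_val_ge f m.
Proof.
move=> le [p [q [q0 e]]]; have [k ek] : exists k : nat, n - m = k%:Z.
  by exists `|n - m|%N; rewrite gez0_abs // subr_ge0.
have -> : f = f * z ^ (- n) * z ^ n.
  by rewrite -mulrA -expfzDr ?frac_X_neq0 // addNr mulr1.
rewrite e /frac_val_ge -mulrA -expfzDr ?frac_X_neq0 // ek.
by apply: zintM; [exists p, q | rewrite -exprnP -rmorphXn; apply: zint_frac].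
Qed.

Lemma frac_val_ge_const (c : K) k : c != 0 -> frac_val_ge (frac c%:P ^ k) 0.
Proof.
move=> c0; apply/val0P; case: k => n; first by rewrite -exprnP -rmorphXn; apply: zint_frac.
rewrite NegzE -exprnN; exists 1, (c ^+ n.+1)%:P; split.
  by rewrite hornerC expf_neq0.
by rewrite rmorph1 mul1r polyC_exp rmorphXn.
Qed.

Lemma frac_val_ge_delta (c : K) : c != 0 ->
  frac_val_ge (1 + (frac c%:P - (frac c%:P)^-1) / z) (-1).
Proof.
move=> c0; have cV : (frac c%:P)^-1 = frac (c^-1)%:P.
  by apply: (mulIf (frac_neq0 (q := c%:P) _)); rewrite ?hornerC // mulVf ?tofrac_eq0 ?polyC_eq0 // -rmorphM -polyCM mulVf.
exists ('X + (c - c^-1)%:P), 1; split; first by rewrite hornerC oner_neq0.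
rewrite rmorph1 divr1 opprK expr1z mulrDl mul1r divfK ?frac_X_neq0 //.
by rewrite cV rmorphD polyCB rmorphB.
Qed.

End Valuation.

Lemma cumulant_set1 (F : fieldType) (C : finType) (a : C) (Y : {set C} -> F) :
  cumulant [set a] Y = Y [set a].
Proof.
have C0 : (0 < #|C|)%N by apply/card_gt0P; exists a.
rewrite /cumulant (bigD1 (Ordinal C0)) //= big1 => [|r r0]; last first.
  rewrite block_sum_gt ?mulr0 // cards1 ltnS lt0n; apply: contra r0 => /eqP e.
  by apply/eqP/val_inj.
rewrite expr0 divr1 mul1r addr0 /block_sum (big_pred1 [ffun=> [set a]]) => [|P].
  by rewrite big_ord1 ffunE.
apply/idP/eqP => [/ordpart_onP[n _ s _]|->].
  apply/ffunP=> i; rewrite ffunE; apply/eqP.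
  by have := s i; rewrite subset1 (negPf (n i)) orbF.
apply/ordpart_onP; split=> [i|i j|i|x].
- by rewrite ffunE; apply/set0Pn; exists a; rewrite inE.
- by rewrite !ord1.
- by rewrite ffunE.
by move=> xa; exists ord0; rewrite ffunE.
Qed.

(** * The induction on crossings for coloured links *)

Section KauffmanCumulants.

Variables (F : fieldType) (t z : F) (val : F -> int -> Prop).
Definition circle_val : F := 1 + (t - t^-1) / z.
Local Notation dl := circle_val.
Hypothesis t_neq0 : t != 0.
Hypothesis charF : forall n, n.+1%:R != 0 :> F.
Hypothesis val0 : forall m, val 0 m.
Hypothesis valD : forall f h m, val f m -> val h m -> val (f + h) m.
Hypothesis valB : forall f h m, val f m -> val h m -> val (f - h) m.
Hypothesis valM : forall f h m n, val f m -> val h n -> val (f * h) (m + n).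
Hypothesis val_le : forall f m n, m <= n -> val f n -> val f m.
Hypothesis val_z : val z 1.
Hypothesis val_t : forall k, val (t ^ k) 0.
Hypothesis val_dl : val dl (-1).

Variable Lam : diagram -> F.
Hypothesis skein : forall D, wf_diagram D -> planar D -> forall i, (i < ncr D)%N ->
  Lam D - Lam (switch D i) = z * (Lam (smooth D i pair01) - Lam (smooth D i pair03)).
Hypothesis unlink : forall D o, wf_diagram D -> planar D -> valid_or D o ->
  (0 < ncomp D)%N -> descending D o -> Lam D = t ^ writhe D o * dl ^+ (ncomp D).-1.

Lemma val_mulz f m : val f (m - 1) -> val (z * f) m.
Proof. by move=> h; rewrite -(subrK 1 m) addrC; apply: valM. Qed.

Lemma val_dl_exp k : val (dl ^+ k) (- k%:Z).
Proof.
elim: k => [|k IH]; first by rewrite expr0 oppr0; apply: (val_t 0).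
rewrite exprS; have -> : - k.+1%:Z = -1 + - k%:Z by lia.
exact: valM.
Qed.

Variables (T : finType) (g rot : T -> T) (C : finType).
Hypothesis gK : involutive g.
Hypothesis gN : forall x, g x != x.
Hypothesis rot4 : forall x, rot (rot (rot (rot x))) = x.
Hypothesis rot2 : forall x, rot (rot x) != x.

Local Notation comps q := (strand_rel g q pred0 predT).

Definition colored (kap : T -> C) (S : {set C}) : pred T := fun x => kap x \in S.

Definition free_in (f : C -> nat) (S : {set C}) : nat := (\sum_(c in S) f c)%N.

(** Here [f] counts the initial crossingless circles of each colour. By [cl_ne] every colour occurs,
    so the sublink of a nonempty set of colours is nonempty, as the value of Lambda on unlinks
    requires. *)
Record coloring (q : T -> T) (Sv ov : pred T) (kap : T -> C) (A : {set C})
    (f : C -> nat) : Prop := Coloring {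
  cl_tg : tangle rot q Sv;
  cl_ov : forall x, ov (rot x) = ~~ ov x;
  cl_g : forall x, kap (g x) = kap x;
  cl_q : forall x, kap (q x) = kap x;
  cl_A : forall x, kap x \in A;
  cl_ne : forall a, a \in A -> (0 < f a)%N \/ exists x, kap x = a;
  cl_bd : strand_cycles_bound g rot q Sv predT }.

(** A relation and not a function of the strands: different numberings of the same sublink are not
    known to have the same Lambda. *)
Definition realized (q : T -> T) (Sv ov : pred T) (kap : T -> C) (f : C -> nat)
    (S : {set C}) (y : F) : Prop :=
  exists (D : diagram) (io : dart D -> T), realizes g rot q
    (restrict rot Sv (colored kap S)) (colored kap S) ov (free_in f S) io /\ y = dl * Lam D.

Section OneColoring.

Variables (q : T -> T) (Sv ov : pred T) (kap : T -> C) (A : {set C}) (f : C -> nat).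
Hypothesis cl : coloring q Sv ov kap A f.

Let tg := cl_tg cl.
Let ov_rot := cl_ov cl.

Let colg S x : colored kap S (g x) = colored kap S x. Proof. by rewrite /colored (cl_g cl). Qed.
Let colq S x : colored kap S (q x) = colored kap S x. Proof. by rewrite /colored (cl_q cl). Qed.
Let tgS S : tangle rot q (restrict rot Sv (colored kap S)) := restrict_tangle tg (colq S).
Let scS S : strand_closed g q (restrict rot Sv (colored kap S)) (colored kap S) :=
  restrict_closed rot Sv (colg S) (colq S).

Lemma realized_planar S D (io : dart D -> T) :
  realizes g rot q (restrict rot Sv (colored kap S)) (colored kap S) ov (free_in f S) io ->
  wf_diagram D /\ planar D.
Proof.
move=> rz; split; first exact: (rz_wf gK (tgS S) (scS S) rz).
apply: (rz_planar gK gN (tgS S) (scS S) rz).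
exact: (restrict_cycles_bound tg (colq S) (cl_bd cl)).
Qed.

Lemma connect_kap x y : connect (comps q) x y -> kap x = kap y.
Proof.
case/connectP=> p; elim: p x => [|w p IH] x /=; first by move=> _ ->.
by case/andP=> /orP[]/eqP-> pw /(IH _ pw) <-; rewrite ?(cl_g cl) ?(cl_q cl).
Qed.

Section Crossing.

Variable c : T.
Hypothesis Sc : Sv c.

Lemma crossing_col (S : {set C}) x : (kap c \in S) = (kap (rot c) \in S) -> crossing rot c x ->
  colored kap S x = (kap c \in S).
Proof.
move=> E; have Sr : Sv (rot c) by rewrite (tg_rot tg).
by case/crossingP=> ->; rewrite /colored -?(tg_q tg) ?(cl_q cl).
Qed.

(** If the crossing is absent from the sublink, the same diagram serves after the switch, and after
    the smoothings when neither strand belongs to it. When exactly one does, the smoothings do not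
    respect the colours and nothing is claimed of their realization. *)
Lemma realized_skein (S : {set C}) y : S != set0 -> realized q Sv ov kap f S y ->
  exists y2 y3 y4, [/\ realized q Sv (switch_ov rot c ov) kap f S y2,
    (kap c \in S) = (kap (rot c) \in S) ->
      realized (smooth_map rot ov true c q) (smooth_Sv rot c Sv) ov kap f S y3 /\
      realized (smooth_map rot ov false c q) (smooth_Sv rot c Sv) ov kap f S y4,
    (kap c \in S) && (kap (rot c) \in S) -> y - y2 = z * (y3 - y4) &
    ~~ ((kap c \in S) && (kap (rot c) \in S)) -> [/\ y = y2, y = y3 & y = y4]].
Proof.
move=> S0 [D [io [rz yE]]]; have [wfD plD] := realized_planar rz.
case: (boolP ((kap c \in S) && (kap (rot c) \in S))) => cS.
  have Rc : restrict rot Sv (colored kap S) c by rewrite /restrict Sc.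
  have [d0 dc] := rz_surj rz Rc.
  have [io1 r1] := realizes_smooth gK rot4 rot2 (tgS S) (scS S) ov_rot rz d0 true.
  have [io2 r2] := realizes_smooth gK rot4 rot2 (tgS S) (scS S) ov_rot rz d0 false.
  have r3 := realizes_switch gK (tgS S) (scS S) rz d0.
  rewrite dc in r1 r2 r3.
  have resE : smooth_Sv rot c (restrict rot Sv (colored kap S)) =1
      restrict rot (smooth_Sv rot c Sv) (colored kap S).
    move=> x; rewrite /smooth_Sv /restrict -!andbA; congr (_ && _).
    by rewrite [RHS]andbC -!andbA.
  exists (dl * Lam (switch D (d0 %/ 4)%N)), (dl * Lam (smooth D (d0 %/ 4)%N pair01)),
    (dl * Lam (smooth D (d0 %/ 4)%N pair03)); split.
  - by eexists _, _; split; first exact: r3.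
  - move=> _; split; eexists _, _; split; try reflexivity.
      by apply: realizes_ext r1.
    by apply: realizes_ext r2.
  - move=> _; rewrite yE -mulrBr skein //; last by have := ltn_ord d0; lia.
    by rewrite -mulrBr mulrCA.
  by [].
have nR x : crossing rot c x -> restrict rot Sv (colored kap S) x = false.
  move=> cx; have Rc : restrict rot Sv (colored kap S) c = false.
    by rewrite /restrict Sc /colored /= (negPf cS).
  have RR y' : restrict rot Sv (colored kap S) (rot y') = restrict rot Sv (colored kap S) y'.
    by rewrite (tg_rot (tgS S)).
  by case/crossingP: cx => ->; rewrite ?RR Rc.
exists y, y, y; split=> //.
  exists D, io; split=> //; apply: realizes_ext rz => // x Rx.
  by rewrite /switch_ov; case: ifP => // /nR; rewrite Rx.
move=> E; have cK x : colored kap S x -> crossing rot c x = false.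
  move=> Kx; apply/negP=> cx; move: cS; rewrite -E andbb.
  by rewrite -(crossing_col E cx) Kx.
have resE : restrict rot Sv (colored kap S) =1 restrict rot (smooth_Sv rot c Sv) (colored kap S).
  move=> x; rewrite /smooth_Sv /restrict; case: (boolP (colored kap S x)) => Kx; last by rewrite !andbF.
  by rewrite cK // andbT.
split; exists D, io; split=> //; apply: realizes_ext rz => // x Kx _;
  by rewrite /smooth_map cK.
Qed.

End Crossing.

Section Descending.

Variables (o : T -> bool) (tm : T -> nat).
Hypotheses (og : forall x, o (g x) = ~~ o x) (oq : forall x, o (q x) = ~~ o x).
Hypothesis tmP : timing g q o tm.
Hypothesis good : forall x, Sv x -> ov x -> (tm x < tm (rot x))%N.

(** The factor [dl] in [realized] completes the exponent c - 1 of the unlink to c, which is additive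
    over disjoint sets of colours. *)
Lemma realized_descending (S : {set C}) y : S != set0 -> S \subset A -> realized q Sv ov kap f S y ->
  y = t ^ strand_writhe rot ov o (restrict rot Sv (colored kap S)) *
      dl ^+ (free_in f S + n_comp (comps q) (colored kap S)).
Proof.
move=> S0 SA [D [io [rz ->]]]; have [wfD plD] := realized_planar rz.
have nc : ncomp D = (free_in f S + n_comp (comps q) (colored kap S))%N.
  rewrite (rz_ncomp gK (tgS S) (scS S) rz); congr addn.
  by apply: n_comp_local => x Kx; exact: (connect_full gK (tgS S) (scS S) Kx).
have n0 : (0 < ncomp D)%N.
  have /set0Pn[a aS] := S0; rewrite nc addn_gt0.
  have [fa|[x xa]] := cl_ne cl (subsetP SA a aS); apply/orP; [left|right].
    by rewrite /free_in (bigD1 a) //= addn_gt0 fa.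
  have Esym := full_strand_sym gK (tg_qK tg).
  apply/card_gt0P; exists (fingraph.root (comps q) x).
  rewrite inE (roots_root Esym) /=.
  have cK : closed (comps q) (colored kap S).
    apply: (intro_closed Esym) => u v /orP[]/eqP->.
      by change (colored kap S u -> colored kap S (g u)); rewrite colg.
    by change (colored kap S u -> colored kap S (q u)); rewrite colq.
  rewrite -(closed_connect cK (connect_root _ x)) unfold_in /colored xa //.
rewrite (unlink wfD plD _ n0 _ (o := extend_or o io)).
- rewrite mulrCA -exprS prednK // nc; congr (t ^ _ * _).
  rewrite /writhe (eq_bigl (fun i : 'I_(ncr D) => predT (io (base_dart i)))) //.
  rewrite (sum_csign rot4 (tgS S) rz oq) //.
  by apply: eq_bigl => x; rewrite andbT.
- exact: (rz_valid_or gK gN (tgS S) (scS S) rz og oq).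
apply: (rz_descending gK gN (tgS S) (scS S) rz og oq tmP) => x /and3P[Sx _ _].
exact: good.
Qed.

Lemma n_comp_colU a (S : {set C}) : a \notin S ->
  n_comp (comps q) (colored kap (a |: S)) =
  (n_comp (comps q) (colored kap [set a]) + n_comp (comps q) (colored kap S))%N.
Proof.
move=> aS; rewrite (n_compID _ _ (colored kap [set a])); congr (_ + _)%N;
  apply: eq_n_comp_r => x.
  change ((kap x \in a |: S) && (kap x \in [set a]) = (kap x \in [set a])).
  by rewrite !inE; case: eqP; rewrite ?andbF.
change ((kap x \in a |: S) && ~~ (kap x \in [set a]) = (kap x \in S)).
by rewrite !inE; case: eqP => [->|_]; rewrite /= ?andbT // (negPf aS).
Qed.

Hypothesis kap_tm : forall x y, (enum_rank (kap x) < enum_rank (kap y))%N -> (tm x < tm y)%N.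

Lemma descending_cumulant Y : A != set0 ->
  (forall S : {set C}, S != set0 -> S \subset A -> realized q Sv ov kap f S (Y S)) ->
  val (cumulant A Y) (2 * #|A|%:Z - 2 - (free_in f A + n_comp (comps q) T)%:Z).
Proof.
move=> A0 rY; have YE S (S0 : S != set0) (SA : S \subset A) := realized_descending S0 SA (rY S S0 SA).
have [a0 a0A] := set0Pn _ A0.
(* The colour of least rank is traversed before all the others, hence lies above them: it is the one
   that splits off. *)
case: (arg_minnP (P := mem A) (fun a : C => enum_rank a : nat) a0A) => a aA amin.
have {}aA : a \in A by [].
have {}amin b : b \in A -> (enum_rank a <= enum_rank b)%N by apply: amin.
case: (eqVneq (A :\ a) set0) => [Aa|Aa].
  have -> : A = [set a] by rewrite -(setD1K aA) Aa setU0.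
  have a1 : [set a] != set0 :> {set C} by apply/set0Pn; exists a; rewrite inE.
  rewrite cumulant_set1 YE ?sub1set // cards1.
  have -> : n_comp (comps q) (colored kap [set a]) = n_comp (comps q) T.
    apply: eq_n_comp_r => x; change ((kap x \in [set a]) = true).
    by have := cl_A cl x; rewrite -(setD1K aA) Aa setU0.
  (* With a single colour, the constant -2 makes the bound equal to minus the number of
     components. *)
  set k := (_ + _)%N; have -> : 2 * 1%:Z - 2 - k%:Z = 0 + - k%:Z by lia.
  by apply: valM => //; apply: val_dl_exp.
rewrite (cumulant_split charF aA Aa) // => S SAa S0.
have aS : a \notin S by apply/negP=> /(subsetP SAa); rewrite !inE eqxx.
have SA : S \subset A := subset_trans SAa (subD1set _ _).
have aSA : a |: S \subset A by rewrite subUset sub1set aA.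
have a1 : [set a] != set0 :> {set C} by apply/set0Pn; exists a; rewrite inE.
have aS0 : a |: S != set0 by apply/set0Pn; exists a; rewrite !inE eqxx.
rewrite !YE ?sub1set // mulrACA -exprD -expfzDr //; congr (t ^ _ * dl ^+ _).
  rewrite -(strand_writheU gK tg ov_rot og oq (cl_bd cl) (colg [set a]) (colq [set a])
    (colg S) (colq S)).
  - apply: eq_bigl => x; congr (_ && _); rewrite /restrict /colored /=.
    by rewrite !inE.
  - by move=> x; rewrite /colored !inE => /eqP->.
  move=> x Sx xS; rewrite /colored inE => /eqP rx; apply/negP=> ox.
  have := good Sx ox; rewrite ltnNge ltnW // kap_tm // rx ltn_neqAle amin ?(subsetP SA) // andbT.
  by apply: contraNneq aS => /val_inj/enum_rank_inj->.
rewrite n_comp_colU // /free_in big_setU1 // big_set1; exact: addnACA.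
Qed.

End Descending.

End OneColoring.
Lemma coloring_switch q Sv ov kap A f c : coloring q Sv ov kap A f ->
  coloring q Sv (switch_ov rot c ov) kap A f.
Proof.
case=> tg ov_rot kg kq kA ne bd; split=> // x.
by rewrite /switch_ov (crossing_rot rot4) ov_rot; case: ifP.
Qed.

Lemma coloring_smooth q Sv ov kap A f c b : coloring q Sv ov kap A f -> Sv c ->
  kap c = kap (rot c) ->
  coloring (smooth_map rot ov b c q) (smooth_Sv rot c Sv) ov kap A f.
Proof.
case=> tg ov_rot kg kq kA ne bd Sc kc.
have kcr x : crossing rot c x -> kap x = kap c.
  by case/crossingP=> ->; rewrite -?(tg_q tg) ?(tg_rot tg) ?kq.
split=> // [|x|].
- exact: (smooth_tangle rot4 rot2 tg ov_rot Sc b).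
- rewrite /smooth_map; case: ifP => [cx|_]; last exact: kq.
  by rewrite [RHS]kcr // [LHS]kcr //; case: ifP => _; rewrite !(crossing_rot rot4).
exact: (smooth_cycles_bound rot4 tg ov_rot Sc bd).
Qed.

Section Merging.

Variables (a b : C) (kap : T -> C) (f : C -> nat) (A : {set C}).
Hypotheses (ab : a != b) (aA : a \in A) (bA : b \in A).

Definition merge_kap (x : T) : C := if kap x == b then a else kap x.

Definition merge_free (k : C) : nat := if k == a then (f a + f b)%N else f k.

Lemma col_merge (S : {set C}) x : b \notin S -> colored kap (merge_set a b S) x = colored merge_kap S x.
Proof.
move=> bS; rewrite /colored /merge_set /merge_kap.
case: eqP => [->|/eqP kb]; first by case: ifP => aS; rewrite ?aS ?inE ?eqxx // (negPf bS).
by case: ifP => // _; rewrite !inE (negPf kb).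
Qed.

Lemma free_in_merge (S : {set C}) : b \notin S -> free_in f (merge_set a b S) = free_in merge_free S.
Proof.
move=> bS; rewrite /free_in /merge_set /merge_free.
case: (boolP (a \in S)) => aS.
  rewrite big_setU1 //= (big_setD1 a) //= [RHS](big_setD1 a) //= eqxx addnA [(f b + _)%N]addnC.
  by congr addn; apply: eq_bigr => k; rewrite !inE => /andP[/negPf->].
by apply: eq_bigr => k kS; case: eqP => // ka; rewrite -ka kS in aS.
Qed.

Lemma coloring_merge q Sv ov : coloring q Sv ov kap A f ->
  coloring q Sv ov merge_kap (A :\ b) merge_free.
Proof.
case=> tg ov_rot kg kq kA ne bd; split=> // [x|x|x|k].
- by rewrite /merge_kap kg.
- by rewrite /merge_kap kq.
- by rewrite /merge_kap !inE; case E: (kap x == b); rewrite ?ab ?aA // E kA.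
rewrite !inE /merge_free => /andP[kb kA']; have [fk|[x xk]] := ne k kA'.
  by left; case: eqP => // e; rewrite -e addn_gt0 fk.
by right; exists x; rewrite /merge_kap xk (negPf kb).
Qed.

Lemma realized_merge q Sv ov (S : {set C}) y : b \notin S ->
  realized q Sv ov kap f (merge_set a b S) y -> realized q Sv ov merge_kap merge_free S y.
Proof.
move=> bS [D [io [rz e]]]; exists D, io; split=> //; rewrite -free_in_merge //.
by apply: realizes_ext rz => // x; rewrite ?/restrict !col_merge.
Qed.

End Merging.

(* The outer induction is on the surviving crossings, the inner one on the crossings met
   first from below. *)
Lemma cumulant_bound n : forall q Sv ov kap A f Y, (#|[pred x | Sv x]| <= n)%N ->
  coloring q Sv ov kap A f -> A != set0 ->
  (forall S : {set C}, S != set0 -> S \subset A -> realized q Sv ov kap f S (Y S)) ->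
  val (cumulant A Y) (2 * #|A|%:Z - 2 - (free_in f A + n_comp (comps q) T)%:Z).
Proof.
elim/ltn_ind: n => n IHn q Sv ov kap A f Y Svn cl A0 rY.
have tg := cl_tg cl.
pose rk x : nat := enum_rank (kap x).
(* The colours are traversed by increasing rank. These times do not depend on [ov], so they stay
   fixed throughout the crossing changes of the inner induction. *)
have [x|x|o [tm [og oq tmP rk_tm]]] := timing_exists gK gN (tg_qK tg) (tg_qN tg) (kap := rk).
- by rewrite /rk (cl_g cl).
- by rewrite /rk (cl_q cl).
have tm_neq x : Sv x -> tm x != tm (rot x).
  move=> Sx; apply/eqP=> /(tm_inj tmP)[] /eqP.
    by rewrite (negPf (rot_neq rot2 x)).
  by rewrite (tg_q tg) // eq_sym (negPf (rot_neq rot2 (rot x))).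
pose bad (ov : pred T) := [pred x | [&& Sv x, ov x & (tm (rot x) < tm x)%N]].
move: {2}(#|bad ov|) (leqnn #|bad ov|) => m.
elim: m ov Y cl rY => [|m IHm] ov Y cl rY.
  rewrite leqn0 => /eqP/card0_eq bad0.
  apply: (descending_cumulant cl og oq tmP _ _ A0 rY) => [x Sx ox|x y /rk_tm//].
  have := bad0 x; rewrite inE Sx ox /= => /negbT; rewrite -leqNgt leq_eqVlt.
  by rewrite (negPf (tm_neq x Sx)).
move=> badm; case: (pickP (bad ov)) => [c /and3P[Sc oc ltc]|bad0]; last first.
  by apply: (IHm ov) => //; have -> : #|bad ov| = 0%N by apply: eq_card0.
pose ov2 := switch_ov rot c ov.
have cl2 : coloring q Sv ov2 kap A f := coloring_switch c cl.
have ov_rot := cl_ov cl.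
(* The values for the three other diagrams are chosen for all [S] at once; (0, 0, 0) is a filler for
   sets that are empty or not inside [A]. *)
have /fin_all_exists[Ys HY] (S : {set C}) : exists y3 : F * F * F,
    S != set0 -> S \subset A -> [/\ realized q Sv ov2 kap f S y3.1.1,
    (kap c \in S) = (kap (rot c) \in S) ->
      realized (smooth_map rot ov true c q) (smooth_Sv rot c Sv) ov kap f S y3.1.2 /\
      realized (smooth_map rot ov false c q) (smooth_Sv rot c Sv) ov kap f S y3.2,
    (kap c \in S) && (kap (rot c) \in S) -> Y S - y3.1.1 = z * (y3.1.2 - y3.2) &
    ~~ ((kap c \in S) && (kap (rot c) \in S)) ->
      [/\ Y S = y3.1.1, Y S = y3.1.2 & Y S = y3.2]].
  case: (boolP ((S != set0) && (S \subset A))) => [/andP[S0 SA]|nS]; last first.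
    by exists (0, 0, 0) => S0 SA; rewrite S0 SA in nS.
  have [y2 [y3 [y4 H]]] := realized_skein cl Sc S0 (rY S S0 SA).
  by exists (y2, y3, y4).
pose Y2 S := (Ys S).1.1; pose Z1 S := (Ys S).1.2; pose Z2 S := (Ys S).2.
have val2 : val (cumulant A Y2) (2 * #|A|%:Z - 2 - (free_in f A + n_comp (comps q) T)%:Z).
  apply: (IHm ov2 Y2 cl2) => [S S0 SA|]; first by have [] := HY S S0 SA.
  (* After the switch the over-darts at this crossing are on the passage met earlier, so none of its
     darts is bad any more; the other crossings are unaffected. *)
  rewrite -ltnS; apply: leq_trans badm;
  apply: proper_card; apply/properP; split.
    apply/subsetP=> x; rewrite !inE /ov2 /switch_ov => /and3P[-> ox lt]; rewrite lt andbT /=.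
    move: ox; case: ifP => // cx.
    have t2 y : Sv y -> tm (rot (rot y)) = tm y by move=> Sy; rewrite -(tg_q tg) // (tm_q tmP).
    have Sr : Sv (rot c) by rewrite (tg_rot tg).
    move: lt; case/crossingP: cx => ->; rewrite ?ov_rot ?negbK ?oc // ?t2 ?rot4 ?(tg_rot tg) // => lt;
      by have := ltn_trans lt ltc; rewrite ltnn.
  exists c; rewrite !inE ?Sc ?oc ?ltc // /ov2 /switch_ov crossing_refl oc.
  by rewrite andbF.
have Sv2n : (#|[pred x | smooth_Sv rot c Sv x]| < n)%N.
  apply: leq_trans Svn; apply: proper_card; apply/properP; split.
    by apply/subsetP=> x; rewrite !inE => /andP[].
  by exists c; rewrite !inE // /smooth_Sv crossing_refl andbF.
have A1 := cl_A cl c; have A2 := cl_A cl (rot c).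
suff vd : val (cumulant A Y - cumulant A Y2)
    (2 * #|A|%:Z - 2 - (free_in f A + n_comp (comps q) T)%:Z).
  by rewrite -(subrK (cumulant A Y2) (cumulant A Y)); apply: valD.
case: (eqVneq (kap c) (kap (rot c))) => [kc|kc].
  have -> := cumulant_self (z := z) (Y1 := Z1) (Y2 := Z2) A1 _ _.
  - have vZ (b : bool) Z : (forall S, S != set0 -> S \subset A ->
        realized (smooth_map rot ov b c q) (smooth_Sv rot c Sv) ov kap f S (Z S)) ->
        val (cumulant A Z) (2 * #|A|%:Z - 2 - (free_in f A + n_comp (comps q) T)%:Z - 1).
      move=> rZ; have := IHn _ Sv2n _ _ _ _ _ _ _ (leqnn _) (coloring_smooth b cl Sc kc) A0 rZ.
      (* The component that may be gained costs one unit, which the factor z restores. *)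
      apply: val_le; have := smooth_n_comp gK rot4 rot2 b tg ov_rot Sc; lia.
    apply/val_mulz/valB.
      by apply: (vZ true) => S S0 SA; have [_ /(_ _)[]] := HY S S0 SA; rewrite ?kc.
    by apply: (vZ false) => S S0 SA; have [_ /(_ _)[]] := HY S S0 SA; rewrite ?kc.
  - move=> S SA cS S0; have [_ _ _ H] := HY S S0 SA.
    by apply: H; rewrite (negPf cS).
  move=> S SA cS; have S0 : S != set0 by apply/set0Pn; exists (kap c).
  by have [_ _ H _] := HY S S0 SA; apply: H; rewrite -kc cS.
have -> := cumulant_merge (z := z) (Y1 := Z1) (Y2 := Z2) A1 A2 kc _ _ _.
- have Mb : kap (rot c) \notin A :\ kap (rot c) by rewrite !inE eqxx.
  have MA : merge_set (kap c) (kap (rot c)) (A :\ kap (rot c)) = A.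
    by rewrite /merge_set !inE kc A1 setD1K.
  have kc' : merge_kap (kap c) (kap (rot c)) kap c = merge_kap (kap c) (kap (rot c)) kap (rot c).
    by rewrite /merge_kap (negPf kc) eqxx.
  have clm := coloring_smooth _ (coloring_merge kc A1 cl) Sc kc'.
  have Ab0 : A :\ kap (rot c) != set0 by apply/set0Pn; exists (kap c); rewrite !inE kc.
  (* Different colours lie on different components, so either smoothing unites two components into
     one. *)
  have nconn : ~~ connect (comps q) c (rot c).
    by apply: contraNN kc => /(connect_kap cl)->.
  have vZ (b : bool) Z : (forall S : {set C}, S != set0 -> S \subset A ->
      (kap c \in S) = (kap (rot c) \in S) ->
      realized (smooth_map rot ov b c q) (smooth_Sv rot c Sv) ov kap f S (Z S)) ->
      val (cumulant (A :\ kap (rot c)) (fun S => Z (merge_set (kap c) (kap (rot c)) S)))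
        (2 * #|A|%:Z - 2 - (free_in f A + n_comp (comps q) T)%:Z - 1).
    move=> rZ; have := IHn _ Sv2n _ _ _ _ _ _ _ (leqnn _) (clm b) Ab0.
    move/(_ (fun S => Z (merge_set (kap c) (kap (rot c)) S))) => H.
    apply: val_le (H _) => [|S S0 SA].
      rewrite -free_in_merge // MA.
      (* One colour and one component are lost: 2(L - 1) - 2 - (c - 1) is one less than the bound,
         and z restores it. *)
      have := smooth_n_comp_merge gK gN rot4 rot2 b tg ov_rot Sc nconn.
      have := cardsD1 (kap (rot c)) A; rewrite A2; lia.
    have bS : kap (rot c) \notin S by apply: contra Mb => /(subsetP SA).
    apply: realized_merge => //; apply: rZ.
    - have /set0Pn[x xS] := S0; apply/set0Pn; exists x.
      by rewrite /merge_set; case: ifP; rewrite ?inE ?xS ?orbT.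
    - have SA' : S \subset A := subset_trans SA (subD1set _ _).
      by rewrite /merge_set; case: ifP => _ //; rewrite subUset sub1set A2.
    rewrite /merge_set; case: ifP => aS; first by rewrite !inE aS eqxx orbT.
    by rewrite aS (negPf bS).
  apply/val_mulz/valB.
    by apply: (vZ true) => S S0 SA e; have [_ /(_ e)[]] := HY S S0 SA.
  by apply: (vZ false) => S S0 SA e; have [_ /(_ e)[]] := HY S S0 SA.
- move=> S SA cS S0; have [_ _ _ H] := HY S S0 SA.
  by have [] := H cS.
- move=> S SA cS _ S0; have [_ _ _ H] := HY S S0 SA.
  have [|_ e1 e2] := H _; last by split.
  by rewrite (negPf cS).
move=> S SA cS rS; have S0 : S != set0 by apply/set0Pn; exists (kap c).
by have [_ _ H _] := HY S S0 SA; apply: H; rewrite cS.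
Qed.

End KauffmanCumulants.

Local Close Scope ring_scope.

Lemma oppdE d : oppd d = rotd (rotd d). Proof. by rewrite rotd2. Qed.

Lemma oppdK : involutive oppd.
Proof. by move=> d; rewrite !oppdE rotd4. Qed.

Lemma oppd_neq d : oppd d != d.
Proof. by rewrite oppdE rotd2_neq. Qed.

Lemma oppd_div d : oppd d %/ 4 = d %/ 4.
Proof. by rewrite oppdE !rotd_div. Qed.

(** * The given link, coloured by its components *)

Section Sublinks.

Variable D : diagram.
Hypothesis wfD : wf_diagram D.

Definition opp_dart (x : dart D) : dart D := rot_dart (rot_dart x).

Lemma val_opp_dart x : val (opp_dart x) = oppd (val x).
Proof. by rewrite /opp_dart val_rot_dart rot_dartE oppdE. Qed.

Local Notation E := (strand_rel (@glue_dart D) opp_dart pred0 predT).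

Lemma opp_tangle : tangle (@rot_dart D) opp_dart predT.
Proof.
split=> // [x|x]; first by rewrite /opp_dart rot_dart4.
exact: rot_dart2_neq.
Qed.

Lemma comprel_strand : comprel D =2 E.
Proof.
by move=> x y; rewrite /comprel /strand_rel /= -!val_eqE /= val_opp_dart val_glue_dart.
Qed.

Lemma comprel_sym : connect_sym (comprel D).
Proof.
move=> x y; rewrite !(eq_connect comprel_strand).
exact: full_strand_sym (glue_dartK wfD) (tg_qK opp_tangle) _ _.
Qed.

Definition comp_of (x : dart D) : ccomp D :=
  exist (fun y => fingraph.root (comprel D) y == y) (fingraph.root (comprel D) x)
    (introT eqP (root_root comprel_sym x)).

Definition lcomp_of (x : dart D) : lcomp D := inl (comp_of x).

Lemma lcomp_of_eq x y : (lcomp_of x == lcomp_of y) = connect (comprel D) x y.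
Proof.
rewrite -(root_connect comprel_sym); apply/eqP/eqP => [[]//|e].
by congr inl; apply: val_inj.
Qed.

Lemma lcomp_of_glue x : lcomp_of (glue_dart x) = lcomp_of x.
Proof.
apply/eqP; rewrite lcomp_of_eq comprel_sym; apply: connect1.
by rewrite comprel_strand /strand_rel eqxx.
Qed.

Lemma lcomp_of_opp x : lcomp_of (opp_dart x) = lcomp_of x.
Proof.
apply/eqP; rewrite lcomp_of_eq comprel_sym; apply: connect1.
by rewrite comprel_strand /strand_rel eqxx orbT.
Qed.

Definition is_free (c : lcomp D) : nat := if c is inr _ then 1 else 0.

(** Each component is its own colour; a crossingless circle carries no dart and is counted by
    [is_free]. *)
Lemma lcomp_coloring : planar D ->
  coloring (@glue_dart D) (@rot_dart D) opp_dart predT (fun x => odd x) lcomp_of setT is_free.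
Proof.
move=> plD; split.
- exact: opp_tangle.
- by move=> x; rewrite rot_dartE odd_rotd.
- exact: lcomp_of_glue.
- exact: lcomp_of_opp.
- by move=> x; rewrite inE.
- case=> [c|j] _; [right|by left]; exists (val c); congr inl; apply: val_inj => /=.
  exact/eqP/(valP c).
exact/(full_cycles_bound (glue_dartK wfD))/planarE.
Qed.

Lemma keepdartE (S : {set lcomp D}) (x : dart D) : keepdart D S x = (lcomp_of x \in S).
Proof.
apply/existsP/idP=> [[c /andP[cS /existsP[y /andP[/eqP/val_inj-> /eqP e]]]]|xS].
  suff -> : lcomp_of x = inl c by []; congr inl; exact: val_inj.
exists (comp_of x); rewrite xS; apply/existsP; exists x.
by rewrite !eqxx.
Qed.

Lemma sub_remE (S : {set lcomp D}) (x : dart D) :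
  ~~ sub_rem D S (x %/ 4) = restrict (@rot_dart D) predT (colored lcomp_of S) x.
Proof.
have xi : x %/ 4 < ncr D by have := ltn_ord x; lia.
pose b := base_dart (Ordinal xi).
have b0 : (4 * (x %/ 4))%N = b by [].
have b1 : (4 * (x %/ 4) + 1)%N = rot_dart b by rewrite rot_dartE /rotd /=; lia.
have b2 : (4 * (x %/ 4) + 2)%N = opp_dart b by rewrite !rot_dartE /rotd /=; lia.
have b3 : (4 * (x %/ 4) + 3)%N = opp_dart (rot_dart b) by rewrite !rot_dartE /rotd /=; lia.
rewrite /sub_rem negbK b1 b2 b3 b0 !keepdartE !lcomp_of_opp /restrict /colored /=.
have : x \in [:: b; rot_dart b; opp_dart b; opp_dart (rot_dart b)].
  have : x %% 4 < 4 by rewrite ltn_mod.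
  rewrite !inE -!val_eqE /= -b1 -b2 -b3; lia.
have L2 y : lcomp_of (rot_dart (rot_dart y)) = lcomp_of y := lcomp_of_opp y.
rewrite !inE => /or4P[] /eqP->; rewrite /opp_dart ?L2;
  by case: (lcomp_of b \in S); case: (lcomp_of (rot_dart b) \in S).
Qed.

Lemma free_in_lcomp (S : {set lcomp D}) :
  free_in is_free S = #|[set j : 'I_(nfree D) | inr j \in S]|.
Proof.
rewrite /free_in big_mkcond big_sumType /= big1 ?add0n => [|c _]; last by case: ifP.
by rewrite -big_mkcond /= sum1dep_card; apply: eq_card => j; rewrite !inE.
Qed.

Lemma sublink_realizes (S : {set lcomp D}) : exists io : dart (sublink D S) -> dart D,
  realizes (@glue_dart D) (@rot_dart D) opp_dart (restrict (@rot_dart D) predT (colored lcomp_of S))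
    (colored lcomp_of S) (fun x => odd x) (free_in is_free S) io /\
  forall d, val (io d) = olddart D (sub_rem D S) d.
Proof.
have keep_lt d : d < 4 * ncr D -> exists2 x : dart D, val x = d & keepdart D S d = (lcomp_of x \in S).
  by move=> dN; exists (Ordinal dN) => //; rewrite -keepdartE.
have dg d : d < 4 * ncr D -> ~~ keepdart D S (glue D d) = ~~ keepdart D S d.
  by case/keep_lt=> x <- ->; rewrite -[glue D (val x)]val_glue_dart // keepdartE lcomp_of_glue.
have dp d : d < 4 * ncr D -> ~~ keepdart D S (oppd d) = ~~ keepdart D S d.
  by case/keep_lt=> x <- ->; rewrite -val_opp_dart keepdartE lcomp_of_opp.
have dr d : d < 4 * ncr D -> ~~ sub_rem D S (d %/ 4) -> ~~ ~~ keepdart D S d.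
  by case/keep_lt=> x <- ->; rewrite sub_remE negbK => /and3P[].
have r := remove_realizes wfD oppd_div oppdK oppd_neq dg dp dr #|[set j : 'I_(nfree D) | inr j \in S]|.
have H1 : kept_crossing (sub_rem D S) =1 restrict (@rot_dart D) predT (colored lcomp_of S).
  by move=> x; rewrite -sub_remE.
have H2 : kept_dart (fun d => ~~ keepdart D S d) =1 colored lcomp_of S.
  by move=> x; rewrite /kept_dart negbK keepdartE.
have H3 (x : dart D) : partner_dart oppd x = opp_dart x.
  by apply: val_inj; rewrite val_opp_dart val_partner_dart //; apply: oppd_div.
rewrite free_in_lcomp; eexists; split.
  exact: (realizes_ext H1 H2 (fun _ _ => erefl) (fun x _ _ => H3 x) r).
by [].
Qed.

(** There are as many colours as components, which turns the bound 2L - 2 - c into L - 2. *)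
Lemma card_lcomp : #|lcomp D| = (free_in is_free setT + n_comp E (dart D))%N.
Proof.
rewrite card_sum card_ord addnC free_in_lcomp; congr addn.
  by rewrite -[LHS]card_ord -cardsT; apply: eq_card => j; rewrite !inE.
rewrite card_sig; have <- := eq_n_comp (eq_connect comprel_strand) (mem (dart D)).
by apply: eq_card => x; rewrite !inE andbT.
Qed.

Section Oriented.

Variable o : nat -> bool.
Hypothesis oP : valid_or D o.

Local Open Scope ring_scope.

Definition self_writhe (c : lcomp D) : int :=
  \sum_(x : dart D | [&& ~~ odd x, o x, lcomp_of x == c & lcomp_of (rot_dart x) == c])
    sgn_of (o (rot_dart (rot_dart (rot_dart x)))).

(** [lk2] collects the signs of crossings between different components, so the difference keeps the
    self-crossings, and these are grouped by component. A self-crossing survives in every sublink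
    that contains its component. *)
Lemma sublink_self_writhe (S : {set lcomp D}) :
  writhe (sublink D S) (sub_or D S o) - lk2 (sublink D S) (sub_or D S o) =
  \sum_(c in S) self_writhe c.
Proof.
have [io [rz ioE]] := sublink_realizes S.
pose oT (x : dart D) := o x.
have oq x : oT (opp_dart x) = ~~ oT x.
  have [e _] := oP (ltn_ord x); rewrite /oT -e; congr o; exact: val_opp_dart.
have colq x : colored lcomp_of S (opp_dart x) = colored lcomp_of S x.
  by rewrite /colored lcomp_of_opp.
have colg x : colored lcomp_of S (glue_dart x) = colored lcomp_of S x.
  by rewrite /colored lcomp_of_glue.
have tg := restrict_tangle opp_tangle colq.
have sc := restrict_closed (@rot_dart D) predT colg colq.
pose P x := lcomp_of x == lcomp_of (rot_dart x).
have Pq x : P (opp_dart x) = P x.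
  by rewrite /P lcomp_of_opp -[rot_dart (opp_dart x)]/(opp_dart (rot_dart x)) lcomp_of_opp.
have o_io (d : dart (sublink D S)) : sub_or D S o d = extend_or oT io d.
  by rewrite extend_orE /oT /sub_or -ioE.
have E1 (i : 'I_(ncr (sublink D S))) : (4 * i + 1)%N = rot_dart (base_dart i).
  by rewrite rot_dartE /rotd /=; lia.
have E2 (i : 'I_(ncr (sublink D S))) : (4 * i + 2)%N = rot_dart (rot_dart (base_dart i)).
  by rewrite !rot_dartE /rotd /=; lia.
have csE (i : 'I_(ncr (sublink D S))) :
    csign (sub_or D S o) i = csign (extend_or oT io) i.
  by rewrite /csign E1 E2 !o_io.
have sE (i : 'I_(ncr (sublink D S))) :
    samecomp (sublink D S) (4 * i) (4 * i + 1) = P (io (base_dart i)).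
  rewrite E1 -[(4 * i)%N]/(nat_of_ord (base_dart i)).
  rewrite (samecomp_dart (glue_dartK wfD) tg sc rz) (rz_rot rz).
  by rewrite -(eq_connect comprel_strand) -lcomp_of_eq.
rewrite /writhe /lk2 (bigID (fun i : 'I_(ncr (sublink D S)) =>
  samecomp (sublink D S) (4 * i) (4 * i + 1))) /= addrK.
rewrite (eq_bigr _ (fun i _ => csE i)) (eq_bigl _ _ sE).
rewrite (sum_csign (@rot_dart4 D) tg rz oq Pq).
rewrite (partition_big lcomp_of (mem S)) /= => [|x /and4P[/and3P[_ xS _] _ _ _]]; last exact: xS.
apply: eq_bigr => c cS; apply: eq_bigl => x; rewrite /restrict /colored /P /oT /=.
case: (lcomp_of x =P c) => [->|]; last by rewrite !andbF.
rewrite cS /= eq_sym; case: eqP => [->|]; last by rewrite !andbF.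
by rewrite cS !andbT.
Qed.

End Oriented.

End Sublinks.

(** * The valuation of the free energy *)

Section KauffmanFreeEnergy.

Local Open Scope ring_scope.

Variables (F : fieldType) (t z : F) (val : F -> int -> Prop).
Local Notation dl := (circle_val t z).
Hypothesis t_neq0 : t != 0.
Hypothesis charF : forall n, n.+1%:R != 0 :> F.
Hypothesis val0 : forall m, val 0 m.
Hypothesis valD : forall f h m, val f m -> val h m -> val (f + h) m.
Hypothesis valB : forall f h m, val f m -> val h m -> val (f - h) m.
Hypothesis valM : forall f h m n, val f m -> val h n -> val (f * h) (m + n).
Hypothesis val_le : forall f m n, m <= n -> val f n -> val f m.
Hypothesis val_z : val z 1.
Hypothesis val_t : forall k, val (t ^ k) 0.
Hypothesis val_dl : val dl (-1).

Variable Lam : diagram -> F.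
Hypothesis skein : forall D, wf_diagram D -> planar D -> forall i, (i < ncr D)%N ->
  Lam D - Lam (switch D i) = z * (Lam (smooth D i pair01) - Lam (smooth D i pair03)).
Hypothesis unlink : forall D o, wf_diagram D -> planar D -> valid_or D o ->
  (0 < ncomp D)%N -> descending D o -> Lam D = t ^ writhe D o * dl ^+ (ncomp D).-1.

(** The powers of t in the family combine into a product of weights over components. Such a product
    leaves the cumulant as a single factor, a power of t, of valuation 0. *)
Lemma free_energy_bound D o : wf_diagram D -> planar D -> valid_or D o ->
  (0 < #|lcomp D|)%N ->
  val (cumulant setT (fun S : {set lcomp D} =>
      t ^ lk2 (sublink D S) (sub_or D S o) * dl *
      (t ^ (- writhe (sublink D S) (sub_or D S o)) * Lam (sublink D S))))
    (#|lcomp D|%:Z - 2).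
Proof.
move=> wfD plD oP L0.
pose Y S := dl * Lam (sublink D S).
pose w c := t ^ (- self_writhe wfD o c).
have wE (S : {set lcomp D}) : \prod_(c in S) w c = t ^ (- \sum_(c in S) self_writhe wfD o c).
  elim/big_rec2: _ => [|c x y _ ->]; first by rewrite oppr0 expr0z.
  by rewrite opprD expfzDr.
rewrite (eq_cumulant (Y' := fun S => (\prod_(c in S) w c) * Y S)) => [|S _ _]; last first.
  rewrite wE -(sublink_self_writhe wfD oP) opprB expfzDr //; exact: mulrACA.
rewrite cumulant_weight wE -[X in val _ X]add0r; apply: valM; first exact: val_t.
have cl := lcomp_coloring wfD plD.
have T0 : [set: lcomp D] != set0 by rewrite -card_gt0 cardsT.
have rY (S : {set lcomp D}) : S != set0 -> S \subset setT ->
    realized t z Lam (@glue_dart D) (@rot_dart D) (@opp_dart D) predT (fun x => odd x)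
      (lcomp_of wfD) (@is_free D) S (Y S).
  by move=> _ _; have [io [rz _]] := sublink_realizes wfD S; exists (sublink D S), io.
have := cumulant_bound t_neq0 charF val0 valD valB valM val_le val_z val_t val_dl skein unlink
  (glue_dartK wfD) (@glue_dart_neq _ wfD) (@rot_dart4 D) (@rot_dart2_neq D) (leqnn _) cl T0 rY.
rewrite cardsT -card_lcomp //.
by have -> : 2 * #|lcomp D|%:Z - 2 - #|lcomp D|%:Z = #|lcomp D|%:Z - 2 by lia.
Qed.

End KauffmanFreeEnergy.

Local Open Scope ring_scope.

Lemma rat_char0 n : n.+1%:R != 0 :> rat.
Proof. by rewrite pnatr_eq0. Qed.

(** [FSO] is by conversion the cumulant over the set of all components. *)
Lemma FSO_bound (Lam : diagram -> FF) (D : diagram) (o : nat -> bool) :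
  kauffman_lambda Lam -> wf_diagram D -> planar D -> valid_or D o ->
  (0 < #|lcomp D|)%N -> zval_ge (FSO Lam D o) (#|lcomp D|%:Z - 2).
Proof.
case=> skein unlink wfD plD oP L0.
have Qt0 : forall n, n.+1%:R != 0 :> Qt := frac_char0 rat_char0.
have tc0 : FracField.tofrac ('X : {poly rat}) != 0 :> Qt := frac_X_neq0 _.
have t0 : tvar != 0 by rewrite /tvar tofrac_eq0 polyC_eq0.
exact: (free_energy_bound (F := FF) (t := tvar) (z := zvar) (val := zval_ge)
  t0 (frac_char0 Qt0) (@frac_val_ge0 Qt) (@frac_val_geD Qt) (@frac_val_geB Qt) (@frac_val_geM Qt)
  (@frac_val_ge_le Qt) (@frac_val_geX Qt) (fun k => frac_val_ge_const k tc0)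
  (frac_val_ge_delta tc0) skein unlink wfD plD oP L0).
Qed.

Theorem theorem7p1 (Lam : diagram -> FF) (D : diagram) (o : nat -> bool) :
  kauffman_lambda Lam -> wf_diagram D -> planar D -> valid_or D o ->
  (2 <= #|lcomp D|)%N ->
  ((3 <= #|lcomp D|)%N -> zval_ge (FSO Lam D o) (3%:Z - (#|lcomp D|)%:Z)) /\
  (#|lcomp D| = 2%N -> zval_ge (FSO Lam D o) 0).
Proof.
move=> kl wfD plD oP L2; have H := FSO_bound kl wfD plD oP (ltnW L2).
(* L - 2 is at least 3 - L as soon as 2L is at least 5, and it vanishes for L = 2. *)
by split=> L; apply: (frac_val_ge_le (K := Qt) _ H); move: L2 L; lia.
Qed.
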